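(* Let $\Omega\subset\mathbb{R}^d$ be open and let $c\in\mathcal{C}^2(\Omega^2)$ be infinitesimally twisted. Let $\mu_0,\mu_1$ be two compactly supported probability measures on $\Omega$, absolutely continuous with respect to the Lebesgue measure, with $H(\mu_i)<\infty$ for $i=0,1$. For $\varepsilon>0$ let $\gamma_\varepsilon$ be the minimizer of the entropic optimal transport problem with cost $c$ between $\mu_0$ and $\mu_1$, $OT_\varepsilon$ its value, and let $\gamma_0$ be an optimal transport plan for $\varepsilon=0$, with value $OT_0$. Then, as $\varepsilon\to0^+$, $$(c,\gamma_\varepsilon)-(c,\gamma_0)=\Theta(\varepsilon),\qquad H(\gamma_\varepsilon)=-\frac d2\ln(\varepsilon)+O(1),\qquad OT_\varepsilon=OT_0-\frac{d\varepsilon}{2}\ln(\varepsilon)+O(\varepsilon).$$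
   Context: A cost $c\in\mathcal{C}^2(\Omega^2)$ is infinitesimally twisted if the matrix $\nabla^2_{xy}c(x,y)=(\partial^2_{x_iy_j}c(x,y))_{i,j}\in M_d(\mathbb{R})$ is invertible for every $(x,y)\in\Omega^2$. $\Pi(\mu_0,\mu_1)$ is the set of probability measures with marginals $\mu_0,\mu_1$. $\mathcal{H}^k$ is the Lebesgue measure on $\mathbb{R}^k$. For a compactly supported probability measure $\mu$ on $\mathbb{R}^k$, $H(\mu)=H(\mu\mid\mathcal{H}^k)=\int\ln(\mu(x))\,d\mu(x)$ if $\mu$ has density $\mu(x)$, and $+\infty$ otherwise; $H(\gamma_\varepsilon)=H(\gamma_\varepsilon\mid\mathcal{H}^{2d})$. $(c,\gamma):=\int c\,d\gamma$. For $\varepsilon>0$, $OT_\varepsilon=\inf_{\gamma\in\Pi(\mu_0,\mu_1)}\int c\,d\gamma+\varepsilon H(\gamma\mid\mathcal{H}^{2d})$ with minimizer $\gamma_\varepsilon$; $OT_0=\inf_{\gamma\in\Pi(\mu_0,\mu_1)}\int c\,d\gamma$ and $\gamma_0$ is any minimizer (not necessarily unique). $f(\varepsilon)=\Theta(\varepsilon)$ means that there are constants $0<a\le b$ with $a\varepsilon\le f(\varepsilon)\le b\varepsilon$ for all small $\varepsilon>0$. *)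

(* Defs.v *)
From HB Require Import structures.
From mathcomp Require Import all_boot all_order all_algebra.
From mathcomp Require Import all_classical all_reals all_analysis.

Set Implicit Arguments.
Unset Strict Implicit.
Unset Printing Implicit Defensive.

Import Order.TTheory GRing.Theory Num.Theory.
Import numFieldNormedType.Exports.

Local Open Scope classical_set_scope.
Local Open Scope ring_scope.
Local Open Scope charge_scope.

Notation borel T := (g_sigma_algebraType (open : set (set T))).

Lemma borel_open (T : ptopologicalType) (U : set T) : open U ->
  measurable (U : set (borel T)).
Proof. by move=> oU; exact: sub_sigma_algebra. Qed.

Lemma borel_measurable_fun d (S : measurableType d) (T : ptopologicalType)
    (f : S -> borel T) :
  (forall U : set T, open U -> measurable (f @^-1` U)) -> measurable_fun setT f.
Proof.
move=> H; apply: (@measurability _ _ S (borel T) setT f (@open T)) => //.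
by move=> _ [U oU <-]; rewrite setTI; exact: H.
Qed.

(* The library's sigma-finiteness of [m1 \x m2] is shadowed by its instance for
   pairs of subprobabilities, hence this copy. *)
Section prod_measure.
Local Open Scope ereal_scope.
Context d1 d2 (T1 : measurableType d1) (T2 : measurableType d2) (R : realType).
Variable m1 : {sigma_finite_measure set T1 -> \bar R}.
Variable m2 : {sigma_finite_measure set T2 -> \bar R}.

Definition prod_measure : set (T1 * T2) -> \bar R := m1 \x m2.

HB.instance Definition _ := Measure.copy prod_measure (m1 \x m2).

Let prod_measure_sigma_finite : sigma_finite setT prod_measure.
Proof.
have /sigma_finiteP[F [TF ndF Foo]] := sigma_finiteT m1.
have /sigma_finiteP[G [TG ndG Goo]] := sigma_finiteT m2.
exists (fun n => F n `*` G n).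
  rewrite -setXTT TF TG predeqE => -[x y]; split.
    move=> [/= [n _ Fnx] [k _ Gky]]; exists (maxn n k) => //; split.
      by move: x Fnx; exact/subsetPset/ndF/leq_maxl.
    by move: y Gky; exact/subsetPset/ndG/leq_maxr.
  by move=> [n _ []/= ? ?]; split; exists n.
move=> k; have [? ?] := Foo k; have [? ?] := Goo k.
split; first exact: measurableX.
by rewrite /prod_measure product_measure1E// lte_mul_pinfty// ge0_fin_numE.
Qed.

HB.instance Definition _ :=
  Measure_isSigmaFinite.Build _ _ _ prod_measure prod_measure_sigma_finite.

End prod_measure.

Section lebesgue_measure_rV.
Context {R : realType}.

Definition rV_cons n (p : measurableTypeR R * borel 'rV[R]_n) :
    borel 'rV[R]_n.+1 :=
  row_mx (p.1%:M : 'M[R]_1) (p.2 : 'rV_n).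

Definition rV_uncons n (v : borel 'rV[R]_n.+1) :
    measurableTypeR R * borel 'rV[R]_n :=
  ((v : 'rV_n.+1) ord0 ord0, rsubmx (v : 'rV_(1 + n))).

Lemma rV_consK n : cancel (@rV_cons n) (@rV_uncons n).
Proof.
case=> x v; rewrite /rV_cons /rV_uncons /= row_mxKr; congr pair.
transitivity (row_mx (x%:M : 'M[R]_1) (v : 'rV_n) ord0 (lshift n ord0)).
  by congr (row_mx _ _ _ _); exact: val_inj.
by rewrite row_mxEl mxE eqxx.
Qed.

Lemma measurable_rV_coord n (i : 'I_n) : measurable_fun setT
  ((fun v : 'rV[R]_n => v ord0 i) : borel 'rV[R]_n -> measurableTypeR R).
Proof.
apply: (measurability _ (measurable_realfun.RGenOpens.measurableE R)).
move=> _ [_ [a [b ->] <-]]; rewrite setTI; apply: borel_open.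
apply: open_comp; last exact: interval_open.
by move=> v _; exact: coord_continuous.
Qed.

Lemma measurable_rV_uncons n : measurable_fun setT (@rV_uncons n).
Proof.
apply/measurable_fun_pairP; split; first exact: measurable_rV_coord.
apply: borel_measurable_fun => U oU; apply: borel_open.
by apply: open_comp => // v _; exact: continuous_rsubmx.
Qed.

Lemma measurable_rV_cons n : measurable_fun setT (@rV_cons n).
Proof.
apply: borel_measurable_fun => V oV.
pose D (i : rat * 'rV[rat]_n * nat) : set (R * 'rV[R]_n) :=
  ball (ratr i.1.1 : R) i.2.+1%:R^-1 `*`
  ball (map_mx ratr i.1.2 : 'rV[R]_n) i.2.+1%:R^-1.
pose W := (fun p : R * 'rV[R]_n =>
  row_mx (p.1%:M : 'M[R]_1) p.2 : 'rV[R]_n.+1) @^-1` V.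
rewrite [X in measurable X](_ : _ =
  \bigcup_i (if `[< D i `<=` W >] then D i else set0)); last first.
  apply/seteqP; split; last first.
    move=> p [i _]; case: asboolP => // DW; exact: DW.
  move=> [x v] Vxv.
  have /nbhs_ballP[e /= e0 eV] : nbhs (rV_cons (x, v) : 'rV[R]_n.+1) V.
    exact: open_nbhs_nbhs.
  have [k ke] : exists k : nat, k.+1%:R^-1 < e / 2.
    have e2 : 0 < e / 2 by rewrite divr_gt0.
    have [k _ kP] := near_infty_natSinv_lt (PosNum e2).
    by exists k; apply: kP => /=.
  have k0 : (0 : R) < k.+1%:R^-1 by rewrite invr_gt0.
  have appr (y : R) : exists q : rat, `|ratr q - y| < k.+1%:R^-1.
    have /rat_in_itvoo[q /itvP qP] : y < y + k.+1%:R^-1 by rewrite ltrDl.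
    exists q; rewrite gtr0_norm ?subr_gt0 ?qP//.
    by rewrite ltrBlDl qP.
  have [q qx] := appr x.
  have [w wP] := choice (fun j => appr (v ord0 j)).
  exists (q, \row_j w j, k) => //=.
  have Dxv : D (q, \row_j w j, k) (x, v).
    split; first by rewrite /ball/=.
    split => // i j; rewrite !mxE ord1; exact: wP.
  case: asboolP => // /(_ _); case=> [[y u]] [/= By [_ Bu]].
  have [/= Bx [_ Bv]] := Dxv.
  apply: eV; split => // i j; rewrite /rV_cons ord1.
  rewrite /ball /= in Bx By.
  case: (fintype.split_ordP (j : 'I_(1 + n))) => j' ->.
    rewrite (row_mxEl (x%:M : 'M[R]_1) v) (row_mxEl (y%:M : 'M[R]_1) u).
    rewrite !mxE !ord1 !eqxx /ball /=.
    rewrite -(subrK (ratr q) x) -addrA (le_lt_trans (ler_normD _ _))//.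
    rewrite [ltRHS]splitr ltrD// ?(lt_trans _ ke)//.
    by rewrite distrC.
  rewrite (row_mxEr (x%:M : 'M[R]_1) v) (row_mxEr (y%:M : 'M[R]_1) u).
  have := Bu ord0 j'; have := Bv ord0 j'; rewrite /ball /= !mxE => b1 b2.
  rewrite -(subrK (ratr (w j')) (v ord0 j')) -addrA.
  rewrite (le_lt_trans (ler_normD _ _))//.
  rewrite [ltRHS]splitr ltrD// ?(lt_trans _ ke)//.
  by rewrite distrC.
apply: countable_bigcupT_measurable => // i.
case: asboolP => // _; apply: measurableX.
  exact: (@measurable_realfun.measurable_ball R).
by apply: borel_open; exact: ball_open.
Qed.

Section cons.
Variables (n : nat) (m : {sigma_finite_measure set (borel 'rV[R]_n) -> \bar R}).

Definition lebesgue_cons : set (borel 'rV[R]_n.+1) -> \bar R :=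
  pushforward (prod_measure lebesgue_measure m) (@rV_cons n).

Let cons_measure : {measure set (borel 'rV[R]_n.+1) -> \bar R} :=
  measure_function_pushforward__canonical__measure_function_Measure
    (prod_measure lebesgue_measure m) (@measurable_rV_cons n).

HB.instance Definition _ := @isMeasure.Build _ _ _ lebesgue_cons
  (@measure0 _ _ _ cons_measure) (@measure_ge0 _ _ _ cons_measure)
  (@measure_semi_sigma_additive _ _ _ cons_measure).

Let sf : sigma_finite setT lebesgue_cons.
Proof.
have [F FT Foo] := sigma_finiteT (prod_measure lebesgue_measure m).
exists (fun k => @rV_uncons n @^-1` F k).
  by rewrite -preimage_bigcup -FT.
move=> k; have [mF Fk] := Foo k; split.
  by rewrite -[X in measurable X]setTI; exact: measurable_rV_uncons.
rewrite /lebesgue_cons /pushforward.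
rewrite [X in (_ X < _)%E](_ : _ = F k)//.
by apply/seteqP; split => p /=; rewrite rV_consK.
Qed.

HB.instance Definition _ := Measure_isSigmaFinite.Build _ _ _ lebesgue_cons sf.
End cons.

Fixpoint lebesgue_rV n :
    {sigma_finite_measure set (borel 'rV[R]_n) -> \bar R} :=
  match n with
  | 0 => \d_(0 : borel 'rV[R]_0)
  | n.+1 => lebesgue_cons (lebesgue_rV n)
  end.

End lebesgue_measure_rV.
Section lebesgue_rV_box.
Context {R : realType}.

Definition rV_box n (a b : 'I_n -> R) : set (borel 'rV[R]_n) :=
  [set v | forall i, (v : 'rV_n) ord0 i \in `]a i, b i]].

Lemma measurable_rV_box n (a b : 'I_n -> R) : measurable (rV_box a b).
Proof.
rewrite (_ : rV_box a b = \bigcap_(i in [set: 'I_n])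
    (fun v : borel 'rV[R]_n => (v : 'rV_n) ord0 i) @^-1` `]a i, b i]).
  apply: (@fin_bigcap_measurable _ (borel 'rV[R]_n) _ [set: 'I_n]).
    exact: finite_finset.
  move=> i _.
  rewrite -[X in measurable X]setTI.
  exact: (@measurable_rV_coord R n i measurableT _ (measurable_itv _)).
by apply/seteqP; split => v /= vab i; [move=> _|]; exact: vab.
Qed.

Lemma lebesgue_rV_box n (a b : 'I_n -> R) : (forall i, a i <= b i) ->
  lebesgue_rV n (rV_box a b) = (\prod_i (b i - a i))%:E.
Proof.
elim: n => [|n IH] in a b *; move=> ab.
  by rewrite big_ord0 /= diracE mem_set// => -[].
pose s (i : 'I_n) : 'I_n.+1 := lift ord0 i.
rewrite big_ord_recl EFinM -(IH (a \o s) (b \o s))//; last first.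
  by move=> i; exact: ab.
rewrite /= /lebesgue_cons /pushforward.
rewrite [X in prod_measure _ _ X = _](_ : _ =
    `]a ord0, b ord0] `*` rV_box (a \o s) (b \o s)).
  rewrite /prod_measure product_measure1E//=; last exact: measurable_rV_box.
  rewrite lebesgue_measure_itv/= lte_fin EFinB.
  case: ltP => // ba; have -> : a ord0 = b ord0 by apply/eqP; rewrite eq_le ab.
  by rewrite subee.
have cons0 x (v : 'rV[R]_n) : rV_cons (x, v) ord0 ord0 = x.
  by have := rV_consK (x, v) => /(congr1 fst).
have consS x (v : 'rV[R]_n) i : rV_cons (x, v) ord0 (s i) = v ord0 i.
  rewrite /rV_cons [s i](_ : _ = rshift 1 i); last exact: ord_inj.
  exact: (row_mxEr (x%:M : 'M[R]_1) v).
apply/seteqP; split => -[x v].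
  move=> H; split; first by have := H ord0; rewrite cons0.
  by move=> i; have := H (s i); rewrite consS.
case=> /= xab vab i; case: (unliftP ord0 i) => [j|] ->.
  by have := vab j; rewrite -(consS x).
by rewrite cons0; exact: xab.
Qed.

End lebesgue_rV_box.

(* The value of [ln] outside positive reals is irrelevant: the density is finite
   and positive [P]-almost everywhere. *)
Section entropy.
Local Open Scope ereal_scope.
Context d (T : measurableType d) (R : realType).

Definition entropy (P : probability T R)
    (m : {sigma_finite_measure set T -> \bar R}) : \bar R :=
  if `[< P `<< m >] then
    \int[P]_x (ln (fine ('d (charge_of_finite_measure P) '/d m x)))%:E
  else +oo.

End entropy.

Definition msupport {R : realType} {T : ptopologicalType}
    (m : set (borel T) -> \bar R) : set T :=
  [set x | forall U : set T, open U -> U x -> m U != 0%E].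

Definition compactly_supported_in {R : realType} {T : ptopologicalType}
    (Omega : set T) (m : set (borel T) -> \bar R) :=
  compact (msupport m) /\ msupport m `<=` Omega.

Section coupling.
Context d0 d1 (T0 : measurableType d0) (T1 : measurableType d1) (R : realType).

Definition coupling (mu0 : probability T0 R) (mu1 : probability T1 R) :
    set (probability (T0 * T1)%type R) :=
  [set g | (forall A, measurable A -> pushforward g fst A = mu0 A) /\
           (forall B, measurable B -> pushforward g snd B = mu1 B)].

End coupling.

(* On an open [U], [f] is of class C^k+1 iff it is Frechet differentiable and
   its differential is C^k, that is, so are all [x |-> 'd f x v = 'D_v f x]. *)
Fixpoint class_C {R : realType} {V : normedModType R} (k : nat) (U : set V)
    (f : V -> R) : Prop :=
  if k is k'.+1 then
    (forall x, U x -> differentiable f x) /\ (forall v, class_C k' U ('D_v f))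
  else forall x, U x -> {for x, continuous f}.

Section transport.
Context {R : realType} {d : nat}.
Implicit Types (c : 'rV[R]_d * 'rV[R]_d -> R) (Omega : set 'rV[R]_d).

Definition hessian_xy c (x y : 'rV[R]_d) : 'M[R]_d :=
  \matrix_(i, j)
    'D_((delta_mx 0 i, 0) : 'rV_d * 'rV_d)
      ('D_((0, delta_mx 0 j) : 'rV_d * 'rV_d) c) (x, y).

Definition infinitesimally_twisted Omega c :=
  forall x y, Omega x -> Omega y -> hessian_xy c x y \in unitmx.

Local Notation plan :=
  (probability (borel 'rV[R]_d * borel 'rV[R]_d)%type R).
Implicit Types (mu nu : probability (borel 'rV[R]_d) R) (g : plan).

Local Open Scope ereal_scope.

(* [c] is only meaningful on [Omega `*` Omega], which carries all the mass of a
   plan between measures concentrated on [Omega]. *)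
Definition transport_cost Omega c g : \bar R :=
  \int[g]_(z in Omega `*` Omega) (c z)%:E.

Definition plan_entropy g : \bar R :=
  entropy g (prod_measure (lebesgue_rV d) (lebesgue_rV d)).

Definition entropic_cost Omega c (e : R) g : \bar R :=
  transport_cost Omega c g + e%:E * plan_entropy g.

Definition OT Omega c mu nu : \bar R :=
  ereal_inf [set transport_cost Omega c g | g in coupling mu nu].

Definition entropic_OT Omega c mu nu (e : R) : \bar R :=
  ereal_inf [set entropic_cost Omega c e g | g in coupling mu nu].

Definition minimizer_on (A : set plan) (J : plan -> \bar R) g :=
  A g /\ forall g', A g' -> J g <= J g'.

Definition Theta_at0 (f : R -> \bar R) := exists a b : R,
  [/\ (0 < a)%R, (a <= b)%R &
      \forall e \near 0^'+, (a * e)%:E <= f e <= (b * e)%:E].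

End transport.

(* Main.v *)
From HB Require Import structures.
Require Import Defs.
From mathcomp Require Import all_boot all_order all_algebra.
From mathcomp Require Import ring lra.
From mathcomp Require Import all_classical all_reals all_analysis measurable_realfun.

(** Let [D(p, q) = c(x, y) + c(x', y') - c(x, y') - c(x', y)] for [p = (x, y)] and
    [q = (x', y')]; it is [mixed_diff c p q], the saving when [p] and [q] exchange
    their targets. Given a symmetric coupling [Q] of a plan [g] with itself and a
    symmetric set [S] of pairs, exchanging targets on [S] produces a plan of cost
    [(c, g) - 1/2 * int_S D dQ] ([resample_plan]). That cost is at least [OT_0], so
    [int_S D dQ] is at most twice the gap [E(g) = (c, g) - OT_0]. Such couplings are
    obtained from a finite partition, by drawing two independent points of a common
    cell.

    The twist makes [D] coercive. Near a point where the mixed Hessian of [c] is [M],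
    [D] is close to [dx M dy^T]; with [u = y - x M] this is [|z|^2 + z . du] for
    [z = dx M], whence [|dx|^2 <= C * (D + C * |du|^2)] ([twisted_patch_near], a form
    of Minty's trick). Finitely many such patches cover the product of the supports.
    Fixing the patch and locating [u] in a grid of mesh [delta] makes
    [O(delta^-d)] cells, in each of which [|dx|^2 <= C * (D + C * delta^2)].

    Lower bound on the entropy ([plan_entropy_ge]). Two independent points of a common
    cell satisfy [int |dx|^2 dQ <= C * (E(g) + delta^2)], so that in its cell a point of
    the plan is, in mean square, at distance [O(delta)] of some centre as soon as
    [E(g) = O(delta^2)]. As [u] is known up to [delta] as well, the plan lives on a set
    of volume [O(delta^-d * delta^(2 * d))]. Gibbs' inequality against a density constant
    on shells of width [delta] gives
    [H(g) >= - d * ln delta - L * (1 + E(g) / delta^2)].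

    Upper bound ([block_plan]). For an optimal plan, [E = 0] and [D <= 0] for almost all
    pairs of a common cell, hence [|dx| <= C * delta] and [|dy| <= C * delta]: the plan
    charges [O(delta^-d)] products of two grid cubes ([positive_blocks_card]).
    Resampling targets inside each of these blocks costs [O(delta^2)] and leaves a plan
    whose density is at most [1 / p_B] times the product of the densities of the
    marginals on the block [B] of mass [p_B]; its entropy is at most
    [H(mu0) + H(mu1) + ln N], where [N] is the number of charged blocks.

    With [delta^2] of order [eps], the two bounds give
    [OT_eps = OT_0 - (d / 2) * eps * ln eps + O(eps)]. The entropy of the minimizer is
    a slope of the concave function [eps |-> OT_eps], which is compared between [eps],
    [2 * eps] and [eps / 2]. Thus the gap is [O(eps)]. If it were smaller than [rho * eps]
    with [rho] small, the lower bound at [delta^2] of order [rho * eps] would contradict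
    the upper bound on the entropy ([entropic_asymptotics]). *)

Set Implicit Arguments.
Unset Strict Implicit.
Unset Printing Implicit Defensive.

Import Order.TTheory GRing.Theory Num.Theory.
Import numFieldNormedType.Exports.

Local Open Scope classical_set_scope.
Local Open Scope ring_scope.

(** * Borel sets of a product, and supports *)

Section borel_product.
Context {R : realType} {d : nat}.
Local Notation V := 'rV[R]_d.

(** Balls with rational centre and radius [1 / k.+1], enumerated by [nat]: a countable
    basis, which turns every open set into a countable union. *)
Definition rat_ball (n : nat) : set V :=
  if unpickle n is Some (w, k) then
    ball (map_mx ratr (w : 'rV[rat]_d) : V) (k : nat).+1%:R^-1
  else set0.

Lemma open_rat_ball n : open (rat_ball n).
Proof.
by rewrite /rat_ball; case: unpickle => [[w k]|]; [exact: ball_open|exact: open0].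
Qed.

Lemma rat_ball_basis (U : set V) x : open U -> U x ->
  exists2 n, rat_ball n x & rat_ball n `<=` U.
Proof.
move=> oU Ux.
have /nbhs_ballP[e /= e0 eU] : nbhs x U by exact: open_nbhs_nbhs.
have [k ke] : exists k : nat, k.+1%:R^-1 < e / 2.
  have e2 : 0 < e / 2 by rewrite divr_gt0.
  have [k _ kP] := near_infty_natSinv_lt (PosNum e2).
  by exists k; apply: kP => /=.
have k0 : (0 : R) < k.+1%:R^-1 by rewrite invr_gt0.
have appr (y : R) : exists q : rat, `|ratr q - y| < k.+1%:R^-1.
  have /rat_in_itvoo[q /itvP qP] : y < y + k.+1%:R^-1 by rewrite ltrDl.
  exists q; rewrite gtr0_norm ?subr_gt0 ?qP//.
  by rewrite ltrBlDl qP.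
have [w wP] := choice (fun j => appr (x ord0 j)).
have xw : ball (map_mx ratr (\row_j w j) : V) k.+1%:R^-1 x.
  by split => // i j; rewrite !mxE ord1; exact: wP.
exists (pickle (\row_j w j : 'rV[rat]_d, k)); rewrite /rat_ball pickleK//.
move=> y wy; apply: eU.
rewrite (splitr e); apply: (@ball_triangle _ _ (map_mx ratr (\row_j w j) : V)).
  by apply: ball_sym; exact: le_ball (ltW ke) _ xw.
exact: le_ball (ltW ke) _ wy.
Qed.

(** The product of the Borel sigma-algebras contains the open sets of the product
    because [rat_ball] is a countable basis. *)
Lemma open_product_measurable (W : set (V * V)) : open W ->
  measurable (W : set (borel V * borel V)).
Proof.
move=> oW.
pose B (n : nat * nat) : set (borel V * borel V) :=
  rat_ball n.1 `*` rat_ball n.2.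
rewrite [X in measurable X](_ : _ =
  \bigcup_n (if `[< B n `<=` W >] then B n else set0)).
  apply: countable_bigcupT_measurable => // n.
  case: asboolP => // _; apply: measurableX;
    by apply: borel_open; exact: open_rat_ball.
apply/seteqP; split=> [[x y] Wxy|z [n _]]; last first.
  by case: asboolP => // nW; exact: nW.
have [[U1 U2]/= [U1x U2y] UW] : nbhs (x, y) W by exact: open_nbhs_nbhs.
have [n1 n1x n1U] := @rat_ball_basis U1° x (open_interior _) U1x.
have [n2 n2y n2U] := @rat_ball_basis U2° y (open_interior _) U2y.
exists (n1, n2) => //; case: asboolP => [_|[]]; first by split.
move=> [a b] [/= a1 b2]; apply: UW; split => /=.
  by apply: interior_subset; exact: n1U.
by apply: interior_subset; exact: n2U.
Qed.

Lemma continuous_product_measurable (W : set (V * V)) (f : V * V -> R) :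
  open W -> (forall z, W z -> {for z, continuous f}) ->
  measurable_fun (W : set (borel V * borel V))
    (f : borel V * borel V -> measurableTypeR R).
Proof.
move=> oW cf.
apply: (measurability _ (measurable_realfun.RGenOpens.measurableE R)).
move=> _ [_ [a [b ->] <-]]; apply: open_product_measurable.
rewrite openE => z [Wz fz]; apply: filterI; first exact: open_nbhs_nbhs.
by apply: cf => //; apply: open_nbhs_nbhs; split => //; exact: interval_open.
Qed.

End borel_product.

Section support.
Context {R : realType} {d : nat}.
Local Notation V := 'rV[R]_d.
Variable m : {measure set (borel V) -> \bar R}.

Let null_ball n : set (borel V) :=
  if `[< m (rat_ball n) = 0%E >] then rat_ball n else set0.

Let measurable_null_ball n : measurable (null_ball n).
Proof.
rewrite /null_ball; case: asboolP => // _; apply: borel_open.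
exact: open_rat_ball.
Qed.

Let msupportC : ~` msupport m = \bigcup_n null_ball n.
Proof.
apply/seteqP; split=> [x|x [n _]].
  move=> /existsNP[U] /not_implyP[oU /not_implyP[Ux /negP]].
  rewrite negbK => /eqP mU0; have [n nx nU] := rat_ball_basis oU Ux.
  exists n => //; rewrite /null_ball; case: asboolP => // -[].
  apply/eqP; rewrite eq_le measure_ge0 andbT -mU0.
  apply: le_measure => //; rewrite inE; apply: borel_open => //.
  exact: open_rat_ball.
rewrite /null_ball; case: asboolP => // mn0 nx /(_ _ (@open_rat_ball R d n) nx).
by rewrite mn0 eqxx.
Qed.

Lemma measurable_msupport : measurable (msupport m : set (borel V)).
Proof.
rewrite -[X in measurable X]setCK; apply: measurableC; rewrite msupportC.
exact: bigcupT_measurable.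
Qed.

(** The complement of the support is the union of the null balls of the countable
    basis. *)
Lemma measure_msupportC : m (~` msupport m) = 0%E.
Proof.
rewrite msupportC; apply/eqP; rewrite eq_le measure_ge0 andbT.
apply: (le_trans (measure_sigma_subadditive _ measurable_null_ball _ _)) => //.
  exact: bigcupT_measurable.
by rewrite eseries0// => n _ _; rewrite /null_ball; case: asboolP.
Qed.

End support.

(** * Mixed differences of a twisted cost *)

Section line.
Context {R : realType} {V : normedModType R}.

Lemma is_derive_line (f : V -> R) (x v : V) (t : R) :
  derivable f (x + t *: v) v ->
  is_derive t (1 : R) (fun s : R => f (x + s *: v)) ('D_v f (x + t *: v)).
Proof.
move=> df.
have E : (fun h : R => h^-1 *: (((fun s : R => f (x + s *: v)) \o shift t) (h *: (1 : R))
      - f (x + t *: v))) =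
    (fun h => h^-1 *: ((f \o shift (x + t *: v)) (h *: v) - f (x + t *: v))).
  apply/funext => h /=; congr (_ *: (f _ - _)).
  by rewrite /shift /= [h *: (1:R)]mulr1 scalerDl addrCA.
by split; rewrite ?/derivable /derive E.
Qed.

Lemma MVT_line (f : V -> R) (x v : V) :
  (forall t : R, 0 <= t <= 1 -> differentiable f (x + t *: v)) ->
  exists2 t : R, 0 <= t <= 1 & f (x + v) - f x = 'D_v f (x + t *: v).
Proof.
move=> df.
have dl (t : R) : 0 <= t <= 1 -> is_derive t (1 : R) (fun s : R => f (x + s *: v))
    ('D_v f (x + t *: v)).
  by move=> t01; apply: is_derive_line; exact/diff_derivable/df.
have [||t t01] := @MVT_segment R (fun s : R => f (x + s *: v))
  (fun t : R => 'D_v f (x + t *: v)) 0 1 ler01.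
- by move=> t; rewrite in_itv /= => /andP[t0 t1]; apply: dl; rewrite !ltW.
- apply: derivable_within_continuous => t; rewrite in_itv /= => t01.
  by have [] := dl t t01.
rewrite scale0r scale1r addr0 subr0 mulr1 => E; exists t => //.
Qed.
End line.

(** The saving in transport cost when [p] and [q] exchange their targets. *)
Definition mixed_diff {R : zmodType} {S T : Type} (c : S * T -> R) (p q : S * T) :=
  c p + c q - c (p.1, q.2) - c (q.1, p.2).

Section mixed.
Context {R : realType} {d : nat}.
Local Notation V := 'rV[R]_d.

Lemma bilin_mx_sum (M : 'M[R]_d) (a b : V) :
  (a *m M *m b^T) 0 0 = \sum_i \sum_j a 0 i * b 0 j * M i j.
Proof.
rewrite mxE exchange_big /=; apply: eq_bigr => j _.
rewrite mxE big_distrl /=; apply: eq_bigr => i _.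
by rewrite mxE mulrAC.
Qed.

(** [mixed_diff c p q] is a difference in [x] of an increment of [c] in [y]: the mean
    value theorem is applied in [y] first, then in [x] to the derivative that it
    yields. *)
Lemma mixed_diff_mean (U : set (V * V)) (c : V * V -> R) (p q : V * V) :
  class_C 2 U c ->
  (forall s t : R, 0 <= s <= 1 -> 0 <= t <= 1 ->
     U (p.1 + s *: (q.1 - p.1), p.2 + t *: (q.2 - p.2))) ->
  exists s t : R, [/\ 0 <= s <= 1, 0 <= t <= 1 &
    mixed_diff c p q = ((q.1 - p.1) *m
      hessian_xy c (p.1 + s *: (q.1 - p.1)) (p.2 + t *: (q.2 - p.2))
      *m (q.2 - p.2)^T) 0 0].
Proof.
move=> [dc dcC] Useg; case: p q Useg => [x y] [x' y'] /=.
set dx := x' - x; set dy := y' - y => Useg.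
pose v : V * V := (0, dy); pose w : V * V := (dx, 0).
have pE (a b a' b' : V) (t : R) :
  (a, b) + t *: (a', b') = (a + t *: a', b + t *: b') :> V * V by [].
have U0 (t : R) : 0 <= t <= 1 -> U ((x, y) + t *: v).
  move=> t01; have := Useg 0 t; rewrite scale0r addr0 lexx ler01 => /(_ isT t01).
  by rewrite pE scaler0 addr0.
have U1 (t : R) : 0 <= t <= 1 -> U ((x', y) + t *: v).
  move=> t01; have := Useg 1 t; rewrite lexx ler01 => /(_ isT t01).
  by rewrite pE scaler0 addr0 scale1r addrC subrK.
pose e (j : 'I_d) : V * V := (0, delta_mx 0 j).
pose e' (i : 'I_d) : V * V := (delta_mx 0 i, 0).
have vE : v = \sum_j dy 0 j *: e j.
  apply: injective_projections; rewrite [RHS]raddf_sum /=; last first.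
    by rewrite [dy in LHS]row_sum_delta.
  by rewrite big1 // => j _; rewrite scaler0.
have wE : w = \sum_i dx 0 i *: e' i.
  apply: injective_projections; rewrite [RHS]raddf_sum /=.
    by rewrite [dx in LHS]row_sum_delta.
  by rewrite big1 // => j _; rewrite scaler0.
have DE z : U z -> 'D_v c z = \sum_j dy 0 j * 'D_(e j) c z.
  move=> Uz; rewrite deriveE; last exact: dc.
  rewrite vE linear_sum; apply: eq_bigr => j _.
  by rewrite linearZ /= -deriveE//; exact: dc.
have [||t t01] := @MVT_segment R (fun t : R => c ((x', y) + t *: v) - c ((x, y) + t *: v))
  (fun t : R => 'D_v c ((x', y) + t *: v) - 'D_v c ((x, y) + t *: v)) 0 1 ler01.
- move=> t /= t01; apply: is_deriveB; apply: is_derive_line;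
    apply: diff_derivable; apply: dc; [apply: U1|apply: U0];
    by move: t01; rewrite in_itv /= => /andP[/ltW -> /ltW ->].
- apply: derivable_within_continuous => t; rewrite in_itv /= => t01.
  by apply: derivableB; apply: ex_derive; apply: is_derive_line;
    apply: diff_derivable; apply: dc; [apply: U1|apply: U0].
rewrite in_itv /= in t01.
have [U0t U1t] := (U0 t t01, U1 t t01).
rewrite scale0r scale1r subr0 mulr1 !addr0 (DE _ U0t) (DE _ U1t) => E.
pose h (j : 'I_d) : V * V -> R := dy 0 j \*: ('D_(e j) c : V * V -> R).
pose g (z : V * V) : R := \sum_j h j z.
have gE z : g z = \sum_j dy 0 j * 'D_(e j) c z by [].
have gS : g = \sum_j h j by rewrite fct_sumE.
have stE (s : R) : (x, y) + t *: v + s *: w = (x + s *: dx, y + t *: dy).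
  by rewrite !pE !scaler0 !addr0 /= scaler0 addr0.
have Ust (s : R) : 0 <= s <= 1 -> U (((x, y) + t *: v) + s *: w).
  by move=> s01; rewrite stE; exact: Useg.
have dD j z : U z -> differentiable ('D_(e j) c) z by exact: (dcC (e j)).1.
have dg z : U z -> differentiable g z.
  move=> Uz; rewrite gS; apply: differentiable_sum => j.
  by apply: differentiableZ; exact: dD.
have [s s01] := @MVT_line R (V * V)%type g ((x, y) + t *: v) w
  (fun s s01 => dg _ (Ust s s01)).
have -> : (x, y) + t *: v + w = (x', y) + t *: v.
  by rewrite addrAC; congr (_ + _); congr pair; rewrite ?addr0// addrC subrK.
rewrite !gE -E => E'; exists s, t; split => //.
transitivity (c ((x', y) + v) - c ((x, y) + v) - (c (x', y) - c (x, y))).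
  have vy (a : V) : (a, y) + v = (a, y').
    by congr pair; rewrite /= ?addr0// addrC subrK.
  by rewrite /mixed_diff !vy /=; ring.
have := Ust s s01; set z := (x, y) + t *: v + s *: w => Uz.
have zE := stE s; rewrite -/z in zE.
rewrite E' -/z bilin_mx_sum exchange_big /=.
rewrite gS derive_sum; last first.
  by move=> j; apply: derivableZ; apply: diff_derivable; exact: dD.
apply: eq_bigr => j _; rewrite deriveZ /=; last exact/diff_derivable/dD.
rewrite deriveE; last exact: dD.
rewrite wE linear_sum scaler_sumr; apply: eq_bigr => i _.
rewrite linearZ /= -deriveE; last exact: dD.
rewrite /hessian_xy [X in _ = _ * X]mxE -zE.
by rewrite -[LHS]/(_ * (_ * _)) mulrA [X in X * _ = _]mulrC.
Qed.
End mixed.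

Section norms.
Context {R : realType}.

Lemma mx_entry_le_norm m n (A : 'M[R]_(m, n)) i j : `|A i j| <= `|A|.
Proof.
rewrite [X in _ <= X]mx_normrE.
by apply: (le_bigmax _ (fun ij : 'I_m * 'I_n => `|A ij.1 ij.2|) (i, j)).
Qed.

Lemma mx_norm_le m n (A : 'M[R]_(m, n)) e : 0 <= e ->
  (forall i j, `|A i j| <= e) -> `|A| <= e.
Proof.
move=> e0 Ae; rewrite [X in X <= _]mx_normrE.
by apply: bigmax_le => // -[i j] _; exact: Ae.
Qed.

Lemma norm_mulmx m n p (x : 'M[R]_(m, n)) (A : 'M[R]_(n, p)) :
  `|x *m A| <= n%:R * `|x| * `|A|.
Proof.
apply: mx_norm_le => [|i j]; first by rewrite !mulr_ge0.
rewrite mxE (le_trans (ler_norm_sum _ _ _))//.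
rewrite -mulrA [leRHS](_ : _ = \sum_(k < n) `|x| * `|A|); last first.
  by rewrite sumr_const card_ord mulr_natl.
apply: ler_sum => k _; rewrite normrM ler_pM//; exact: mx_entry_le_norm.
Qed.

Lemma sum_sqr_ge_norm n (x : 'rV[R]_n) : `|x| ^+ 2 <= \sum_j x 0 j * x 0 j.
Proof.
have x20 j : 0 <= x 0 j * x 0 j by rewrite -expr2 sqr_ge0.
have [E|] := eqVneq `|x| 0; first by rewrite E expr0n/= sumr_ge0.
move=> /mx_norm_neq0[[i j] /= E]; rewrite [`|x|]E ord1.
rewrite real_normK ?num_real// expr2 (bigD1 j) //= lerDl.
exact: sumr_ge0.
Qed.

Lemma norm_dot_le n (x y : 'rV[R]_n) :
  `|\sum_j x 0 j * y 0 j| <= n%:R * (`|x| * `|y|).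
Proof.
rewrite (le_trans (ler_norm_sum _ _ _))//.
rewrite [leRHS](_ : _ = \sum_(k < n) `|x| * `|y|); last first.
  by rewrite sumr_const card_ord mulr_natl.
apply: ler_sum => k _; rewrite normrM ler_pM//; exact: mx_entry_le_norm.
Qed.

Lemma norm_bilin_le n (M : 'M[R]_n) (a b : 'rV[R]_n) :
  `|(a *m M *m b^T) 0 0| <= n%:R ^+ 2 * `|M| * (`|a| * `|b|).
Proof.
rewrite mxE; under eq_bigr do rewrite [b^T _ _]mxE.
rewrite (le_trans (norm_dot_le _ _))//.
apply: (@le_trans _ _ (n%:R * (n%:R * `|a| * `|M| * `|b|))).
  by rewrite ler_wpM2l// ler_wpM2r// norm_mulmx.
by rewrite le_eqVlt; apply/orP; left; apply/eqP; ring.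
Qed.

Lemma ball_segment (V : normedModType R) (x p q : V) (r s : R) :
  ball x r p -> ball x r q -> 0 <= s <= 1 -> ball x r (p + s *: (q - p)).
Proof.
rewrite -ball_normE /ball_ /= => xp xq /andP[s0 s1].
have -> : x - (p + s *: (q - p)) = (1 - s) *: (x - p) + s *: (x - q).
  rewrite opprD addrA -scalerN opprB scalerBl scale1r -[RHS]addrA; congr (_ + _).
  rewrite addrC -scalerBr opprB; congr (_ *: _).
  by rewrite [RHS]addrC addrA subrK.
rewrite (le_lt_trans (ler_normD _ _))// !normrZ ger0_norm ?subr_ge0//.
rewrite (ger0_norm s0).
have [->|s1'] := eqVneq s 1; first by rewrite subrr mul0r add0r mul1r.
have s1lt : 0 < 1 - s by rewrite subr_gt0 lt_neqAle s1' s1.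
have h1 : (1 - s) * `|x - p| < (1 - s) * r by rewrite ltr_pM2l.
have h2 : s * `|x - q| <= s * r by rewrite ler_wpM2l// ltW.
by rewrite (lt_le_trans (ltr_leD h1 h2))// -mulrDl subrK mul1r.
Qed.
End norms.

Lemma open_setX (S T : topologicalType) (A : set S) (B : set T) :
  open A -> open B -> open (A `*` B).
Proof.
move=> oA oB; rewrite openE => z [Az Bz].
by exists (A, B) => //; split; exact: open_nbhs_nbhs.
Qed.

Section patches.
Context {R : realType} {d : nat}.
Local Notation V := 'rV[R]_d.

(** In the coordinates [(x, u)] with [u = shear M (x, y)], the bilinear form
    [dx M dy^T] is [|dx M|^2 + (dx M) . du]. *)
Definition shear (M : 'M[R]_d) (p : V * V) : V := p.2 - p.1 *m M.

Lemma shear_sub M p q :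
  q.2 - p.2 = (shear M q - shear M p) + (q.1 - p.1) *m M.
Proof.
rewrite /shear mulmxBl; move: (q.1 *m M) (p.1 *m M) => a b.
rewrite opprB addrA [_ + (b - p.2) + a]addrAC subrK -addrA.
by rewrite [b - p.2 - b]addrAC subrr add0r.
Qed.

(** The two estimates that the mixed Hessian of a twisted cost provides locally: the
    mixed difference is at most bilinear, and it controls the displacement of [p.1] up to
    that of the sheared coordinate. *)
Definition twisted_patch (c : V * V -> R) (U : set (V * V)) M (C : R) :=
  forall p q, U p -> U q ->
    `|mixed_diff c p q| <= C * (`|q.1 - p.1| * `|q.2 - p.2|) /\
    `|q.1 - p.1| ^+ 2 <= C * (mixed_diff c p q + C * `|shear M q - shear M p| ^+ 2).

(** To be read with the norms [X] of [dx], [Y] of [dy], [Z] of [dx M], [W] of the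
    increment of the shear, and [D] the mixed difference: the cross terms are absorbed
    in [Z ^+ 2] by completing a square. *)
Lemma twisted_quadratic (n B X Y Z W D e : R) :
  0 <= n -> 0 < B -> 0 <= X -> 0 <= Y -> 0 <= Z -> 0 <= W -> 0 <= e ->
  X <= B * Z -> Y <= W + Z -> e * B <= 4^-1 ->
  Z ^+ 2 - n * (Z * W) - e * (X * Y) <= D ->
  X ^+ 2 <= 4 * B ^+ 2 * (D + (n + 1) ^+ 2 * W ^+ 2).
Proof.
move=> n0 B0 X0 Y0 Z0 W0 e0 XBZ YWZ eB HD.
have h1 : e * (X * Y) <= 4^-1 * (Z * (W + Z)).
  apply: (@le_trans _ _ (e * (B * Z * (W + Z)))).
    by rewrite ler_wpM2l// ler_pM.
  have -> : e * (B * Z * (W + Z)) = e * B * (Z * (W + Z)) by ring.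
  by rewrite ler_wpM2r// mulr_ge0// addr_ge0.
have h2 : Z ^+ 2 <= 4 * (D + (n + 1) ^+ 2 * W ^+ 2).
  have : 0 <= (Z - 2 * (n + 1) * W) ^+ 2 by exact: sqr_ge0.
  have : 0 <= Z * W by exact: mulr_ge0.
  have : 0 <= W ^+ 2 by exact: sqr_ge0.
  nra.
apply: (@le_trans _ _ ((B * Z) ^+ 2)).
  by rewrite ler_sqr ?nnegrE ?mulr_ge0// ltW.
have -> : 4 * B ^+ 2 * (D + (n + 1) ^+ 2 * W ^+ 2) =
  B ^+ 2 * (4 * (D + (n + 1) ^+ 2 * W ^+ 2)) by ring.
by rewrite exprMn ler_wpM2l// sqr_ge0.
Qed.

(** Minty's trick. By [mixed_diff_mean] the mixed difference is [dx H dy^T] for a matrix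
    [H] close to [M], and [dx M dy^T] is coercive in [dx] once [dy] is written as
    [dx M + du]; the error [dx (H - M) dy^T] is absorbed when [H - M] is small compared
    with [M^-1]. *)
Lemma twisted_patch_near (Omega : set V) (c : V * V -> R) (w : V * V) :
  open Omega -> class_C 2 (Omega `*` Omega) c ->
  infinitesimally_twisted Omega c -> (Omega `*` Omega) w ->
  exists r M C, [/\ 0 < r, 1 <= C & twisted_patch c (ball w r) M C].
Proof.
move=> oO cC tw Ow; pose M := hessian_xy c w.1 w.2.
have Mu : M \in unitmx by apply: tw; case: Ow.
(* [B] bounds [|dx|] by [|dx M|], and [d^2 * e * B <= 1 / 4] leaves a coercive form *)
pose B : R := d%:R * `|invmx M| + 1.
have B0 : 0 < B by rewrite ltr_wpDl// mulr_ge0.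
pose e : R := (4 * B * (d%:R ^+ 2 + 1))^-1.
have e0 : 0 < e by rewrite invr_gt0 !mulr_gt0// ltr_wpDl// sqr_ge0.
have oOO : open (Omega `*` Omega) by exact: open_setX.
have subE (A N : 'M[R]_d) i j : (A - N) i j = A i j - N i j by rewrite !mxE.
have hessE z i j : hessian_xy c z.1 z.2 i j =
    'D_((delta_mx 0 i, 0) : V * V) ('D_((0, delta_mx 0 j) : V * V) c) z.
  by case: z => x y; rewrite mxE.
have : \forall z \near w, (Omega `*` Omega) z /\
    `|hessian_xy c z.1 z.2 - M| <= e.
  apply: filterI; first exact: open_nbhs_nbhs.
  have H1 : \forall z \near w, forall i j, `|(hessian_xy c z.1 z.2 - M) i j| <= e.
    apply: (@filter_forall _ _ (fun i z => forall j, `|(hessian_xy c z.1 z.2 - M) i j| <= e) (nbhs w)) => i.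
    apply: (@filter_forall _ _ (fun j z => `|(hessian_xy c z.1 z.2 - M) i j| <= e) (nbhs w)) => j.
    have := (cC.2 (0, delta_mx 0 j)).2 (delta_mx 0 i, 0) _ Ow.
    move=> /cvgrPdistC_le/(_ _ e0) H2; apply: (filterS _ H2) => z.
    by rewrite (etrans (subE _ _ _ _) (f_equal2 (fun a b => a - b) (hessE z i j) (hessE w i j))).
  by apply: (filterS _ H1) => z Hz; apply: mx_norm_le => //; exact: ltW.
move=> /nbhs_ballP[r /= r0 rP].
pose C0 : R := 4 * B ^+ 2 + (d%:R + 1) ^+ 2 + d%:R ^+ 2 * (`|M| + e) + 1.
exists r, M, C0; split=> //.
  by rewrite lerDr addr_ge0// ?addr_ge0 ?mulr_ge0 ?sqr_ge0 ?addr_ge0// ltW.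
move=> p q rp rq.
have [||s [t [s01 t01 ->]]] := @mixed_diff_mean _ _ (Omega `*` Omega) c p q.
- by [].
- move=> s t s01 t01; apply: (rP _ _).1.
  by split; apply: ball_segment => //; [exact: rp.1|exact: rq.1|exact: rp.2|exact: rq.2].
set H := hessian_xy c _ _; set dx := q.1 - p.1; set dy := q.2 - p.2.
have HM : `|H - M| <= e.
  have := (rP (p.1 + s *: dx, p.2 + t *: dy) _).2; apply.
  by split; apply: ball_segment => //; [exact: rp.1|exact: rq.1|exact: rp.2|exact: rq.2].
split.
  rewrite (le_trans (norm_bilin_le _ _ _))// ler_wpM2r ?mulr_ge0//.
  have HMe : `|H| <= `|M| + e.
    by rewrite -[H](subrK M) (le_trans (ler_normD _ _))// addrC lerD2l.
  apply: (@le_trans _ _ (d%:R ^+ 2 * (`|M| + e))).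
    by rewrite ler_wpM2l// sqr_ge0.
  rewrite /C0 -addrA [leRHS]addrC -addrA lerDl.
  by rewrite !addr_ge0 ?mulr_ge0 ?sqr_ge0 ?addr_ge0 // ltW.
pose z := dx *m M; set D := (_ *m _ *m _) 0 0.
set W := `|shear M q - shear M p|.
have dyE : dy = (shear M q - shear M p) + z by exact: shear_sub.
have key : `|dx| ^+ 2 <= 4 * B ^+ 2 * (D + (d%:R + 1) ^+ 2 * W ^+ 2).
  apply: (@twisted_quadratic d%:R B _ `|dy| `|z| W D (d%:R ^+ 2 * e)) => //.
  - by rewrite /W.
  - by rewrite mulr_ge0 ?sqr_ge0 ?ltW.
  - have -> : dx = z *m invmx M by rewrite /z mulmxK.
    rewrite (le_trans (norm_mulmx _ _))// mulrAC ler_wpM2r// /B.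
    by rewrite lerDl.
  - by rewrite dyE (le_trans (ler_normD _ _)).
  - have k0 : (0 : R) <= d%:R ^+ 2 by exact: sqr_ge0.
    rewrite /e; move: (d%:R ^+ 2) k0 => k k0.
    have k1 : 0 < k + 1 by rewrite ltr_wpDl.
    have -> : k / (4 * B * (k + 1)) * B = 4^-1 * (k / (k + 1)).
      by field; rewrite gt_eqF// gt_eqF.
    by rewrite ler_piMr ?invr_ge0// ler_pdivrMr// mul1r lerDl.
  - have -> : D = (z *m dy^T) 0 0 + (dx *m (H - M) *m dy^T) 0 0.
      have E : dx *m H *m dy^T = z *m dy^T + dx *m (H - M) *m dy^T.
        by rewrite mulmxBr (mulmxBl (dx *m H)) [RHS]addrC subrK.
      have addE (A N : 'M[R]_1) : (A + N) 0 0 = A 0 0 + N 0 0 by rewrite mxE.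
      exact: etrans (congr1 (fun A : 'M[R]_1 => A 0 0) E) (addE _ _).
    have := norm_bilin_le (H - M) dx dy; rewrite ler_norml => /andP[h _].
    have : d%:R ^+ 2 * `|H - M| * (`|dx| * `|dy|) <= d%:R ^+ 2 * e * (`|dx| * `|dy|).
      by rewrite ler_wpM2r ?mulr_ge0// ler_wpM2l// sqr_ge0.
    have -> : (z *m dy^T) 0 0 =
        \sum_j z 0 j * z 0 j + \sum_j z 0 j * (shear M q - shear M p) 0 j.
      rewrite mxE -big_split; apply: eq_bigr => j _ /=.
      by rewrite [dy^T _ _]mxE dyE [(_ + z) _ _]mxE mulrDr addrC.
    have := norm_dot_le z (shear M q - shear M p); rewrite ler_norml => /andP[h1 _].
    have := sum_sqr_ge_norm z.
    rewrite -/W in h1; move: h h1; lra.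
apply: (le_trans key).
have P0 : 0 <= D + (d%:R + 1) ^+ 2 * W ^+ 2.
  have := le_trans (sqr_ge0 _) key; rewrite pmulr_rge0// mulr_gt0//.
  by rewrite exprn_gt0.
have [C01 C02] : 4 * B ^+ 2 <= C0 /\ (d%:R + 1) ^+ 2 <= C0.
  have a1 : 0 <= 4 * B ^+ 2 by rewrite mulr_ge0// sqr_ge0.
  have a2 : 0 <= (d%:R + 1 : R) ^+ 2 by rewrite sqr_ge0.
  have a3 : 0 <= d%:R ^+ 2 * (`|M| + e).
    by rewrite mulr_ge0 ?sqr_ge0 ?addr_ge0// ltW.
  by rewrite /C0; split; lra.
apply: ler_pM => //.
  by rewrite mulr_ge0// sqr_ge0.
by rewrite lerD2l ler_wpM2r// sqr_ge0.
Qed.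
End patches.

Section patches_cover.
Context {R : realType} {d : nat}.
Local Notation V := 'rV[R]_d.

Lemma twisted_patch_le c (U U' : set (V * V)) M (C C' : R) : 1 <= C -> C <= C' ->
  U' `<=` U -> twisted_patch c U M C -> twisted_patch c U' M C'.
Proof.
move=> C1 CC' UU' tw p q Up Uq; have [h1 h2] := tw p q (UU' _ Up) (UU' _ Uq).
split; first by rewrite (le_trans h1)// ler_wpM2r// mulr_ge0.
have C0 : 0 < C by exact: lt_le_trans ltr01 C1.
have h0 : 0 <= mixed_diff c p q + C * `|shear M q - shear M p| ^+ 2.
  by rewrite -(pmulr_rge0 _ C0) (le_trans _ h2)// sqr_ge0.
apply: (le_trans h2); apply: ler_pM => //; first exact: ltW.
by rewrite lerD2l ler_wpM2r// sqr_ge0.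
Qed.

Lemma compact_pair_cover (K : set (V * V)) : compact K -> cover_compact K.
Proof.
pose S := [the topologicalType of (V * V)%type].
pose PT : ptopologicalType := HB.pack S (isPointed.Build S (0, 0)).
by move=> cK; rewrite -(@compact_cover PT).
Qed.

(** Each patch of a finite subcover is doubled: the least radius [r] of the cover is then
    such that the ball of radius [r] around any point of [K] lies in one patch
    (Lebesgue's number lemma). *)
Lemma patches_exist (Omega : set V) (c : V * V -> R) (K : set (V * V)) :
  open Omega -> class_C 2 (Omega `*` Omega) c ->
  infinitesimally_twisted Omega c -> compact K -> K `<=` Omega `*` Omega ->
  exists (s : seq (set (V * V) * 'M[R]_d)) (r C : R), [/\ 0 < r, 1 <= C,
    (forall U, U \in s -> [/\ open U.1, twisted_patch c U.1 U.2 C & `|U.2| <= C]) &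
    (forall p, K p -> exists2 U, U \in s & ball p r `<=` U.1)].
Proof.
move=> oO cC tw cK KO.
have /choice[rMC H] : forall w : V * V, exists x : R * 'M[R]_d * R, K w ->
    [/\ 0 < x.1.1, 1 <= x.2 & twisted_patch c (ball w (2 * x.1.1)) x.1.2 x.2].
  move=> w; have [Kw|nKw] := pselect (K w); last by exists (0, 0, 0).
  have [r [M [C [r0 C1 twM]]]] := twisted_patch_near oO cC tw (KO _ Kw).
  exists (r / 2, M, C) => _ /=; split => //; first by rewrite divr_gt0.
  by rewrite mulrC divfK.
have [] := compact_pair_cover cK (D := K) (f := fun w => ball w (rMC w).1.1).
- by move=> w Kw; exact: ball_open.
- by move=> w Kw; exists w => //; apply: ballxx; have [] := H w Kw.
move=> D DK Dcov.
pose C := \big[Order.max/1]_(w <- finmap.enum_fset D) Order.max (rMC w).2 `|(rMC w).1.2|.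
pose r := \big[Order.min/1]_(w <- finmap.enum_fset D) (rMC w).1.1.
exists [seq (ball w (2 * (rMC w).1.1), (rMC w).1.2) | w <- finmap.enum_fset D], r, C.
have C1 : 1 <= C by exact: bigmax_ge_id.
split => //.
- rewrite /r big_seq; elim/big_ind : _ => //.
    by move=> x y x0 y0; rewrite lt_min x0 y0.
  move=> w wD; have Kw : K w by apply/set_mem/DK.
  by have [] := H w Kw.
- move=> U /mapP[w wD ->] /=.
  have Kw : K w by apply/set_mem/DK.
  have [r0 Cw tww] := H w Kw.
  have : Order.max (rMC w).2 `|(rMC w).1.2| <= C.
    exact: (@Order.TotalTheory.le_bigmax_seq _ _ _ _ _ w xpredT
      (fun w => Order.max (rMC w).2 `|(rMC w).1.2|) wD isT).
  rewrite ge_max => /andP[CC MC].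
  split=> //; first exact: ball_open.
  exact: twisted_patch_le tww.
- move=> p Kp; have [w /= wD wp] := Dcov p Kp.
  exists (ball w (2 * (rMC w).1.1), (rMC w).1.2) => /=; first by apply/mapP; exists w.
  have rw : r <= (rMC w).1.1.
    exact: (@Order.TotalTheory.ge_bigmin_seq _ _ _ _ _ w xpredT (fun w => (rMC w).1.1) wD isT).
  move=> q pq; rewrite [2 * _]mulrDl mul1r; apply: ball_triangle wp _.
  exact: le_ball rw _ pq.
Qed.

End patches_cover.

(** * Measurable maps with finitely many values *)

Lemma measurable_fun_mem d (T : measurableType d) (K : set T) :
  measurable K -> measurable_fun setT (fun x => x \in K).
Proof.
move=> mK; apply: (measurable_fun_bool true); rewrite setTI.
rewrite [X in measurable X](_ : _ = K)//.
by apply/seteqP; split=> x /= h; [exact: set_mem|exact: mem_set].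
Qed.

Section measurable_fibers.
Context d (X : measurableType d).

Definition measurable_fibers (T : Type) (idx : X -> T) :=
  forall t, measurable (idx @^-1` [set t]).

Lemma measurable_fibers_map (T : countType) T' (idx : X -> T) (h : T -> T') :
  measurable_fibers idx -> measurable_fibers (h \o idx).
Proof.
move=> mi t'.
rewrite (_ : _ @^-1` _ =
  \bigcup_(t : T) (if `[< h t = t' >] then idx @^-1` [set t] else set0)).
  by apply: countable_bigcupT_measurable => // t; case: asboolP.
apply/seteqP; split=> [w /= hw|w [t _]]; first by exists (idx w) => //; case: asboolP.
by case: asboolP => // ht /= E; rewrite E.
Qed.

(** A map into a countable type with measurable fibers is measurable for the discrete
    sigma-algebra. *)
Lemma measurable_fun_of_fibers (T : countType) d' (X' : measurableType d') (idx : X -> T)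
    (h : T -> X') : measurable_fibers idx -> measurable_fun setT (h \o idx).
Proof.
move=> mi _ B mB; rewrite setTI.
have := measurable_fibers_map (fun t => `[< B (h t) >]) mi true; congr measurable.
by apply/seteqP; split=> w /= /asboolP.
Qed.

Lemma measurable_fibers_pair T T' (i : X -> T) (j : X -> T') :
  measurable_fibers i -> measurable_fibers j ->
  measurable_fibers (fun w => (i w, j w)).
Proof.
move=> mi mj [t t']; have := measurableI _ _ (mi t) (mj t').
by congr measurable; apply/seteqP; split=> w /=; [case=> -> ->|case=> -> ->].
Qed.

Lemma measurable_fibers_ffun (I : finType) (T : Type) (i : I -> X -> T) :
  (forall a, measurable_fibers (i a)) ->
  measurable_fibers (fun w => [ffun a => i a w]).
Proof.
move=> mi t; rewrite (_ : _ @^-1` _ = \bigcap_(a in [set: I]) (i a @^-1` [set t a])).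
  by apply: fin_bigcap_measurable => // a _; exact: mi.
apply/seteqP; split=> [w /= E a _|w H] /=; first by rewrite -E ffunE.
by apply/ffunP => a; rewrite ffunE; exact: H.
Qed.

Lemma measurable_fibers_comp d' (X' : measurableType d') T (phi : X' -> X) (i : X -> T) :
  measurable_fun setT phi -> measurable_fibers i ->
  forall t, measurable ((i \o phi) @^-1` [set t]).
Proof.
move=> mphi mi t; rewrite -[X in measurable X]setTI.
exact: (mphi measurableT (i @^-1` [set t]) (mi t)).
Qed.

Lemma measurable_fun_pred (b : X -> bool) :
  measurable_fun setT b -> measurable [set w | b w].
Proof.
by move=> mb; rewrite -[X in measurable X]setTI; exact: (mb measurableT [set true]).
Qed.

(** [Num.truncn] vanishes on negative numbers, which makes the fiber of [0] special. *)
Lemma measurable_fibers_truncn (R : realType) (g : X -> R) :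
  measurable_fun setT g -> measurable_fibers (fun w => Num.truncn (g w)).
Proof.
move=> mg k.
have mk n : measurable [set w | (n < Num.truncn (g w))%N].
  rewrite (_ : [set _ | _] = [set w | n.+1%:R <= g w]); last first.
    by apply/seteqP; split=> w /=; rewrite truncn_gt_nat.
  apply: (@measurable_fun_pred (fun w => n.+1%:R <= g w)).
  exact: (measurable_fun_ler (measurable_cst _) mg).
case: k => [|k].
  rewrite (_ : _ @^-1` _ = ~` [set w | (0 < Num.truncn (g w))%N]).
    exact: measurableC.
  by apply/seteqP; split=> w /=; [move=> ->|move=> /negP; rewrite -eqn0Ngt => /eqP].
rewrite (_ : _ @^-1` _ = [set w | (k < Num.truncn (g w))%N] `\`
   [set w | (k.+1 < Num.truncn (g w))%N]); first exact: measurableD.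
apply/seteqP; split=> w /=; first by move=> ->; rewrite ltnS leqnn ltnn.
by move=> [h /negP]; rewrite -leqNgt => h'; apply/eqP; rewrite eqn_leq h h'.
Qed.

Lemma measurable_fibers_find (s : seq (set X)) :
  (forall U, U \in s -> measurable U) ->
  measurable_fibers (fun w => find (fun U => w \in U) s).
Proof.
elim: s => [_ k|U s IH ms k] /=.
  case: k => [|k].
    by rewrite (_ : _ @^-1` _ = setT)//; apply/seteqP; split.
  by rewrite (_ : _ @^-1` _ = set0)//; apply/seteqP; split.
have mU : measurable U by apply: ms; rewrite inE eqxx.
have {}IH := IH (fun V Vs => ms V (mem_behead (s := U :: s) Vs)).
case: k => [|k].
  rewrite (_ : _ @^-1` _ = U)//; apply/seteqP; split=> w /=.
    by case: ifP => // /set_mem.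
  by move=> Uw; rewrite mem_set.
rewrite (_ : _ @^-1` _ = (fun w => find (fun U => w \in U) s) @^-1` [set k] `\` U).
  exact: measurableD.
apply/seteqP; split=> w /=.
  by case: ifPn => // /negP nU [->]; split => // Uw; apply: nU; exact: mem_set.
by move=> [<- nU]; rewrite ifN//; apply/negP => /set_mem.
Qed.

End measurable_fibers.


Section measurability.
Context d (X : measurableType d) {R : realType} {n : nat}.

Lemma measurable_norm_rV (phi : X -> 'rV[R]_n) :
  (forall a, measurable_fun setT (fun w => phi w 0 a)) ->
  measurable_fun setT (fun w => `|phi w|).
Proof.
move=> mphi.
rewrite (_ : (fun w => _) =
  (fun w => \big[Order.max/0]_(ij <- index_enum ('I_1 * 'I_n)%type) `|phi w ij.1 ij.2|)); last first.
  by apply/funext => w; rewrite [LHS]mx_normrE.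
elim: (index_enum _) => [|[i j] e IH].
  by under eq_fun do rewrite big_nil; exact: measurable_cst.
under eq_fun do rewrite big_cons.
apply: measurable_maxr => //=; rewrite ord1.
exact: (measurableT_comp (@normr_measurable R setT) (mphi j)).
Qed.

Lemma measurable_eq_fiber (T : finType) (idx : X -> T) :
  measurable_fibers idx -> measurable_fun setT (fun z : X * X => idx z.1 == idx z.2).
Proof.
move=> mi; apply: (measurable_fun_bool true); rewrite setTI.
rewrite (_ : _ @^-1` _ = \bigcup_(t in [set: T]) ((idx @^-1` [set t]) `*` (idx @^-1` [set t]))).
  by apply: fin_bigcup_measurable => // t _; exact: measurableX.
apply/seteqP; split=> [[a b] /= /eqP E|[a b] [t _ [/= -> ->]]]; last exact: eqxx.
by exists (idx a).
Qed.

Definition same_fiber (T : eqType) (K : set X) (idx : X -> T) (z : X * X) : bool :=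
  [&& z.1 \in K, z.2 \in K & idx z.1 == idx z.2].

Lemma same_fiberC (T : eqType) (K : set X) (idx : X -> T) p q :
  same_fiber K idx (p, q) = same_fiber K idx (q, p).
Proof. by rewrite /same_fiber /= andbCA eq_sym. Qed.

Lemma measurable_same_fiber (T : finType) (K : set X) (idx : X -> T) :
  measurable K -> measurable_fibers idx -> measurable_fun setT (same_fiber K idx).
Proof.
move=> mK mi; apply: measurable_and.
  exact: (measurableT_comp (measurable_fun_mem mK) measurable_fst).
apply: measurable_and; last exact: measurable_eq_fiber.
exact: (measurableT_comp (measurable_fun_mem mK) measurable_snd).
Qed.

End measurability.

(** * Exchanging targets in a self-coupling *)

Section bounded_measurable.
Context {R : realType}.

Definition bounded_measurable d (T : measurableType d) (f : T -> R) :=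
  measurable_fun setT f /\ exists M, forall x, `|f x| <= M.

Lemma bounded_measurable_integrable d (T : measurableType d) (P : probability T R) f :
  bounded_measurable f -> P.-integrable setT (EFin \o f).
Proof.
move=> [mf [M fM]]; apply: measurable_bounded_integrable => //.
  by rewrite (le_lt_trans (probability_le1 P measurableT))// ltry.
exists M; split; first exact: num_real.
by move=> x Mx y _; apply: (le_trans (fM y)); exact: ltW.
Qed.

Lemma bounded_measurable_comp d d' (T : measurableType d) (T' : measurableType d')
    (phi : T -> T') (f : T' -> R) :
  measurable_fun setT phi -> bounded_measurable f -> bounded_measurable (f \o phi).
Proof.
move=> mphi [mf [M fM]]; split; first exact: measurableT_comp.
by exists M => x /=.
Qed.

Lemma bounded_measurableD d (T : measurableType d) (f g : T -> R) :
  bounded_measurable f -> bounded_measurable g -> bounded_measurable (fun x => f x + g x).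
Proof.
move=> [mf [M fM]] [mg [N gN]]; split; first exact: measurable_funD.
by exists (M + N) => x; rewrite (le_trans (ler_normD _ _))// lerD.
Qed.

Lemma bounded_measurableB d (T : measurableType d) (f g : T -> R) :
  bounded_measurable f -> bounded_measurable g -> bounded_measurable (fun x => f x - g x).
Proof.
move=> [mf [M fM]] [mg [N gN]]; split; first exact: measurable_funB.
by exists (M + N) => x; rewrite (le_trans (ler_normB _ _))// lerD.
Qed.

Lemma bounded_measurable_if d (T : measurableType d) (s : T -> bool) (f : T -> R) :
  measurable_fun setT s -> bounded_measurable f ->
  bounded_measurable (fun x => if s x then f x else 0).
Proof.
move=> ms [mf [M fM]]; split; first exact: measurable_fun_ifT.
exists M => x; case: ifP => // _; rewrite normr0.
exact: le_trans (fM x).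
Qed.

Lemma bounded_measurable_cst d (T : measurableType d) (k : R) :
  bounded_measurable (fun _ : T => k).
Proof. by split => //; exists `|k|. Qed.

Lemma law_exists d d' (T : measurableType d) (T' : measurableType d')
    (P : probability T R) (phi : T -> T') : measurable_fun setT phi ->
  exists P' : probability T' R, forall A, P' A = P (phi @^-1` A).
Proof.
move=> mphi; pose m := isMeasurableFun.Build _ _ _ _ _ mphi.
pose phi' : {mfun T >-> T'} := HB.pack phi m.
by exists (distribution P phi').
Qed.

Lemma Rintegral_law d d' (T : measurableType d) (T' : measurableType d')
    (P : probability T R) (P' : probability T' R) (phi : T -> T') (f : T' -> R) :
  measurable_fun setT phi ->
  (forall A, measurable A -> P' A = P (phi @^-1` A)) ->
  bounded_measurable f ->
  \int[P']_x f x = \int[P]_x f (phi x).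
Proof.
move=> mphi P'E bf; pose m := isMeasurableFun.Build _ _ _ _ _ mphi.
pose phi' : {mfun T >-> T'} := HB.pack phi m.
rewrite /Rintegral; congr fine.
rewrite (eq_measure_integral (distribution P phi')); last first.
  by move=> A mA _; apply: P'E.
rewrite integral_distribution//; first exact/measurable_EFinP/(bf.1).
exact/bounded_measurable_integrable/(bounded_measurable_comp mphi bf).
Qed.

Lemma le_Rintegral_bounded d (T : measurableType d) (P : probability T R) (f g : T -> R) :
  bounded_measurable f -> bounded_measurable g -> (forall x, f x <= g x) ->
  \int[P]_x f x <= \int[P]_x g x.
Proof.
by move=> bf bg fg; apply: le_Rintegral => //; exact: bounded_measurable_integrable.
Qed.

End bounded_measurable.

(** Invariance under the exchange of the copies makes both marginals equal to [P]. *)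
Definition self_coupling d (T : measurableType d) (R : realType)
    (P : probability T R) (Q : probability (T * T)%type R) :=
  (forall E, measurable E -> Q (swap_pair @^-1` E) = Q E) /\
  (forall E, measurable E -> Q (fst @^-1` E) = P E).

Section resampling.
Context d1 d2 (T1 : measurableType d1) (T2 : measurableType d2) {R : realType}.
Local Notation X := (T1 * T2)%type.
Variables (P : probability X R) (Q : probability (X * X)%type R).
Variable s : X * X -> bool.

Definition resample (z : X * X) : X := if s z then (z.1.1, z.2.2) else z.1.

Hypotheses (hQ : self_coupling P Q) (ms : measurable_fun setT s)
  (sC : forall p q, s (p, q) = s (q, p)).

Lemma measurable_resample : measurable_fun setT resample.
Proof.
apply: measurable_fun_ifT => //; apply: measurable_fun_pair.
  exact: measurableT_comp measurable_fst measurable_fst.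
exact: measurableT_comp measurable_snd measurable_snd.
Qed.

Lemma resample_fst A : measurable A ->
  Q (resample @^-1` (fst @^-1` A)) = P (fst @^-1` A).
Proof.
move=> mA; rewrite -hQ.2; last first.
  by rewrite -[X in measurable X]setTI; exact: measurable_fst.
by congr (Q _); apply/seteqP; split=> -[p q]; rewrite /resample /=; case: ifP.
Qed.

(** Where [s] holds the target is read on the second point; the exchange of the copies
    preserves [Q] and [s], so that part has the law of the target of the first point. *)
Lemma resample_snd B : measurable B ->
  Q (resample @^-1` (snd @^-1` B)) = P (snd @^-1` B).
Proof.
move=> mB; pose S := s @^-1` [set true].
have mS : measurable S by rewrite -[X in measurable X]setTI; exact: ms.
have mB1 : measurable (fst @^-1` (snd @^-1` B) : set (X * X)).
  rewrite -[X in measurable X]setTI.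
  exact: (measurableT_comp measurable_snd measurable_fst).
have mB2 : measurable (snd @^-1` (snd @^-1` B) : set (X * X)).
  rewrite -[X in measurable X]setTI.
  exact: (measurableT_comp measurable_snd measurable_snd).
rewrite -hQ.2; last by rewrite -[X in measurable X]setTI; exact: measurable_snd.
transitivity (Q (fst @^-1` (snd @^-1` B) `\` S) +
    Q (S `&` snd @^-1` (snd @^-1` B)))%E.
  rewrite -measureU//; [|exact: measurableD|exact: measurableI|].
    congr (Q _); apply/seteqP; split=> -[p q]; rewrite /resample /S /=.
      by case: ifP => sz /= ?; [right|left; split => //; rewrite sz].
    by case: ifP => sz [[]|[]] //=; rewrite sz.
  by apply/seteqP; split => // z [[_ nS] [Sz _]].
rewrite -[X in (_ + X)%E]hQ.1; last exact: measurableI.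
rewrite (_ : swap_pair @^-1` _ = fst @^-1` (snd @^-1` B) `&` S).
  by rewrite -measureDI.
by apply/seteqP; split=> -[p q] /=; rewrite /S /= sC; case.
Qed.

(** The integrand of the loss is [f z.1 - f (z.1.1, z.2.2)]; its mean with the same
    quantity after exchange of the copies is half of [mixed_diff]. *)
Lemma Rintegral_resample (f : X -> R) : bounded_measurable f ->
  \int[Q]_z f (resample z) = \int[P]_p f p -
  2^-1 * \int[Q]_z (if s z then mixed_diff f z.1 z.2 else 0).
Proof.
move=> bf; pose g z := if s z then f z.1 - f (z.1.1, z.2.2) else 0.
have mcross : measurable_fun setT (fun z : X * X => (z.1.1, z.2.2)).
  apply: measurable_fun_pair.
    exact: measurableT_comp measurable_fst measurable_fst.
  exact: measurableT_comp measurable_snd measurable_snd.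
have bg : bounded_measurable g.
  apply: bounded_measurable_if => //; apply: bounded_measurableB.
    exact: (bounded_measurable_comp measurable_fst bf).
  exact: (bounded_measurable_comp mcross bf).
have b1 : bounded_measurable (fun z : X * X => f z.1).
  exact: (bounded_measurable_comp measurable_fst bf).
have mswap : measurable_fun setT (@swap_pair X X) by exact: measurable_swap.
have -> : \int[Q]_z f (resample z) = \int[Q]_z (f z.1 - g z).
  apply: eq_Rintegral => z _; rewrite /g /resample.
  by case: ifP => _; rewrite ?subr0// opprB addrC subrK.
rewrite RintegralB//; [|exact: bounded_measurable_integrable..].
congr (_ - _).
  by rewrite (@Rintegral_law _ _ _ _ _ Q P fst)// => A mA; rewrite hQ.2.
have gsw : \int[Q]_z g (swap_pair z) = \int[Q]_z g z.
  by rewrite -(@Rintegral_law _ _ _ _ _ Q Q swap_pair)// => A mA; rewrite hQ.1.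
have -> : \int[Q]_z (if s z then mixed_diff f z.1 z.2 else 0) =
    \int[Q]_z (g z + g (swap_pair z)).
  apply: eq_Rintegral => -[p q] _; rewrite /g /mixed_diff /= sC.
  by case: ifP => _; rewrite ?addr0//; ring.
rewrite RintegralD//; [|exact: bounded_measurable_integrable|]; last first.
  exact/bounded_measurable_integrable/(bounded_measurable_comp mswap bg).
by rewrite gsw; field.
Qed.

End resampling.

Section resample_plan.
Context d0 d1 (T0 : measurableType d0) (T1 : measurableType d1) {R : realType}.
Variables (mu0 : probability T0 R) (mu1 : probability T1 R).
Local Notation X := (T0 * T1)%type.

(** The competitors of the whole proof: exchanging targets on a symmetric set keeps the
    marginals and saves half of the mean mixed difference on that set. *)
Lemma resample_plan (g : probability X R) (Q : probability (X * X)%type R)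
    (s : X * X -> bool) (f : X -> R) :
  coupling mu0 mu1 g -> self_coupling g Q -> measurable_fun setT s ->
  (forall p q, s (p, q) = s (q, p)) -> bounded_measurable f ->
  exists g' : probability X R, [/\ coupling mu0 mu1 g',
    (forall A, g' A = Q (resample s @^-1` A)) &
    \int[g']_w f w = \int[g]_w f w -
      2^-1 * \int[Q]_z (if s z then mixed_diff f z.1 z.2 else 0)].
Proof.
move=> [g0 g1] hQ ms sC bf.
have mr := measurable_resample ms.
have [g' g'E] := law_exists Q mr; exists g'; split => //.
  split=> [A mA|B mB].
    by rewrite -g0// /pushforward g'E (resample_fst s hQ).
  by rewrite -g1// /pushforward g'E (resample_snd hQ ms sC).
rewrite (Rintegral_law mr (P := Q))//; first exact: Rintegral_resample.
Qed.

End resample_plan.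

(** * Self-couplings of independent points of a common cell *)

Lemma measure_cells d (T : measurableType d) (R : realType)
    (mu : {measure set T -> \bar R}) (kappa : T -> nat) (n : nat) (E : set T) :
  (forall k, measurable (kappa @^-1` [set k])) -> (forall w, (kappa w < n)%N) ->
  measurable E -> mu E = (\sum_(k < n) mu (E `&` kappa @^-1` [set k%N : nat]))%E.
Proof.
move=> mA kn mE.
rewrite -(measure_bigsetU_ord mu xpredT (F := fun k : 'I_n =>
  E `&` kappa @^-1` [set k%N : nat])).
- congr (mu _); rewrite -(bigcup_mkord n (fun k => E `&` kappa @^-1` [set k])).
  apply/seteqP; split=> [w Ew|w [k _ []]//].
  by exists (kappa w) => //=; exact: kn.
- by move=> k; exact: measurableI.
- apply/trivIsetP => i j _ _ ij; apply/seteqP; split=> // w [[_ /= wi] [_ /= wj]].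
  by move/eqP: ij; apply; apply/val_inj; rewrite /= -wi -wj.
Qed.

Section probability_of_measure.
Context d (T : measurableType d) (R : realType).
Variables (mu : {measure set T -> \bar R}) (mu1 : mu setT = 1%E).

(** The proof is a parameter so that the instance of probability can be found from the
    term. *)
Definition unit_mass_measure (_ : mu setT = 1%E) : set T -> \bar R := mu.

HB.instance Definition _ := isMeasure.Build _ _ _ (unit_mass_measure mu1)
  (measure0 mu) (measure_ge0 mu) (@measure_semi_sigma_additive _ _ _ mu).

HB.instance Definition _ :=
  Measure_isProbability.Build _ _ _ (unit_mass_measure mu1) mu1.

Lemma probability_of_measure :
  exists P : probability T R, forall A, P A = mu A.
Proof. by exists (unit_mass_measure mu1). Qed.

End probability_of_measure.

Section cell_coupling.
Context d (T : measurableType d) {R : realType} (P : probability T R).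
Variables (kappa : T -> nat) (n : nat).
Let A k : set T := kappa @^-1` [set k].
Hypotheses (mA : forall k, measurable (A k)) (kn : forall w, (kappa w < n)%N).

Let p k : R := fine (P (A k)).

Let PA k : P (A k) = (p k)%:E.
Proof. by rewrite /p fineK// fin_num_measure. Qed.

Let p0 k : 0 <= (p k)^-1.
Proof. by rewrite invr_ge0 fine_ge0. Qed.

Let mAA k : measurable (A k `*` A k).
Proof. exact: measurableX. Qed.

Let PP : {measure set (T * T) -> \bar R} := (P \x P)%E.

Let m k : {measure set (T * T) -> \bar R} :=
  mscale (NngNum (p0 k)) (mrestr PP (mAA k)).

Let Q : set (T * T) -> \bar R := msum m n.

Let QE E : Q E = (\sum_(k < n) ((p k)^-1)%:E * PP (E `&` (A k `*` A k)))%E.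
Proof. by []. Qed.

Let PPX (E F : set T) : measurable E -> measurable F ->
  PP (E `*` F) = (P E * P F)%E.
Proof. by move=> mE mF; apply: product_measure1E. Qed.

Let Qfst E : measurable E -> Q (fst @^-1` E) = P E.
Proof.
move=> mE; rewrite QE.
transitivity (\sum_(k < n) P (E `&` A k))%E.
  apply: eq_bigr => k _.
  have -> : fst @^-1` E `&` A k `*` A k = (E `&` A k) `*` A k.
    by apply/seteqP; split=> -[a b] /=; tauto.
  rewrite PPX//; last exact: measurableI.
  have [pk0|pk0] := eqVneq (p k) 0.
    rewrite pk0 invr0 mul0e; apply/esym/eqP; rewrite eq_le measure_ge0 andbT.
    rewrite -[leRHS]/(0%R%:E) -pk0 -PA le_measure ?inE//; exact: measurableI.
  by rewrite PA muleCA -EFinM mulVf// mule1.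
by rewrite -(measure_cells P mA kn).
Qed.

Let Qprob : Q setT = 1%E.
Proof. by rewrite -(preimage_setT (@fst T T)) Qfst// probability_setT. Qed.

Let PPswap E : measurable E -> PP (swap_pair @^-1` E) = PP E.
Proof.
move=> mE; have ms : measurable_fun setT (@swap_pair T T) by exact: measurable_swap.
pose phi : {mfun _ >-> _} := HB.pack (@swap_pair T T) (isMeasurableFun.Build _ _ _ _ _ ms).
rewrite [RHS](@product_measure_unique _ _ _ _ _ P P (pushforward PP phi))//.
move=> E' F' mE' mF'; change (PP (swap_pair @^-1` (E' `*` F')) = (P E' * P F')%E).
rewrite (_ : _ @^-1` _ = F' `*` E'); first by rewrite PPX// muleC.
by apply/seteqP; split=> -[a b] /= [].
Qed.

(** [Q] is the law of two independent points of a common cell, the cell being drawn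
    according to [P]. A null cell contributes nothing since [0^-1 = 0]. *)
Lemma cell_coupling_exists : exists Q : probability (T * T)%type R,
  [/\ self_coupling P Q,
   (forall E, Q E = (\sum_(k < n) ((fine (P (A k)))^-1)%:E *
                   (P \x P)%E (E `&` (A k `*` A k)))%E) &
   (forall f : T * T -> \bar R, measurable_fun setT f -> (forall z, 0 <= f z)%E ->
     (\sum_(k < n) ((fine (P (A k)))^-1)%:E *
       \int[P \x P]_(z in A k `*` A k) f z <= \int[Q]_z f z)%E)].
Proof.
have [Q' Q'E] := @probability_of_measure _ _ _ (msum m n) Qprob.
exists Q'; split; last 2 first.
- by move=> E; rewrite Q'E -QE.
- move=> f mf f0.
  rewrite (eq_measure_integral (msum m n)); last by move=> E mE _; apply: Q'E.
  rewrite ge0_integral_measure_sum//; apply: lee_sum => k _.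
  rewrite (ge0_integral_mscale _ measurableT)//.
  apply: lee_wpmul2l; first by rewrite lee_fin; exact: p0.
  apply: (@le_trans _ _ (\int[mrestr PP (mAA k)]_(z in A k `*` A k) f z)%E).
    rewrite le_eqVlt; apply/orP; left; apply/eqP.
    by apply: eq_measure_integral => E mE EA; rewrite /= /mrestr setIidl.
  exact: ge0_subset_integral.
split=> E mE; rewrite !Q'E; last exact: Qfst.
rewrite -[LHS]/(Q _) -[RHS]/(Q _) !QE; apply: eq_bigr => k _; congr (_ * _)%E.
rewrite -[RHS]PPswap; last exact: measurableI.
congr (PP _).
by apply/seteqP; split=> -[a b] /=; tauto.
Qed.

End cell_coupling.

Section average.
Context d (T : measurableType d) {R : realType} (P : probability T R).

(** Otherwise [g] would exceed its mean over [A] at almost every point of [A]. *)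
Lemma average_point (A K : set T) (g : T -> \bar R) :
  measurable A -> measurable K -> P (~` K) = 0%E -> P A != 0%E ->
  measurable_fun A g -> (forall w, 0 <= g w)%E ->
  exists w, [/\ A w, K w & (P A * g w <= \int[P]_(z in A) g z)%E].
Proof.
move=> mA mK PK0 PA0 mg g0; apply: contrapT => no.
pose I := (\int[P]_(z in A) g z)%E.
have H w : A w -> K w -> (I < P A * g w)%E.
  by move=> Aw Kw; rewrite ltNge; apply/negP => le; apply: no; exists w.
have I0 : (0 <= I)%E by exact: integral_ge0.
have nullA : (P (A `&` K) = 0 -> False)%E.
  move=> AK0; move/eqP: PA0; apply; apply/eqP.
  rewrite -measure_le0 (measureDI P mA mK) [X in (_ + X)%E]AK0 adde0.
  rewrite -PK0; apply: le_measure; rewrite ?inE.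
  - exact: measurableD.
  - exact: measurableC.
  - by move=> w [_ ?].
have [w [Aw Kw]] : A `&` K !=set0.
  by apply/set0P/negP => /eqP AK; apply: nullA; rewrite AK measure0.
have Ioo : (I < +oo)%E by rewrite (lt_le_trans (H w Aw Kw))// leey.
have If : I \is a fin_num by rewrite ge0_fin_numE.
have PAf : P A \is a fin_num by exact: fin_num_measure.
have ig : P.-integrable A g.
  apply/integrableP; split=> //.
  by under eq_integral do rewrite gee0_abs//.
have ih : P.-integrable A (fun w => (P A * g w - I)%E).
  apply: integrableB => //; first by rewrite -(fineK PAf); exact: integrableZl.
  by rewrite -(fineK If); apply: finite_measure_integrable_cst.
have h0 : (\int[P]_(w in A) (P A * g w - I) = 0)%E.
  rewrite integralB//; first last.
  - by rewrite -(fineK If); apply: finite_measure_integrable_cst.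
  - by rewrite -(fineK PAf); exact: integrableZl.
  rewrite ge0_integralZl// integral_cst// -/I muleC subee//.
  by rewrite fin_numM.
have mAK : measurable (A `&` K) by exact: measurableI.
have h1 : (\int[P]_(w in A `&` K) `|P A * g w - I| = 0)%E.
  apply/eqP; rewrite eq_le integral_ge0// andbT -h0.
  rewrite [leLHS](_ : _ = \int[P]_(w in A `&` K) (P A * g w - I))%E; last first.
    apply: eq_integral => v /[!inE] -[Av Kv]; rewrite gee0_abs//.
    by rewrite sube_ge0 ?If// ltW// H.
  rewrite [leRHS](@negligible_integral _ _ _ _ _ (~` K))//; last exact: measurableC.
  by rewrite setDE setCK.
have mh : measurable_fun (A `&` K) (fun w => (P A * g w - I)%E).
  by apply: measurable_funS (measurable_int _ ih) => // v [].
have [N [mN N0 hN]] := (ae_eq_integral_abs P mAK mh).1 h1.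
apply: nullA; apply/eqP; rewrite -measure_le0 -N0; apply: le_measure; rewrite ?inE//.
move=> v [Av Kv]; apply: hN => /(_ (conj Av Kv)) E.
by have := H v Av Kv; rewrite -sube_gt0 E ltxx.
Qed.

End average.

Lemma ge0_integral_cells d (T : measurableType d) (R : realType)
    (mu : {measure set T -> \bar R}) (kappa : T -> nat) (n : nat) (h : T -> \bar R) :
  (forall k, measurable (kappa @^-1` [set k])) -> (forall w, (kappa w < n)%N) ->
  measurable_fun setT h -> (forall w, 0 <= h w)%E ->
  (\int[mu]_w h w =
     \sum_(k < n) \int[mu]_(w in kappa @^-1` [set k%N : nat]) h w)%E.
Proof.
move=> mA kn mh h0.
rewrite -(big_mkord xpredT (fun k => \int[mu]_(w in kappa @^-1` [set k]) h w))%E.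
have E : \big[setU/set0]_(k <- index_iota 0 n) (kappa @^-1` [set k]) = setT.
  rewrite (big_mkord xpredT (fun k => kappa @^-1` [set k])) -(bigcup_mkord n (fun k => kappa @^-1` [set k])).
  by apply/seteqP; split=> // w _; exists (kappa w) => //=; exact: kn.
rewrite -ge0_integral_bigsetU ?E//; first exact: iota_uniq.
apply/trivIsetP => i j _ _ /eqP ij; apply/seteqP; split=> // w [/= E1 E2].
by apply: ij; rewrite -E1 -E2.
Qed.

Section centers.
Context d (T : measurableType d) {R : realType} (P : probability T R).
Variables (Q : probability (T * T)%type R) (kappa : T -> nat) (n : nat) (K : set T).
Let A k : set T := kappa @^-1` [set k].
Hypotheses (mA : forall k, measurable (A k)) (kn : forall w, (kappa w < n)%N).
Hypotheses (mK : measurable K) (PK : P (~` K) = 0%E).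
Hypothesis QI : forall f : T * T -> \bar R, measurable_fun setT f ->
  (forall z, 0 <= f z)%E ->
  (\sum_(k < n) ((fine (P (A k)))^-1)%:E *
       \int[P \x P]_(z in A k `*` A k) f z <= \int[Q]_z f z)%E.

(** By Fubini, the mean of [f] over a pair of independent points of a cell is an average
    over the second point, and some choice of that point does at least as well. *)
Lemma cell_centers (f : T * T -> R) : bounded_measurable f -> (forall z, 0 <= f z) ->
  exists Y : nat -> T, (forall k, P (A k) != 0%E -> A k (Y k) /\ K (Y k)) /\
    \int[P]_w f (w, Y (kappa w)) <= \int[Q]_z f z.
Proof.
move=> bf f0; have mf : measurable_fun setT (EFin \o f).
  by apply/measurable_EFinP; exact: bf.1.
have f0e z : (0 <= (EFin \o f) z)%E by rewrite lee_fin.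
have mAA k : measurable (A k `*` A k) by exact: measurableX.
pose F k := (EFin \o f) \_ (A k `*` A k).
have mF k : measurable_fun setT (F k).
  by apply: (measurable_restrictT _ (mAA k)).1; exact: measurable_funTS.
have F0 k z : (0 <= F k z)%E by rewrite /F patchE; case: ifP => // _; exact: f0e.
pose g k w' := (\int[P]_w F k (w, w'))%E.
have mg k : measurable_fun setT (g k).
  exact: (measurable_fun_fubini_tonelli_G (F k) (mF k) (F0 k)).
have g0 k w : (0 <= g k w)%E by exact: integral_ge0.
have [t0 _] : [set: T] !=set0.
  apply/set0P/negP => /eqP T0; have := probability_setT P.
  by rewrite T0 measure0 => /eqP; rewrite eq_sym onee_eq0.
have /choice[Y HY] : forall k, exists w, P (A k) != 0%E ->
    [/\ A k w, K w & (P (A k) * g k w <= \int[P]_(z in A k) g k z)%E].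
  move=> k; have [->|Ak0] := eqVneq (P (A k)) 0%E; first by exists t0.
  have [w Hw] := average_point (mA k) mK PK Ak0 (measurable_funTS (mg k)) (g0 k).
  by exists w.
exists Y; split; first by move=> k /HY[].
have mY : measurable_fun setT (fun w => f (w, Y (kappa w))).
  apply: (measurableT_comp bf.1); apply: measurable_fun_pair => //.
  exact: (measurable_fun_of_fibers Y mA).
have bY : bounded_measurable (fun w => f (w, Y (kappa w))).
  by split => //; have [_ [M fM]] := bf; exists M => w; exact: fM.
rewrite -lee_fin /Rintegral !fineK; last 2 first.
- exact/integrable_fin_num/bounded_measurable_integrable.
- exact/integrable_fin_num/bounded_measurable_integrable.
apply: le_trans (QI mf f0e).
rewrite (ge0_integral_cells P mA kn); last 2 first.
- exact/measurable_EFinP.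
- by move=> w; rewrite lee_fin.
apply: lee_sum => k _.
have [Ak0|Ak0] := eqVneq (P (A k)) 0%E.
  rewrite null_set_integral//.
  - by rewrite mule_ge0 ?lee_fin ?invr_ge0 ?fine_ge0// integral_ge0.
  - exact: mA.
  - by apply: measurable_funTS; exact/measurable_EFinP.
have [AY KY le] := HY k Ak0.
have PAf : P (A k) \is a fin_num by exact: fin_num_measure.
have PA0 : 0 < fine (P (A k)) by rewrite fine_gt0// lt0e Ak0 measure_ge0/= ltey_eq PAf.
have -> : (\int[P]_(w in kappa @^-1` [set k%N : nat]) (f (w, Y (kappa w)))%:E =
    g k (Y k))%E.
  rewrite integral_mkcond; apply: eq_integral => w _; rewrite /F !patchE.
  case: ifPn => [/[!inE]/= wk|]; last first.
    by rewrite notin_setE => nw; rewrite ifN// notin_setE => -[].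
  by rewrite ifT /= ?wk// inE.
rewrite lee_pdivlMl// fineK//; apply: (le_trans le).
apply: (@le_trans _ _ (\int[P]_z g k z)%E).
  by apply: ge0_subset_integral.
by rewrite -(fubini_tonelli2 (F k) (mF k) (F0 k)) [leRHS]integral_mkcond.
Qed.

End centers.

Section fin_cells.
Context d (X : measurableType d) {R : realType} (P : probability X R).
Variables (T : finType) (idx : X -> T).
Let A t : set X := idx @^-1` [set t].
Hypothesis mA : measurable_fibers idx.

Let kappa (w : X) : nat := enum_rank (idx w).

Let kappaE (k : 'I_#|T|) : kappa @^-1` [set k%N : nat] = A (enum_val k).
Proof.
apply/seteqP; split=> w; rewrite /kappa /A /=.
  by move=> /val_inj <-; rewrite enum_rankK.
by move=> ->; rewrite enum_valK.
Qed.

Let mkappa k : measurable (kappa @^-1` [set k]).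
Proof. exact: (measurable_fibers_map (fun t => enum_rank t : nat) mA). Qed.

Let kappan w : (kappa w < #|T|)%N. Proof. exact: ltn_ord. Qed.

Lemma measure_fin_cells (mu : {measure set X -> \bar R}) E : measurable E ->
  (mu E = \sum_(t : T) mu (E `&` A t))%E.
Proof.
move=> mE; rewrite (measure_cells mu mkappa kappan mE) (reindex _ (onW_bij _ (@enum_rank_bij T))).
by apply: eq_bigr => t _; rewrite kappaE enum_rankK.
Qed.

Lemma ge0_integral_fin_cells (mu : {measure set X -> \bar R}) (h : X -> \bar R) :
  measurable_fun setT h -> (forall w, 0 <= h w)%E ->
  (\int[mu]_w h w = \sum_(t : T) \int[mu]_(w in A t) h w)%E.
Proof.
move=> mh h0; rewrite (ge0_integral_cells mu mkappa kappan mh h0).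
rewrite (reindex _ (onW_bij _ (@enum_rank_bij T))).
by apply: eq_bigr => t _; rewrite kappaE enum_rankK.
Qed.

(** [cell_coupling_exists] and [cell_centers] for cells indexed by a finite type, through
    its enumeration. *)
Lemma fin_cell_coupling_exists : exists Q : probability (X * X)%type R,
  [/\ self_coupling P Q,
   (forall E, Q E = (\sum_(t : T) ((fine (P (A t)))^-1)%:E *
                   (P \x P)%E (E `&` (A t `*` A t)))%E) &
   (forall (K : set X) (f : X * X -> R), measurable K -> P (~` K) = 0%E ->
     bounded_measurable f -> (forall z, 0 <= f z) ->
     exists Y : T -> X, (forall t, P (A t) != 0%E -> A t (Y t) /\ K (Y t)) /\
      \int[P]_w f (w, Y (idx w)) <= \int[Q]_z f z)].
Proof.
have [Q [h1 h2 h3]] := cell_coupling_exists P mkappa kappan.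
exists Q; split => //.
  move=> E; rewrite h2 (reindex _ (onW_bij _ (@enum_rank_bij T))).
  by apply: eq_bigr => t _; rewrite kappaE enum_rankK.
move=> K f mK PK bf f0; have [Y [HY le]] := cell_centers mkappa kappan mK PK h3 bf f0.
exists (fun t => Y (enum_rank t)); split => // t Pt.
by have := HY (enum_rank t); rewrite kappaE enum_rankK; exact.
Qed.

End fin_cells.

(** * Densities and entropy *)

Section ae_le.
Local Open Scope charge_scope.
Local Open Scope ereal_scope.
Context d (T : measurableType d) (R : realType) (mu : {measure set T -> \bar R}).

(** The positive and the negative parts are compared separately. *)
Lemma ae_le_integral (f g : T -> \bar R) :
  measurable_fun setT f -> measurable_fun setT g ->
  {ae mu, forall x, f x <= g x} -> \int[mu]_x f x <= \int[mu]_x g x.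
Proof.
move=> mf mg fg; rewrite integralE [leRHS]integralE leeB//.
- apply: ae_ge0_le_integral => //; [exact: measurable_funepos..|].
  apply: filterS fg => x fgx _; rewrite !funeposE.
  by rewrite ge_max !le_max fgx lexx/= orbT.
- apply: ae_ge0_le_integral => //; [exact: measurable_funeneg..|].
  apply: filterS fg => x fgx _; rewrite !funenegE.
  by rewrite ge_max !le_max lexx leeN2 fgx/= orbT.
Qed.

End ae_le.

Section density.
Local Open Scope charge_scope.
Local Open Scope ereal_scope.
Context d (T : measurableType d) (R : realType) (P : probability T R)
  (m : {sigma_finite_measure set T -> \bar R}).
Hypothesis Pm : P `<< m.

Let rn := 'd (charge_of_finite_measure P) '/d m.
Definition density (x : T) : R := fine (rn x).

Let rnE x : rn x = (density x)%:E.
Proof. by rewrite /density fineK// Radon_Nikodym_fin_num. Qed.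

Let mrn : measurable_fun setT rn.
Proof. by apply: measurable_int; exact: Radon_Nikodym_integrable. Qed.

Lemma measurable_density : measurable_fun setT density.
Proof. exact: measurableT_comp mrn. Qed.

Lemma density_integral A : measurable A -> P A = \int[m]_(x in A) (density x)%:E.
Proof.
move=> mA; under eq_integral do rewrite -rnE.
by rewrite -Radon_Nikodym_integral.
Qed.

(** [P] gives to the set where the density is nonpositive the integral of a nonpositive
    function. *)
Lemma density_gt0_ae : {ae P, forall x, (0 < density x)%R}.
Proof.
have mN : measurable [set x | (density x <= 0)%R].
  rewrite -[X in measurable X]setTI.
  exact: (measurable_fun_ler measurable_density (measurable_cst (0:R)%R)) measurableT [set true] _.
exists [set x | (density x <= 0)%R]; split => //; last first.
  by move=> x /= /negP; rewrite -leNgt.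
apply/eqP; rewrite -measure_le0 [leLHS](density_integral mN).
have irn : m.-integrable setT rn by exact: Radon_Nikodym_integrable.
rewrite -[leRHS](integral0 m [set x | (density x <= 0)%R]).
apply: le_integral => //.
- apply: (integrableS measurableT) => //; apply: eq_integrable irn => // x _.
- exact: integrable0.
- by move=> x; rewrite inE /= lee_fin.
Qed.

(** The density is only known up to a null set, where it may be negative; [q] vanishing
    there makes the right-hand integrand nonnegative everywhere. *)
Lemma density_change (q : T -> R) : measurable_fun setT q -> (forall x, 0 <= q x)%R ->
  (forall x, (density x <= 0)%R -> q x = 0%R) ->
  \int[P]_x (q x)%:E = \int[m]_x (q x * density x)%:E.
Proof.
move=> mq q0 qN.
rewrite -(@Radon_Nikodym_SigmaFinite.change_of_variables _ _ _ P m Pm (EFin \o q))//; last first.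
  exact/measurable_EFinP.
apply: ge0_ae_eq_integral => //.
- apply: emeasurable_funM; first exact/measurable_EFinP.
  by apply: (measurable_int m); exact: Radon_Nikodym_SigmaFinite.f_integrable.
- apply/measurable_EFinP; apply: measurable_funM => //; exact: measurable_density.
- by move=> x _; rewrite mule_ge0 ?lee_fin//; exact: Radon_Nikodym_SigmaFinite.f_ge0.
- move=> x _; rewrite lee_fin; have [l|l] := leP (density x) 0%R.
    by rewrite qN// mul0r.
  by rewrite mulr_ge0// ltW.
apply: filterS (ae_eq_Radon_Nikodym_SigmaFinite Pm measurableT) => x /(_ I) /= ->.
by rewrite -/(rn x) rnE EFinM.
Qed.

End density.

Section entropy_bounds.
Local Open Scope charge_scope.
Local Open Scope ereal_scope.
Context d (T : measurableType d) (R : realType) (P : probability T R)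
  (m : {sigma_finite_measure set T -> \bar R}).

Lemma entropyE : P `<< m -> entropy P m = \int[P]_x (ln (density P m x))%:E.
Proof. by move=> Pm; rewrite /entropy asboolT. Qed.

Lemma measurable_ln_density : P `<< m -> measurable_fun setT (fun x => ln (density P m x)).
Proof.
by move=> Pm; exact: (measurableT_comp (@measurable_ln R) (measurable_density Pm)).
Qed.

(** Gibbs' inequality in pointwise form. For [t = expR (l x) / density x], the bound
    [ln t <= t - 1] reads [l x + 1 - t <= ln (density x)], and [t] has mean at most [1]. *)
Lemma gibbs_minorant (K : set T) (l : T -> R) : P `<< m ->
  measurable K -> P (~` K) = 0 -> bounded_measurable l ->
  \int[m]_(x in K) (expR (l x))%:E <= 1 ->
  exists k : T -> R, [/\ P.-integrable setT (EFin \o k),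
    {ae P, forall x, (k x <= ln (density P m x))%R} &
    \int[P]_x (l x)%:E <= \int[P]_x (k x)%:E].
Proof.
move=> Pm mK PK bl le1; pose g := density P m.
have mg : measurable_fun setT g by exact: measurable_density.
pose s x := (0 < g x)%R && (x \in K).
have ms : measurable_fun setT s.
  apply: measurable_and; first exact: measurable_fun_ltr.
  exact: measurable_fun_mem.
pose q x : R := if s x then expR (l x - ln (g x))%R else 0%R.
have qE x : (0 < g x)%R -> (expR (l x - ln (g x)) * g x = expR (l x))%R.
  by move=> gx; rewrite expRD expRN lnK ?posrE// divfK ?gt_eqF.
have q0 x : (0 <= q x)%R.
  by rewrite /q; case: ifP => // _; rewrite expR_ge0.
have mel : measurable_fun setT (fun x => expR (l x)).
  exact: (measurableT_comp (@measurable_expR R) bl.1).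
have mq : measurable_fun setT q.
  apply: measurable_fun_ifT => //.
  apply: (measurableT_comp (@measurable_expR R)); apply: measurable_funB => //.
    exact: bl.1.
  exact: measurable_ln_density.
have iq1 : \int[P]_x (q x)%:E <= 1.
  rewrite (density_change Pm mq q0); last first.
    by move=> x gx; rewrite /q /s; case: ltP => //; rewrite ltNge gx.
  apply: le_trans le1; rewrite [leRHS]integral_mkcond.
  apply: ge0_le_integral => //.
  - move=> x _; rewrite lee_fin /q; case: ifP => [/andP[gx _]|]; last by rewrite mul0r.
    by rewrite qE// expR_ge0.
  - by apply/measurable_EFinP; exact: measurable_funM.
  - apply: (measurable_restrictT _ mK).1; apply: measurable_funTS.
    exact/measurable_EFinP.
  move=> x _; rewrite patchE /q /s; case: (x \in K); last by rewrite andbF mul0r.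
  rewrite andbT; case: ltP => gx; first by rewrite qE.
  by rewrite mul0r lee_fin expR_ge0.
have iq : P.-integrable setT (EFin \o q).
  apply/integrableP; split; first exact/measurable_EFinP.
  under eq_integral do rewrite /= ger0_norm//.
  by rewrite (le_lt_trans iq1)// ltry.
have il1 : P.-integrable setT (EFin \o (fun x => l x + 1)%R).
  apply: bounded_measurable_integrable; apply: bounded_measurableD => //.
  exact: bounded_measurable_cst.
exists (fun x => l x + 1 - q x)%R; split.
- exact: (integrableB measurableT il1 iq).
- have PKae : {ae P, forall x, x \in K}.
    exists (~` K); split => //; first exact: measurableC.
    by move=> x /= nx Kx; apply: nx; rewrite inE.
  apply: filterS2 PKae (density_gt0_ae Pm) => x Kx gx.
  rewrite /q /s gx Kx/= -/(g x).
  by have := expR_ge1Dx (l x - ln (g x)); lra.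
rewrite (_ : (fun x => (l x + 1 - q x)%:E) = ((EFin \o (fun x => l x + 1)%R) \- (EFin \o q)))//.
rewrite integralB//.
rewrite (_ : (EFin \o (fun x => l x + 1)%R) = ((EFin \o l) \+ cst 1))//.
rewrite integralD//; [|exact: bounded_measurable_integrable|]; last first.
  exact: (finite_measure_integrable_cst P 1).
rewrite integral_cst// [X in 1 * X]probability_setT mule1.
rewrite -addeA -[leLHS]adde0 leeD2l// sube_ge0//.
by apply/orP; left; exact: integrable_fin_num.
Qed.

(** Gibbs' inequality: [expR \o l] is the density of a subprobability on [K]. *)
Lemma entropy_ge (K : set T) (l : T -> R) :
  measurable K -> P (~` K) = 0 -> bounded_measurable l ->
  \int[m]_(x in K) (expR (l x))%:E <= 1 ->
  \int[P]_x (l x)%:E <= entropy P m.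
Proof.
move=> mK PK bl le1; have [Pm|nPm] := pselect (P `<< m); last first.
  by rewrite /entropy asboolF// leey.
have [k [ik kle]] := gibbs_minorant Pm mK PK bl le1.
move=> /le_trans; apply; rewrite entropyE//; apply: ae_le_integral.
- exact: measurable_int ik.
- by apply/measurable_EFinP; exact: measurable_ln_density.
- by apply: filterS kle => x; rewrite lee_fin.
Qed.

(** Gibbs' inequality against a constant density on [K] bounds the negative part of the
    log-density; the finite entropy then bounds its positive part. *)
Lemma entropy_integrable (K : set T) : P `<< m -> measurable K -> P (~` K) = 0 ->
  m K < +oo -> entropy P m < +oo ->
  P.-integrable setT (EFin \o (fun x => ln (density P m x))).
Proof.
move=> Pm mK PK mKoo Hoo.
(* [m K] may vanish *)
pose r := (fine (m K) + 1)%R.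
have r0 : (0 < r)%R by rewrite ltr_wpDl// fine_ge0.
have bl : bounded_measurable (fun _ : T => - ln r)%R by exact: bounded_measurable_cst.
have le1 : \int[m]_(x in K) (expR (- ln r))%:E <= 1.
  have mKf : m K \is a fin_num by rewrite ge0_fin_numE.
  rewrite integral_cst// expRN lnK ?posrE// -[X in _ * X](fineK mKf).
  by rewrite -EFinM lee_fin ler_pdivrMl// mulr1 /r lerDl.
have [k [ik kle _]] := gibbs_minorant Pm mK PK bl le1.
set f := fun x => _.
have mf : measurable_fun setT (EFin \o f).
  by apply/measurable_EFinP; exact: measurable_ln_density.
have fneg : \int[P]_x (EFin \o f)^\- x < +oo.
  apply: (@le_lt_trans _ _ (\int[P]_x (EFin \o k)^\- x)).
    apply: ae_ge0_le_integral => //.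
    - exact: measurable_funeneg.
    - by apply: measurable_funeneg; exact: measurable_int ik.
    apply: filterS kle => x kx _; rewrite !funenegE.
    by rewrite ge_max !le_max lexx leeN2 lee_fin kx/= orbT.
  have := integrable_funeneg measurableT ik => /integrableP[_].
  by under eq_integral do rewrite gee0_abs//.
have fpos : \int[P]_x (EFin \o f)^\+ x < +oo.
  move: Hoo; rewrite entropyE// integralE.
  have : \int[P]_x (EFin \o f)^\- x \is a fin_num by rewrite ge0_fin_numE// integral_ge0.
  rewrite ltNge leye_eq => fn /=; rewrite ltNge leye_eq.
  by apply: contra => /eqP ->; rewrite -(fineK fn) addye.
apply/integrableP; split => //.
rewrite (_ : (fun x => `|(EFin \o f) x|) = (fun x => (EFin \o f)^\+ x + (EFin \o f)^\- x)); last first.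
  apply/funext => x; rewrite funeposE funenegE /=; have [h|h] := leP 0%R (f x).
    by rewrite max_l ?lee_fin// max_r ?lee_fin ?oppr_le0// adde0 ger0_norm.
  by rewrite max_r ?lee_fin ?ltW// max_l ?lee_fin ?oppr_ge0 ?ltW// add0e ltr0_norm.
rewrite ge0_integralD//; [|exact: measurable_funepos|exact: measurable_funeneg].
exact: lte_add_pinfty.
Qed.

(** The density of [P] is [P]-almost everywhere at most [h]: on the set where it exceeds
    [h], the hypothesis forces the two to have the same integral. *)
Lemma entropy_le (h : T -> R) : measurable_fun setT h -> (forall x, 0 <= h x)%R ->
  (forall A, measurable A -> P A <= \int[m]_(x in A) (h x)%:E) ->
  entropy P m <= \int[P]_x (ln (h x))%:E.
Proof.
move=> mh h0 Ph.
have Pm : P `<< m.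
  apply/null_content_dominatesP => A mA mA0.
  apply/eqP; rewrite -measure_le0 (le_trans (Ph A mA))//.
  by rewrite null_set_integral//; apply: measurable_funTS; exact/measurable_EFinP.
pose g := density P m.
have mg : measurable_fun setT g by exact: measurable_density.
have mB : measurable [set x | (h x < g x)%R].
  rewrite -[X in measurable X]setTI.
  exact: (measurable_fun_ltr mh mg) measurableT [set true] _.
set B := [set x | _] in mB.
have ig : m.-integrable B (EFin \o g).
  apply: (integrableS measurableT) => //.
  have irn := Radon_Nikodym_integrable (nu := charge_of_finite_measure P) Pm.
  apply: eq_integrable irn => // x _.
  by rewrite /g /density /= fineK// Radon_Nikodym_fin_num.
have ih : m.-integrable B (EFin \o h).
  apply: le_integrable ig => //; first by apply: measurable_funTS; exact/measurable_EFinP.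
  move=> x Bx /=; rewrite lee_fin !ger0_norm//; first exact: ltW.
  exact: le_trans (h0 x) (ltW Bx).
have igh : m.-integrable B (fun x => (EFin \o g) x - (EFin \o h) x) by exact: integrableB.
have int0 : \int[m]_(x in B) ((EFin \o g) x - (EFin \o h) x) = 0.
  apply/eqP; rewrite eq_le integral_ge0 ?andbT; last first.
    by move=> x Bx; rewrite sube_ge0// lee_fin ltW.
  rewrite integralB// -(density_integral Pm mB) sube_le0; exact: Ph.
have [N [mN N0 BN]] : ae_eq m B (fun x => (EFin \o g) x - (EFin \o h) x) (cst 0).
  apply/ae_eq_integral_abs => //; first exact: measurable_int igh.
  rewrite -[RHS]int0; apply: eq_integral => x /[!inE] Bx.
  by rewrite gee0_abs// sube_ge0// lee_fin ltW.
have PB0 : P B = 0.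
  apply/eqP; rewrite -measure_le0; apply: (le_trans (Ph B mB)).
  rewrite null_set_integral//; first exact: measurable_int ih.
  apply/eqP; rewrite -measure_le0 -N0 le_measure ?inE// => x Bx.
  by apply: BN => /(_ Bx) /eqP; rewrite sube_eq// add0e eqe gt_eqF.
rewrite entropyE//; apply: ae_le_integral.
- by apply/measurable_EFinP; exact: measurable_ln_density.
- by apply/measurable_EFinP; exact: (measurableT_comp (@measurable_ln R) mh).
have aeB : {ae P, forall x, (g x <= h x)%R}.
  by exists B; split => // x /= /negP; rewrite -ltNge.
apply: filterS2 aeB (density_gt0_ae Pm) => x gh g0.
by rewrite lee_fin ler_ln ?posrE// (lt_le_trans g0).
Qed.

End entropy_bounds.

(** * Grids, and cells of the sheared coordinates *)

Section grid.
Context {R : realType} {d : nat}.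
Local Notation V := 'rV[R]_d.
Variables (N : nat) (rho delta : R).

(** Index of the grid cube of mesh [delta] containing [x]; meaningful when [|x| <= rho]
    and [N] exceeds [2 * rho / delta], so that [inord] does not truncate. *)
Definition grid (x : V) : {ffun 'I_d -> 'I_N.+1} :=
  [ffun a => inord (Num.truncn ((x 0 a + rho) / delta))].

Hypotheses (delta0 : 0 < delta) (Nrho : 2 * rho / delta < N.+1%:R).

Lemma grid_itv (x : V) a : `|x| <= rho ->
  (grid x a)%:R * delta <= x 0 a + rho < (grid x a).+1%:R * delta.
Proof.
move=> xr; have := le_trans (mx_entry_le_norm x 0 a) xr.
rewrite ler_norml => /andP[x1 x2].
have z0 : 0 <= (x 0 a + rho) / delta.
  by apply: divr_ge0; [lra|exact: ltW].
set z := (x 0 a + rho) / delta in z0.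
have zN : (Num.truncn z < N.+1)%N.
  rewrite truncn_lt_nat//; apply: le_lt_trans Nrho.
  by rewrite ler_pM2r ?invr_gt0//; lra.
rewrite /grid ffunE inordK//.
by have := truncn_itv z0; rewrite ler_pdivlMr// ltr_pdivrMr.
Qed.

Lemma grid_close (x y : V) : `|x| <= rho -> `|y| <= rho -> grid x = grid y ->
  `|x - y| <= delta.
Proof.
move=> xr yr E; apply: mx_norm_le; first exact: ltW.
move=> i a; rewrite ord1 !mxE.
have /andP[a1 a2] := grid_itv a xr; have /andP[b1 b2] := grid_itv a yr.
move: a1 a2; rewrite E => a1 a2; rewrite -natr1 in a2 b2.
by rewrite ler_norml; apply/andP; split; lra.
Qed.

Lemma grid_dist (k : nat) (x y : V) a : `|x| <= rho -> `|y| <= rho ->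
  `|x - y| <= k%:R * delta -> (grid x a <= grid y a + k)%N.
Proof.
move=> xr yr xy; have /andP[a1 a2] := grid_itv a xr; have /andP[b1 b2] := grid_itv a yr.
have := le_trans (mx_entry_le_norm (x - y) 0 a) xy; rewrite !mxE ler_norml => /andP[_ h].
rewrite -ltnS -(ltr_nat R) -(ltr_pM2r delta0) -addSn natrD mulrDl; lra.
Qed.

Lemma measurable_grid : measurable_fibers (grid : borel V -> _).
Proof.
apply: measurable_fibers_ffun => a.
apply: (measurable_fibers_map (idx := fun x : borel V =>
  Num.truncn (((x : V) 0 a + rho) / delta)) (inord : nat -> 'I_N.+1)).
apply: measurable_fibers_truncn; apply: measurable_funM => //.
apply: measurable_funD => //.
exact: measurable_rV_coord.
Qed.

(** [S] lies in a translate of a grid cube, of side [delta]; the enclosing box has side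
    [2 * delta] because grid cubes contain their lower faces and boxes do not. *)
Lemma lebesgue_grid_cell (v : V) g (S : set (borel V)) : measurable S ->
  (forall y, S y -> `|y - v| <= rho /\ grid (y - v) = g) ->
  (lebesgue_rV d S <= ((2 * delta) ^+ d)%:E)%E.
Proof.
move=> mS Sg.
pose a i := v 0 i - rho + (g i)%:R * delta - delta.
apply: (@le_trans _ _ (lebesgue_rV d (rV_box a (fun i => a i + 2 * delta)))).
  apply: le_measure; rewrite ?inE//; first exact: measurable_rV_box.
  move=> y Sy i; have [yr yg] := Sg y Sy.
  have /andP[h1 h2] := grid_itv i yr; rewrite yg !mxE in h1 h2.
  rewrite in_itv /= /a; rewrite -natr1 in h2; apply/andP; split; lra.
rewrite lebesgue_rV_box; last by move=> i; rewrite lerDl mulr_ge0 ?ltW.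
rewrite lee_fin (eq_bigr (fun=> 2 * delta)); last by move=> i _; rewrite addrAC subrr add0r.
by rewrite prodr_const card_ord.
Qed.

End grid.

Section volumes.
Context {R : realType} {d : nat}.
Local Notation V := 'rV[R]_d.

Lemma lebesgue_ball_le (x0 : V) (r : R) : 0 <= r ->
  exists B : set (borel V), [/\ measurable B, (forall x, `|x - x0| < r -> B x) &
    lebesgue_rV d B = ((2 * r) ^+ d)%:E].
Proof.
move=> r0; exists (rV_box (fun i => x0 0 i - r) (fun i => x0 0 i + r)); split.
- exact: measurable_rV_box.
- move=> x xr i; have := le_lt_trans (mx_entry_le_norm (x - x0) 0 i) xr.
  rewrite !mxE ltr_norml in_itv /= => /andP[h1 h2].
  by apply/andP; split; [|apply: ltW]; lra.
rewrite lebesgue_rV_box; last by move=> i; rewrite lerBlDr -addrA lerDl addr_ge0.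
congr _%:E; rewrite (eq_bigr (fun=> 2 * r)) ?prodr_const ?card_ord// => i _.
ring.
Qed.

End volumes.

Lemma prod_measure_le d1 d2 (T1 : measurableType d1) (T2 : measurableType d2)
    (R : realType) (m1 : {sigma_finite_measure set T1 -> \bar R})
    (m2 : {sigma_finite_measure set T2 -> \bar R}) (E : set (T1 * T2)) (B : set T1)
    (v : R) : measurable E -> measurable B -> 0 <= v ->
  (forall z, E z -> B z.1) -> (forall x, m2 (xsection E x) <= v%:E)%E ->
  (prod_measure m1 m2 E <= v%:E * m1 B)%E.
Proof.
move=> mE mB v0 EB Ev; rewrite -[leRHS]integral_cst//.
rewrite /prod_measure /product_measure1 [leRHS]integral_mkcond.
apply: ge0_le_integral => //.
- exact: measurable_fun_xsection.
- by apply: (measurable_restrictT _ mB).1.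
move=> x _; rewrite patchE /=; case: ifPn => // /negP nB.
rewrite (_ : xsection E x = set0) ?measure0//.
apply/seteqP; split => // y; rewrite /xsection /= => /set_mem /EB /= Bx.
by apply: nB; exact: mem_set.
Qed.

Section sheared_cells.
Context {R : realType} {d : nat}.
Local Notation V := 'rV[R]_d.
Local Notation X := (borel V * borel V)%type.
Variables (f : V * V -> R) (K : set (V * V)).
Variables (s : seq (set (V * V) * 'M[R]_d)) (C rho : R).
Hypotheses (C1 : 1 <= C) (rho0 : 0 <= rho).
Hypothesis sP : forall U, U \in s -> [/\ measurable (U.1 : set X),
  twisted_patch f (U.1 `&` K) U.2 C & `|U.2| <= C].
Hypothesis scov : forall p, K p -> exists2 U, U \in s & U.1 p.
Hypothesis Krho : forall p, K p -> `|p.1| <= rho /\ `|p.2| <= rho.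

Definition patch_index (w : V * V) : nat := find (fun U : set X => w \in U) (unzip1 s).

Definition patch_matrix (l : nat) : 'M[R]_d := (nth (set0, 0) s l).2.

Definition shear_bound : R := rho + d%:R * rho * C.

Definition cell_number (delta : R) : nat := Num.truncn (2 * shear_bound / delta).

(** A cell fixes the patch and locates the sheared coordinate with precision [delta], but
    says nothing of [w.1]: this is why there are only [O(delta^-d)] cells. *)
Definition sheared_cell (delta : R) (w : V * V) :
    'I_(size s).+1 * {ffun 'I_d -> 'I_(cell_number delta).+1} :=
  (inord (patch_index w),
   grid (cell_number delta) shear_bound delta (shear (patch_matrix (patch_index w)) w)).

Lemma patch_index_lt w : K w -> (patch_index w < size s)%N.
Proof.
move=> Kw; rewrite -(size_map fst) -has_find; have [U Us Uw] := scov Kw.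
by apply/hasP; exists U.1; [apply/mapP; exists U|exact: mem_set].
Qed.

Lemma patch_index_in w : K w ->
  (nth (set0, 0) s (patch_index w)).1 w.
Proof.
move=> Kw; have lt := patch_index_lt Kw.
apply: set_mem; rewrite -(nth_map _ set0 fst)//.
apply: (@nth_find _ set0 (fun U : set X => w \in U)).
by rewrite has_find size_map.
Qed.

Lemma patch_index_le w : (patch_index w < (size s).+1)%N.
Proof. by rewrite ltnS -(size_map fst) find_size. Qed.

Lemma norm_patch_matrix l : `|patch_matrix l| <= C.
Proof.
rewrite /patch_matrix; have [ls|ls] := ltnP l (size s).
  by have [] := sP (mem_nth (set0, 0) ls).
by rewrite nth_default//= normr0 (le_trans ler01).
Qed.

Lemma shear_bound_ge0 : 0 <= shear_bound.
Proof. by rewrite addr_ge0// !mulr_ge0// (le_trans ler01). Qed.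

Lemma norm_shear_le l w : K w -> `|shear (patch_matrix l) w| <= shear_bound.
Proof.
move=> Kw; have [w1 w2] := Krho Kw.
rewrite /shear (le_trans (ler_normB _ _))// lerD// (le_trans (norm_mulmx _ _))//.
by rewrite ler_pM ?mulr_ge0// ?norm_patch_matrix// ler_wpM2l.
Qed.

Lemma cell_number_gt delta : 2 * shear_bound / delta < (cell_number delta).+1%:R.
Proof. exact: truncnS_gt. Qed.

(** Both points lie in a common patch, and their sheared coordinates in a common grid
    cube. *)
Lemma sheared_cell_twisted delta (w w' : V * V) : 0 < delta -> K w -> K w' ->
  sheared_cell delta w = sheared_cell delta w' ->
  exists M : 'M[R]_d, [/\ `|M| <= C, `|shear M w' - shear M w| <= delta &
    `|w'.1 - w.1| ^+ 2 <= C * (mixed_diff f w w' + C * delta ^+ 2)].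
Proof.
move=> d0 Kw Kw' [] /(congr1 (@nat_of_ord _)).
rewrite !inordK ?patch_index_le// => E.
rewrite E => gE; exists (patch_matrix (patch_index w')).
have le : `|shear (patch_matrix (patch_index w')) w' -
            shear (patch_matrix (patch_index w')) w| <= delta.
  rewrite distrC.
  apply: (grid_close d0 (cell_number_gt delta) _ _ gE); exact: norm_shear_le.
split=> //; first exact: norm_patch_matrix.
have := sP (mem_nth (set0, 0) (patch_index_lt Kw')) => -[_ tw _].
have Uw' := conj (patch_index_in Kw') Kw'.
have Uw := conj (patch_index_in Kw) Kw; rewrite E in Uw.
have [_ h] := tw w w' Uw Uw'.
apply: (le_trans h); rewrite ler_wpM2l ?(le_trans ler01)// lerD2l.
by rewrite ler_wpM2l ?(le_trans ler01)// ler_sqr ?nnegrE// ltW.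
Qed.

Lemma measurable_shear_coord (M : 'M[R]_d) a :
  measurable_fun setT ((fun w : X => shear M w 0 a) : X -> measurableTypeR R).
Proof.
have m1 i : measurable_fun setT ((fun w : X => (w.1 : V) 0 i) : X -> measurableTypeR R).
  exact: (measurableT_comp (@measurable_rV_coord R d i) measurable_fst).
have m2 i : measurable_fun setT ((fun w : X => (w.2 : V) 0 i) : X -> measurableTypeR R).
  exact: (measurableT_comp (@measurable_rV_coord R d i) measurable_snd).
rewrite (_ : (fun w => _) = (fun w : X => (w.2 : V) 0 a - \sum_b (w.1 : V) 0 b * M b a)).
  apply: (measurable_funB (m2 a)).
  exact: (measurable_sum _ (fun b => measurable_funM (m1 b) (measurable_cst (M b a)))).
by apply/funext => w; rewrite !mxE.
Qed.

Lemma measurable_sheared_cell delta : measurable_fibers (sheared_cell delta : X -> _).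
Proof.
move=> [l g].
have mi : measurable_fibers (patch_index : X -> nat).
  apply: measurable_fibers_find => U /mapP[W Ws ->].
  by have [] := sP Ws.
pose G (w : X) := grid (cell_number delta) shear_bound delta (shear (patch_matrix l) w).
have mG : measurable_fibers G.
  apply: measurable_fibers_ffun => a.
  apply: (measurable_fibers_map (idx := fun w : X =>
    Num.truncn ((shear (patch_matrix l) w 0%R a + shear_bound) / delta))
    (inord : nat -> 'I_(cell_number delta).+1)).
  apply: measurable_fibers_truncn; apply: measurable_funM => //.
  by apply: measurable_funD => //; exact: measurable_shear_coord.
have := measurableI _ _ (mi l) (mG g); congr measurable.
apply/seteqP; split=> w /=; rewrite /sheared_cell.
  by move=> [-> <-]; rewrite inord_val.
move=> [] El Eg; have E : patch_index w = l by rewrite -El inordK ?patch_index_le.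
by split => //; rewrite /G -E.
Qed.

(** The grid subdivides a cube of [d] dimensions whose size depends on the patches only. *)
Lemma card_sheared_cells : exists A : R, 0 < A /\ forall delta, 0 < delta -> delta <= 1 ->
  #|{: 'I_(size s).+1 * {ffun 'I_d -> 'I_(cell_number delta).+1}}|%:R <=
  A / delta ^+ d.
Proof.
exists ((size s).+1%:R * (2 * shear_bound + 1) ^+ d).
have b0 := shear_bound_ge0.
have b1 : 0 < 2 * shear_bound + 1 by rewrite ltr_wpDl// mulr_ge0.
split; first by rewrite mulr_gt0// exprn_gt0.
move=> delta d0 d1.
rewrite card_prod card_ord card_ffun !card_ord natrM natrX -mulrA ler_wpM2l//.
have q0 : 0 <= (2 * shear_bound + 1) * delta^-1.
  by apply: mulr_ge0; [exact: ltW|rewrite invr_ge0 ltW].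
rewrite -exprVn -exprMn lerXn2r ?nnegrE//.
have := @truncn_le R (2 * shear_bound / delta).
have -> : 0 <= 2 * shear_bound / delta.
  by apply: divr_ge0; [exact: mulr_ge0|exact: ltW].
rewrite -/(cell_number delta) -[(cell_number delta).+1%:R]natr1 => h.
have -> : (2 * shear_bound + 1) * delta^-1 = 2 * shear_bound / delta + delta^-1 by ring.
by rewrite lerD// invf_ge1.
Qed.

(** For a given [w.1], the shear is a translation of [w.2], so the section of a cell is a
    translate of a grid cube. *)
Lemma sheared_cell_volume delta t (x0 : V) (r : R) (S : set X) :
  0 < delta -> 0 <= r -> measurable S ->
  (forall w, S w -> [/\ K w, sheared_cell delta w = t & `|w.1 - x0| < r]) ->
  (prod_measure (lebesgue_rV d) (lebesgue_rV d) S <=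
     ((2 * delta) ^+ d * (2 * r) ^+ d)%:E)%E.
Proof.
move=> d0 r0 mS SP; have [B [mB Br lB]] := lebesgue_ball_le x0 r0.
apply: (le_trans (@prod_measure_le _ _ _ _ _ _ _ S B ((2 * delta) ^+ d) _ _ _ _ _)) => //.
- by rewrite exprn_ge0// mulr_ge0// ltW.
- by move=> w /SP[_ _ wr]; exact: Br.
- move=> x; apply: (@lebesgue_grid_cell _ _ (cell_number delta) shear_bound delta d0
    (cell_number_gt delta) (x *m patch_matrix t.1) t.2).
    exact: measurable_xsection.
  move=> y; rewrite /xsection /= => /set_mem /SP[Kw].
  rewrite /sheared_cell => <- _ /=; rewrite inordK ?patch_index_le//; split => //.
  exact: (norm_shear_le _ Kw).
by rewrite lB -EFinM.
Qed.

End sheared_cells.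

(** * The entropy of a plan from below *)

(** Logarithmic bookkeeping for [ln_shell_density_ge]: [n] is the dimension, [m] the
    index of the shell plus one, and the logarithms are those of the number of cells
    ([lc]), of [delta] ([ld]), of [m] ([lk]) and of [2] ([l2]). *)
Lemma shell_density_arith (R : realFieldType) (lc lA ld lk l2 n m : R) :
  lc <= lA - n * ld -> n * lk <= n * m -> m * l2 <= m ->
  - (n * ld) - (lA + 2 * n * l2) - (n + 1) * m <=
  - (lc + (n * (l2 + ld) + n * (l2 + (lk + ld))) + m * l2).
Proof.
move=> h1 h2 h3.
have -> : - (lc + (n * (l2 + ld) + n * (l2 + (lk + ld))) + m * l2) =
  - lc - 2 * (n * ld) - 2 * n * l2 - n * lk - m * l2 by ring.
have -> : (n + 1) * m = n * m + m by ring.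
lra.
Qed.

Lemma sum_half_le1 (R : realFieldType) n : \sum_(k < n) (2 ^+ k.+1)^-1 <= 1 :> R.
Proof.
suff -> : \sum_(k < n) (2 ^+ k.+1)^-1 = 1 - (2 ^+ n)^-1 :> R.
  by rewrite lerBlDr lerDl invr_ge0 exprn_ge0.
elim: n => [|n IH]; first by rewrite big_ord0 expr0 invr1 subrr.
rewrite big_ord_recr/= IH exprS; field.
by rewrite expf_neq0.
Qed.

Section entropy_lower_bound.
Context {R : realType} {d : nat}.
Local Notation V := 'rV[R]_d.
Local Notation X := (borel V * borel V)%type.
Variables (f : V * V -> R) (K : set (V * V)).
Variables (s : seq (set (V * V) * 'M[R]_d)) (C rho : R).
Hypotheses (C1 : 1 <= C) (rho0 : 0 <= rho).
Hypothesis sP : forall U, U \in s -> [/\ measurable (U.1 : set X),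
  twisted_patch f (U.1 `&` K) U.2 C & `|U.2| <= C].
Hypothesis scov : forall p, K p -> exists2 U, U \in s & U.1 p.
Hypothesis Krho : forall p, K p -> `|p.1| <= rho /\ `|p.2| <= rho.
Hypothesis mK : measurable (K : set X).
Hypothesis bf : bounded_measurable (f : X -> R).

Variable delta : R.
Hypotheses (delta0 : 0 < delta).

Local Notation cell := (sheared_cell s C rho delta).
Local Notation cellT :=
  ('I_(size s).+1 * {ffun 'I_d -> 'I_(@cell_number R d C rho delta).+1})%type.

Let mcell : measurable_fibers (cell : X -> cellT).
Proof. exact: measurable_sheared_cell sP _. Qed.

Local Notation same_cell := (same_fiber (K : set X) (cell : X -> cellT)).

Lemma measurable_same_cell : measurable_fun setT same_cell.
Proof. exact: measurable_same_fiber. Qed.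

(** The displacement of the sources of two points of a common cell; cut off to [0]
    elsewhere, which makes it bounded. *)
Definition spread (z : X * X) : R :=
  if same_cell z then `|(z.2.1 : V) - z.1.1| else 0.

Lemma spread_ge0 z : 0 <= spread z.
Proof. by rewrite /spread; case: ifP. Qed.

Lemma spread_le z : spread z <= 2 * rho.
Proof.
rewrite /spread; case: ifP => [/and3P[/set_mem h1 /set_mem h2 _]|_]; last first.
  by rewrite mulr_ge0.
have [a1 _] := Krho h1; have [a2 _] := Krho h2.
by rewrite (le_trans (ler_normB _ _))// mulrDl mul1r lerD.
Qed.

Lemma bounded_measurable_spread : bounded_measurable spread.
Proof.
split; last by exists (2 * rho) => z; rewrite ger0_norm ?spread_ge0 ?spread_le.
apply: measurable_fun_ifT => //; first exact: measurable_same_cell.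
apply: measurable_norm_rV => a.
rewrite (_ : (fun w => _) = (fun z : X * X => (z.2.1 : V) 0 a - (z.1.1 : V) 0 a)); last first.
  by apply/funext => z; rewrite !mxE.
have m1 : measurable_fun setT (fun w : X => (w.1 : V) 0 a).
  exact: (measurableT_comp (@measurable_rV_coord R d a) measurable_fst).
apply: measurable_funB.
  exact: (measurableT_comp m1 measurable_snd).
exact: (measurableT_comp m1 measurable_fst).
Qed.

Lemma spread_sqr_le z : spread z ^+ 2 <=
  C * (if same_cell z then mixed_diff f z.1 z.2 else 0) + C ^+ 2 * delta ^+ 2.
Proof.
rewrite /spread; case: ifP => [/and3P[/set_mem h1 /set_mem h2 /eqP E]|_].
  have [M [_ _ h]] := sheared_cell_twisted C1 sP scov Krho delta0 h1 h2 E.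
  by rewrite (le_trans h)// mulrDr expr2 mulrA.
by rewrite expr0n mulr0 add0r mulr_ge0// sqr_ge0.
Qed.

Lemma bounded_measurable_mixed_diff (b : X * X -> bool) : measurable_fun setT b ->
  bounded_measurable (fun z : X * X => if b z then mixed_diff f z.1 z.2 else 0).
Proof.
move=> mb; apply: bounded_measurable_if => //.
have m1 : measurable_fun setT (fun z : X * X => (z.1.1, z.2.2)).
  apply: measurable_fun_pair.
    exact: measurableT_comp measurable_fst measurable_fst.
  exact: measurableT_comp measurable_snd measurable_snd.
have m2 : measurable_fun setT (fun z : X * X => (z.2.1, z.1.2)).
  apply: measurable_fun_pair.
    exact: measurableT_comp measurable_fst measurable_snd.
  exact: measurableT_comp measurable_snd measurable_fst.
apply: bounded_measurableB; last exact: (bounded_measurable_comp m2 bf).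
apply: bounded_measurableB; last exact: (bounded_measurable_comp m1 bf).
apply: bounded_measurableD.
  exact: (bounded_measurable_comp measurable_fst bf).
exact: (bounded_measurable_comp measurable_snd bf).
Qed.

Variables (mu0 mu1 : probability (borel V) R) (OT0 : R).
Hypothesis couplingK : forall g, coupling mu0 mu1 g -> g (~` K) = 0%E.
Hypothesis OT0_le : forall g : probability X R, coupling mu0 mu1 g -> OT0 <= \int[g]_w f w.

(** Inside a cell the spread is controlled by the mixed difference, whose mean is twice
    the cost saved by resampling, at most [\int[g]_w f w - OT0]. *)
Lemma spread_mean_le (g : probability X R) (Q : probability (X * X)%type R) :
  coupling mu0 mu1 g -> self_coupling g Q ->
  \int[Q]_z spread z ^+ 2 <= 2 * C * (\int[g]_w f w - OT0) + C ^+ 2 * delta ^+ 2.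
Proof.
move=> hg hQ.
have [g' [hg' _ g'E]] := resample_plan hg hQ measurable_same_cell (same_fiberC _ _) bf.
have := OT0_le hg'; rewrite g'E => le.
set I := \int[Q]_z _ in le.
have bD := bounded_measurable_mixed_diff measurable_same_cell.
have C0 : 0 <= C by exact: le_trans C1.
have b2 : bounded_measurable (fun z => spread z ^+ 2).
  split; first by apply: measurable_funX; exact: bounded_measurable_spread.1.
  exists ((2 * rho) ^+ 2) => z; rewrite ger0_norm ?sqr_ge0// ler_sqr ?nnegrE ?mulr_ge0//.
    exact: spread_le.
  exact: spread_ge0.
have bCD : bounded_measurable (fun z => C * (if same_cell z then mixed_diff f z.1 z.2 else 0)).
  have [mD [M HM]] := bD; split; first exact: measurable_funM.
  by exists (C * M) => z; rewrite normrM ger0_norm// ler_wpM2l.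
have bk : bounded_measurable (fun _ : X * X => C ^+ 2 * delta ^+ 2).
  exact: bounded_measurable_cst.
apply: (@le_trans _ _ (\int[Q]_z (C * (if same_cell z then mixed_diff f z.1 z.2 else 0)
    + C ^+ 2 * delta ^+ 2))).
  apply: le_Rintegral_bounded => //; first exact: bounded_measurableD.
  exact: spread_sqr_le.
rewrite RintegralD//; try exact: bounded_measurable_integrable.
rewrite RintegralZl//; last exact: bounded_measurable_integrable.
rewrite Rintegral_cst// [X in fine X]probability_setT mulr1 lerD2r -/I.
rewrite (mulrC 2) -mulrA ler_wpM2l//; lra.
Qed.

(** Density at the points of a cell whose first coordinate is at distance between
    [k * delta] and [k.+1 * delta] of that of the centre. The total mass of a cell is at
    most [#|cellT|^-1], the shell [k] having at most the part [2 ^- k.+1]. *)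
Definition shell_density (k : nat) : R :=
  (#|{: cellT}|%:R * ((2 * delta) ^+ d * (2 * (k.+1%:R * delta)) ^+ d) * 2 ^+ k.+1)^-1.

Lemma shell_density_gt0 k : 0 < shell_density k.
Proof.
rewrite invr_gt0 !mulr_gt0 ?exprn_gt0 ?mulr_gt0//.
rewrite ltr0n; apply/card_gt0P; exists (ord0, [ffun=> ord0]).
by rewrite inE.
Qed.

Lemma ln_shell_density_ge (A : R) k : 0 < A -> #|{: cellT}|%:R <= A / delta ^+ d ->
  - (d%:R * ln delta) - (ln A + 2 * d%:R * ln 2) - (d%:R + 1) * k.+1%:R <=
  ln (shell_density k).
Proof.
move=> A0 cA.
have c0 : (0 : R) < #|{: cellT}|%:R.
  by rewrite ltr0n; apply/card_gt0P; exists (ord0, [ffun=> ord0]); rewrite inE.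
have dd0 : 0 < delta ^+ d by rewrite exprn_gt0.
have k0 : (0 : R) < k.+1%:R by [].
rewrite /shell_density lnV ?posrE ?mulr_gt0 ?exprn_gt0 ?mulr_gt0//.
rewrite !lnM ?posrE ?mulr_gt0 ?exprn_gt0 ?mulr_gt0//.
have lnX (x : R) n : 0 < x -> ln (x ^+ n) = n%:R * ln x.
  by move=> x0; rewrite lnXn// mulr_natl.
rewrite !lnX ?mulr_gt0// !lnM ?posrE ?mulr_gt0//.
have h1 : ln #|{: cellT}|%:R <= ln A - d%:R * ln delta.
  rewrite -lnX// -ln_div ?posrE// ler_ln ?posrE//.
  by rewrite divr_gt0.
have h2 : ln k.+1%:R <= k.+1%:R :> R by exact/ltW/ln_sublinear.
have h3 : ln 2 <= (1 : R).
  by have := @le_ln1Dx R 1 _; rewrite -[1 + 1]/2; apply; lra.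
have h2' : d%:R * ln k.+1%:R <= d%:R * k.+1%:R :> R by rewrite ler_wpM2l.
have h3' : k.+1%:R * ln 2 <= k.+1%:R :> R by rewrite ler_piMr.
exact: shell_density_arith h1 h2' h3'.
Qed.

Variable g : probability X R.
Hypothesis hg : coupling mu0 mu1 g.

(** Gibbs' inequality against [shell_density], with centres provided by
    [fin_cell_coupling_exists]. Its logarithm is at least affine in the index of the
    shell, whose mean is controlled by the mean square spread. *)
Lemma plan_entropy_ge (A : R) : 0 < A -> #|{: cellT}|%:R <= A / delta ^+ d ->
  ((- (d%:R * ln delta) - (ln A + 2 * d%:R * ln 2) -
    (d%:R + 1) * (2 + (2 * C * (\int[g]_w f w - OT0) + C ^+ 2 * delta ^+ 2) / delta ^+ 2))%:E
   <= plan_entropy g)%E.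
Proof.
move=> A0 cA.
have gK : g (~` K) = 0%E by exact: couplingK.
have [Q [hQ QE Qc]] := fin_cell_coupling_exists g mcell.
have bs := bounded_measurable_spread.
have b2 : bounded_measurable (fun z => spread z ^+ 2).
  split; first by apply: measurable_funX; exact: bs.1.
  exists ((2 * rho) ^+ 2) => z; rewrite ger0_norm ?sqr_ge0// ler_sqr ?nnegrE ?mulr_ge0//.
    exact: spread_le.
  exact: spread_ge0.
(* [Y t] is the centre of the cell [t] *)
have [Y [YP Yle]] := Qc K _ mK gK b2 (fun z => sqr_ge0 _).
have {}Yle := le_trans Yle (spread_mean_le hg hQ).
pose r (w : X) := spread (w, Y (cell w)).
have mY : measurable_fun setT (fun w : X => (w, Y (cell w))).
  by apply: measurable_fun_pair => //; exact: measurable_fun_of_fibers mcell.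
have br : bounded_measurable r by exact: bounded_measurable_comp mY bs.
have r0 w : 0 <= r w by exact: spread_ge0.
pose n (w : X) := Num.truncn (r w / delta).
pose N := Num.truncn (2 * rho / delta).
have nN w : (n w < N.+1)%N.
  by rewrite ltnS le_truncn// ler_pM2r ?invr_gt0// spread_le.
have mn : measurable_fibers n.
  by apply: measurable_fibers_truncn; apply: measurable_funM => //; exact: br.1.
pose l (w : X) := ln (shell_density (n w)).
have bl : bounded_measurable l.
  split; first exact: (measurable_fun_of_fibers (fun k => ln (shell_density k)) mn).
  exists (\sum_(k < N.+1) `|ln (shell_density k)|) => w.
  rewrite (bigD1 (Ordinal (nN w)))//= lerDl; exact: sumr_ge0.
pose A_ t : set X := cell @^-1` [set t].
(* only the cells charged by [g] have a centre in [K] *)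
pose G := K `&` [set w | g (A_ (cell w)) != 0%E].
have mG : measurable (G : set X).
  apply: measurableI => //.
  exact: (measurable_fibers_map (fun t => g (A_ t) != 0%E) mcell true).
have gG : g (~` G) = 0%E.
  have mGC : measurable (~` G : set X) by exact: measurableC.
  rewrite (measure_fin_cells mcell g mGC) big1// => t _.
  have [At0|At0] := eqVneq (g (A_ t)) 0%E; apply/eqP; rewrite -measure_le0.
    rewrite -At0 le_measure ?inE//; first by apply: measurableI => //; exact: mcell.
    exact: mcell.
  rewrite -gK le_measure ?inE//; first by apply: measurableI => //; exact: mcell.
    exact: measurableC.
  by move=> w [nG /= E] Kw; apply: nG; split => //=; rewrite E.
have le1 : (\int[prod_measure (lebesgue_rV d) (lebesgue_rV d)]_(w in G) (expR (l w))%:E <= 1)%E.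
  set leb := prod_measure _ _.
  pose idx (w : X) : cellT * 'I_N.+1 := (cell w, inord (n w)).
  have midx : measurable_fibers idx.
    by apply: measurable_fibers_pair => //; exact: measurable_fibers_map.
  have mel : measurable_fun setT (fun w => (expR (l w))%:E).
    by apply/measurable_EFinP; exact: (measurableT_comp (@measurable_expR R) bl.1).
  rewrite integral_mkcond (ge0_integral_fin_cells midx); last 2 first.
  - by apply: (measurable_restrictT _ mG).1; exact: measurable_funTS.
  - by move=> w; rewrite patchE; case: ifP => // _; rewrite lee_fin expR_ge0.
  have cellT0 : (0 : R) < #|{: cellT}|%:R.
    by rewrite ltr0n; apply/card_gt0P; exists (ord0, [ffun=> ord0]); rewrite inE.
  apply: (@le_trans _ _ (\sum_(p : cellT * 'I_N.+1) ((#|{: cellT}|%:R * 2 ^+ p.2.+1)^-1)%:E)%E).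
    apply: lee_sum => -[t k] _ /=; rewrite -integral_mkcondr.
    rewrite (eq_integral (cst (shell_density k)%:E)); last first.
      move=> w /[!inE] -[[_ <-] _]; rewrite /= inordK// /l lnK//.
      by rewrite posrE shell_density_gt0.
    have mAG : measurable (idx @^-1` [set (t, k)] `&` G : set X).
      by apply: measurableI => //; exact: midx.
    rewrite integral_cst//.
    have vol : (leb (idx @^-1` [set (t, k)] `&` G) <=
       ((2 * delta) ^+ d * (2 * (k.+1%:R * delta)) ^+ d)%:E)%E.
      apply: (@sheared_cell_volume _ _ f K s C rho C1 sP Krho delta t (Y t).1) => //.
        by rewrite mulr_ge0// ltW.
      move=> w [[E1 E2] [Kw gw]]; split => //.
      have [Yt YK] : A_ t (Y t) /\ K (Y t) by apply: YP; rewrite -E1.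
      have : r w < k.+1%:R * delta.
        by rewrite -ltr_pdivrMr// -E2 inordK// truncnS_gt.
      rewrite /r /spread /same_fiber /= !mem_set//= ?E1// Yt eqxx/= distrC.
      by [].
    apply: (le_trans (lee_wpmul2l _ vol)); first by rewrite lee_fin ltW// shell_density_gt0.
    rewrite -EFinM lee_fin /shell_density; set a := _ * _ ^+ d.
    have a0 : 0 < a by rewrite mulr_gt0 ?exprn_gt0 ?mulr_gt0.
    rewrite le_eqVlt; apply/orP; left; apply/eqP; field.
    by rewrite !gt_eqF ?exprn_gt0.
  rewrite sumEFin lee_fin -(pair_bigA _ (fun (t : cellT) (k : 'I_N.+1) => (#|{: cellT}|%:R * 2 ^+ k.+1)^-1))/=.
  rewrite sumr_const -(mulr_natl (\sum_(k < N.+1) _)) mulr_sumr.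
  rewrite (eq_bigr (fun k : 'I_N.+1 => (2 ^+ k.+1)^-1)); last first.
    by move=> k _; rewrite invfM mulrA divff ?mul1r// gt_eqF.
  exact: sum_half_le1.
have := entropy_ge mG gG bl le1; apply: le_trans.
rewrite -[leRHS]fineK; last exact/integrable_fin_num/bounded_measurable_integrable.
rewrite lee_fin -/(Rintegral g setT l).
set B0 := - _ - _.
have br2 : bounded_measurable (fun w => r w ^+ 2) by exact: bounded_measurable_comp mY b2.
have bk : bounded_measurable (fun _ : X => B0 - 2 * (d%:R + 1)).
  exact: bounded_measurable_cst.
have bkr : bounded_measurable (fun w : X => (d%:R + 1) / delta ^+ 2 * r w ^+ 2).
  have [mr [M HM]] := br2; split; first exact: measurable_funM.
  have k0 : 0 <= (d%:R + 1) / delta ^+ 2 by rewrite divr_ge0 ?addr_ge0// sqr_ge0.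
  by exists ((d%:R + 1) / delta ^+ 2 * M) => w; rewrite normrM ger0_norm// ler_wpM2l.
apply: (@le_trans _ _ (\int[g]_w (B0 - 2 * (d%:R + 1) - (d%:R + 1) / delta ^+ 2 * r w ^+ 2))); last first.
  apply: le_Rintegral_bounded => //; first exact: bounded_measurableB.
  move=> w; apply: le_trans (ln_shell_density_ge (n w) A0 cA); rewrite -/B0.
  rewrite -addrA lerD2l -opprD lerN2.
  (* [a + 1 <= 2 + a^2] for [a = r w / delta] *)
  have h : (n w).+1%:R <= 2 + r w ^+ 2 / delta ^+ 2.
    have : (n w)%:R <= r w / delta.
      have q0 : 0 <= r w / delta by apply: divr_ge0 => //; exact: ltW.
      by have := @truncn_le R (r w / delta); rewrite q0 => ->.
    have : 0 <= (r w / delta - 2^-1) ^+ 2 by exact: sqr_ge0.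
    rewrite -expr_div_n -[(n w).+1%:R]natr1; move: (r w / delta) (n w)%:R => a b h1 h2.
    have : (a - 2^-1) ^+ 2 = a ^+ 2 - a + 4^-1 by field.
    by move=> E; rewrite E in h1; lra.
  have d1 : 0 <= (d%:R + 1 : R) by rewrite addr_ge0.
  apply: (le_trans (ler_wpM2l d1 h)); rewrite le_eqVlt; apply/orP; left; apply/eqP; ring.
rewrite RintegralB//; try exact: bounded_measurable_integrable.
rewrite RintegralZl//; last exact: bounded_measurable_integrable.
rewrite Rintegral_cst// [X in fine X]probability_setT mulr1.
have h : (d%:R + 1) / delta ^+ 2 * \int[g]_w r w ^+ 2 <=
    (d%:R + 1) / delta ^+ 2 * (2 * C * (\int[g]_w f w - OT0) + C ^+ 2 * delta ^+ 2).
  by rewrite ler_wpM2l// divr_ge0 ?addr_ge0// sqr_ge0.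
move: h; set I2 := \int[g]_w r w ^+ 2; set b := _ + C ^+ 2 * _ => h.
have -> : (d%:R + 1) * (2 + b / delta ^+ 2) = 2 * (d%:R + 1) + (d%:R + 1) / delta ^+ 2 * b.
  by ring.
by rewrite opprD addrA lerD2l lerN2.
Qed.

End entropy_lower_bound.

(** * Blocks charged by an optimal plan *)

Lemma eq_of_modn_close (k i j : nat) : (i <= j + k)%N -> (j <= i + k)%N ->
  (i %% k.+1 = j %% k.+1)%N -> i = j.
Proof.
wlog ij : i j / (i <= j)%N => [H|_ ji E].
  by case: (leqP i j) => [|/ltnW] ij h1 h2 E; [exact: H|apply/esym/H].
have : (k.+1 %| j - i)%N by rewrite -eqn_mod_dvd//; apply/eqP.
have : (j - i < k.+1)%N by rewrite ltnS leq_subLR.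
case: (posnP (j - i)) => [|p0 lt /(dvdn_leq p0)]; last by rewrite leqNgt lt.
by move=> /eqP; rewrite subn_eq0 => ji' _ _; apply/eqP; rewrite eqn_leq ij.
Qed.

Section block_count.
Context {R : realType} {d : nat}.
Local Notation V := 'rV[R]_d.
Local Notation X := (borel V * borel V)%type.
Variables (f : V * V -> R) (K : set (V * V)).
Variables (s : seq (set (V * V) * 'M[R]_d)) (C rho : R).
Hypotheses (C1 : 1 <= C) (rho0 : 0 <= rho).
Hypothesis sP : forall U, U \in s -> [/\ measurable (U.1 : set X),
  twisted_patch f (U.1 `&` K) U.2 C & `|U.2| <= C].
Hypothesis scov : forall p, K p -> exists2 U, U \in s & U.1 p.
Hypothesis Krho : forall p, K p -> `|p.1| <= rho /\ `|p.2| <= rho.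
Hypothesis mK : measurable (K : set X).
Hypothesis bf : bounded_measurable (f : X -> R).

Variable delta : R.
Hypotheses (delta0 : 0 < delta).

Definition block_number : nat := Num.truncn (2 * rho / delta).

Local Notation blockT := {ffun 'I_d -> 'I_block_number.+1}.
Local Notation cell := (sheared_cell s C rho delta).
Local Notation cellT :=
  ('I_(size s).+1 * {ffun 'I_d -> 'I_(@cell_number R d C rho delta).+1})%type.

Definition block (w : V * V) : blockT * blockT :=
  (grid block_number rho delta w.1, grid block_number rho delta w.2).

Lemma block_number_gt : 2 * rho / delta < block_number.+1%:R.
Proof. exact: truncnS_gt. Qed.

Lemma measurable_block : measurable_fibers (block : X -> _).
Proof.
have mg := @measurable_grid R d block_number rho delta.
apply: measurable_fibers_pair => t.
  exact: (measurable_fibers_comp measurable_fst mg).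
exact: (measurable_fibers_comp measurable_snd mg).
Qed.

Variables (mu0 mu1 : probability (borel V) R) (OT0 : R).
Hypothesis OT0_le : forall g : probability X R, coupling mu0 mu1 g -> OT0 <= \int[g]_w f w.
Variable g : probability X R.
Hypothesis hg : coupling mu0 mu1 g.
Hypothesis gK : g (~` K) = 0%E.
Hypothesis gopt : \int[g]_w f w = OT0.

Let mcell : measurable_fibers (cell : X -> cellT).
Proof. exact: measurable_sheared_cell sP _. Qed.

(** Two-point monotonicity of an optimal plan: exchanging targets inside a cell
    cannot lower the cost, so almost no pair of a cell can profit from it. *)
Lemma optimal_pair (t : cellT) (S S' : set X) : measurable S -> measurable S' ->
  S `<=` K `&` cell @^-1` [set t] -> S' `<=` K `&` cell @^-1` [set t] ->
  g S != 0%E -> g S' != 0%E ->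
  exists w w', [/\ S w, S' w' & mixed_diff f w w' <= 0].
Proof.
move=> mS mS' SK SK' gS gS'; apply: contrapT => no.
have pos w w' : S w -> S' w' -> 0 < mixed_diff f w w'.
  by move=> Sw Sw'; rewrite ltNge; apply/negP => le; apply: no; exists w, w'.
have [Q [hQ QE _]] := fin_cell_coupling_exists g mcell.
have bD0 := bounded_measurable_mixed_diff bf (measurable_cst true).
pose b (z : X * X) := same_fiber (K : set X) (cell : X -> cellT) z && (0 < mixed_diff f z.1 z.2).
have mb : measurable_fun setT b.
  apply: measurable_and; first exact: measurable_same_fiber.
  by apply: measurable_fun_ltr => //; exact: bD0.1.
have bC p q : b (p, q) = b (q, p).
  rewrite /b same_fiberC /=; congr (_ && (0 < _)).
  by rewrite /mixed_diff /= addrAC [f p + _]addrC addrAC.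
have bD := bounded_measurable_mixed_diff bf mb.
have [g' [hg' _ g'E]] := resample_plan hg hQ mb bC bf.
have := OT0_le hg'; rewrite g'E gopt.
set I := \int[Q]_z _ => le.
have I0 : I <= 0 by lra.
have D0 z : 0 <= (if b z then mixed_diff f z.1 z.2 else 0).
  by case: ifP => // /andP[_ /ltW].
pose E := S `*` S'.
have mE : measurable E by exact: measurableX.
have QE0 : Q E = 0%E.
  have iD := bounded_measurable_integrable Q bD.
  have eI : (\int[Q]_z (if b z then mixed_diff f z.1 z.2 else 0)%:E = 0)%E.
    apply/eqP; rewrite eq_le integral_ge0 ?andbT; last by move=> z _; rewrite lee_fin.
    rewrite -[leLHS]fineK; last exact: integrable_fin_num.
    by rewrite lee_fin.
  have [N [mN QN HN]] : ae_eq Q setT (fun z => (if b z then mixed_diff f z.1 z.2 else 0)%:E) (cst 0%E).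
    apply/ae_eq_integral_abs => //; first by apply/measurable_EFinP; exact: bD.1.
    rewrite -[RHS]eI; apply: eq_integral => z _; rewrite gee0_abs//.
    by rewrite lee_fin; exact: D0.
  apply/eqP; rewrite -measure_le0 -QN le_measure ?inE//.
  move=> [w w'] [/= Sw Sw']; apply: HN => /(_ Logic.I) /=.
  have [Kw /= tw] := SK _ Sw; have [Kw' /= tw'] := SK' _ Sw'.
  rewrite /b /same_fiber /= !mem_set//= tw tw' eqxx/= pos//= => -[] E0.
  by have := pos _ _ Sw Sw'; rewrite E0 ltxx.
pose A_ u : set X := cell @^-1` [set u].
have gA0 : g (A_ t) != 0%E.
  apply: contra_neq gS => gA; apply/eqP; rewrite -measure_le0 -gA le_measure ?inE//.
    exact: mcell.
  by move=> w /SK[].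
have gAf : g (A_ t) \is a fin_num by apply: fin_num_measure; exact: mcell.
have p0 : 0 < fine (g (A_ t)).
  by apply: fine_gt0; rewrite lt0e gA0 measure_ge0/= ltey_eq gAf.
have : (((fine (g (A_ t)))^-1)%:E * (g \x g)%E (E `&` (A_ t `*` A_ t)) <= Q E)%E.
  rewrite QE (bigD1 t)//= leeDl// sume_ge0// => u _.
  by rewrite mule_ge0// lee_fin invr_ge0 fine_ge0.
rewrite QE0 (_ : E `&` _ = E); last first.
  apply/seteqP; split=> [z []//|[w w'] [/= Sw Sw']]; split => //; split => /=.
    by have [] := SK _ Sw.
  by have [] := SK' _ Sw'.
rewrite leNgt => /negP; apply; rewrite mule_gt0 ?lte_fin ?invr_gt0//.
rewrite [ltRHS](_ : _ = (g S * g S')%E); last by rewrite product_measure1E.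
by rewrite mule_gt0// lt0e ?gS ?gS' measure_ge0.
Qed.

(** Send each charged block to a sheared cell in which it is charged and to the residues
    modulo [k.+1] of its grid indices. Two blocks charged in the same cell contain a pair
    with nonpositive mixed difference, whose points are at distance [O(delta)]; their
    indices differ by at most [k], so that the residues separate them. *)
Lemma positive_blocks_card (k : nat) : 1 + C + d%:R * C * C <= k%:R ->
  (#|[pred B | g (block @^-1` [set B]) != 0%E]| <=
   #|{: cellT}| * (k.+1 ^ d * k.+1 ^ d))%N.
Proof.
move=> kC; pose A_ u : set X := cell @^-1` [set u].
have mblk := measurable_block.
have C0 : 0 <= C by exact: le_trans C1.
have /choice[tt Ht] : forall B, exists t, g (block @^-1` [set B]) != 0%E ->
    g (block @^-1` [set B] `&` A_ t `&` K) != 0%E.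
  move=> B; have [gB|gB] := boolP (g (block @^-1` [set B]) != 0%E); last first.
    by exists (ord0, [ffun=> ord0]).
  have : exists t, g (block @^-1` [set B] `&` A_ t) != 0%E.
    apply: contrapT => no; move/eqP: gB; apply.
    rewrite (measure_fin_cells mcell g (mblk B)) big1// => t _.
    by apply/eqP/negPn/negP => h; apply: no; exists t.
  move=> [t ht]; exists t => _; apply: contra_neq ht => h0.
  apply/eqP; rewrite -measure_le0.
  have mBA : measurable (block @^-1` [set B] `&` A_ t : set X).
    by apply: measurableI; [exact: mblk|exact: mcell].
  rewrite [leLHS](measureDI g mBA mK) [X in (_ + X)%E]h0 adde0 -gK.
  apply: le_measure; rewrite ?inE; [exact: measurableD|exact: measurableC|by move=> w []].
pose md (i : blockT) : {ffun 'I_d -> 'I_k.+1} := [ffun a => inord (i a %% k.+1)].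
have mdE i a : md i a = (i a %% k.+1)%N :> nat by rewrite ffunE inordK// ltn_pmod.
pose Phi (B : blockT * blockT) := (tt B, (md B.1, md B.2)).
have Phi_inj : {in [pred B | g (block @^-1` [set B]) != 0%E] &, injective Phi}.
  move=> B B'; rewrite !inE => gB gB' [] Et m1 m2.
  have [||||||w [w' [[[wB wt] Kw] [[wB' wt'] Kw'] D0]]] := @optimal_pair (tt B)
    (block @^-1` [set B] `&` A_ (tt B) `&` K) (block @^-1` [set B'] `&` A_ (tt B) `&` K).
  - by apply: measurableI => //; apply: measurableI; [exact: mblk|exact: mcell].
  - by apply: measurableI => //; apply: measurableI; [exact: mblk|exact: mcell].
  - by move=> z [[_ ?] ?].
  - by move=> z [[_ ?] ?].
  - exact: Ht.
  - by rewrite Et; exact: Ht.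
  have [M [MC uM xM]] := sheared_cell_twisted C1 sP scov Krho delta0 Kw Kw' (etrans wt (esym wt')).
  have dx : `|w'.1 - w.1| <= C * delta.
    have h : `|w'.1 - w.1| ^+ 2 <= (C * delta) ^+ 2.
      have -> : (C * delta) ^+ 2 = C * (C * delta ^+ 2) by ring.
      by apply: (le_trans xM); rewrite ler_wpM2l// gerDr.
    have Cd0 : 0 <= C * delta by apply: mulr_ge0 => //; exact: ltW.
    by rewrite -ler_sqr ?nnegrE.
  have dy : `|w'.2 - w.2| <= (1 + d%:R * C * C) * delta.
    rewrite (shear_sub M w w').
    rewrite (le_trans (ler_normD _ _))// mulrDl mul1r lerD//.
    apply: (le_trans (norm_mulmx _ _)).
    have -> : d%:R * C * C * delta = d%:R * (C * delta) * C by ring.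
    by rewrite ler_pM ?mulr_ge0// ler_wpM2l.
  have key (x y : V) : `|x| <= rho -> `|y| <= rho -> `|y - x| <= k%:R * delta ->
      md (grid block_number rho delta x) = md (grid block_number rho delta y) ->
      grid block_number rho delta x = grid block_number rho delta y.
    move=> xr yr xy E; apply/ffunP => a; apply/val_inj => /=.
    have h1 := grid_dist delta0 block_number_gt a yr xr xy.
    have h2 : (grid block_number rho delta x a <= grid block_number rho delta y a + k)%N.
      by apply: (grid_dist delta0 block_number_gt) => //; rewrite distrC.
    have := congr1 (fun h : {ffun 'I_d -> 'I_k.+1} => h a : nat) E.
    by rewrite !mdE; exact: eq_of_modn_close.
  have dCC : 0 <= d%:R * C * C by rewrite !mulr_ge0.
  have [w1 w2] := Krho Kw; have [w1' w2'] := Krho Kw'.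
  have E1 : B.1 = B'.1.
    rewrite -wB -wB' /=; apply: key => //; last by rewrite -[X in md X]/((block w).1) wB m1 -wB'.
    apply: (le_trans dx); apply: ler_wpM2r; first exact: ltW.
    apply: le_trans kC.
    by move: dCC; lra.
  have E2 : B.2 = B'.2.
    rewrite -wB -wB' /=; apply: key => //; last by rewrite -[X in md X]/((block w).2) wB m2 -wB'.
    apply: (le_trans dy); apply: ler_wpM2r; first exact: ltW.
    apply: le_trans kC.
    by move: C0; lra.
  by move: E1 E2; clear; case: B B' => [a b] [a' b'] /= -> ->.
rewrite -(card_in_imset Phi_inj) (leq_trans (max_card _))//.
by rewrite !card_prod !card_ffun !card_ord.
Qed.

End block_count.

(** * The entropy of a resampled plan from above *)

Section product_density.
Local Open Scope ereal_scope.
Context d0 d1 (T0 : measurableType d0) (T1 : measurableType d1) (R : realType).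
Variables (P0 : probability T0 R) (P1 : probability T1 R).
Variables (m0 : {sigma_finite_measure set T0 -> \bar R})
  (m1 : {sigma_finite_measure set T1 -> \bar R}).
Hypotheses (Pm0 : P0 `<< m0) (Pm1 : P1 `<< m1).

(** The density may be negative on a null set. *)
Definition pos_density d (T : measurableType d) (P : probability T R)
  (m : {sigma_finite_measure set T -> \bar R}) (x : T) : R :=
  Num.max 0%R (density P m x).

Lemma pos_density_ge0 d (T : measurableType d) (P : probability T R)
  (m : {sigma_finite_measure set T -> \bar R}) x : (0 <= pos_density P m x)%R.
Proof. by rewrite le_max lexx. Qed.

Lemma measurable_pos_density d (T : measurableType d) (P : probability T R)
  (m : {sigma_finite_measure set T -> \bar R}) : P `<< m ->
  measurable_fun setT (pos_density P m).
Proof.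
by move=> Pm; apply: measurable_maxr => //; exact: measurable_density.
Qed.

(** Tonelli, the marginal densities being integrated one after the other. *)
Lemma prod_pos_density_le (S : set (T0 * T1)) : measurable S ->
  (P0 \x P1) S <= \int[prod_measure m0 m1]_(z in S)
    (pos_density P0 m0 z.1 * pos_density P1 m1 z.2)%:E.
Proof.
move=> mS; pose a := pos_density P0 m0; pose b := pos_density P1 m1.
have ma : measurable_fun setT a by exact: measurable_pos_density.
have mb : measurable_fun setT b by exact: measurable_pos_density.
have a0 x : (0 <= a x)%R by exact: pos_density_ge0.
have b0 x : (0 <= b x)%R by exact: pos_density_ge0.
have mab : measurable_fun setT (fun z : T0 * T1 => (a z.1 * b z.2)%R).
  apply: measurable_funM.
    exact: (measurableT_comp ma measurable_fst).
  exact: (measurableT_comp mb measurable_snd).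
pose F := (fun z : T0 * T1 => (a z.1 * b z.2)%:E) \_ S.
have mF : measurable_fun setT F.
  by apply: (measurable_restrictT _ mS).1; apply: measurable_funTS; exact/measurable_EFinP.
have F0 z : 0 <= F z.
  by rewrite /F patchE; case: ifP => // _; rewrite lee_fin mulr_ge0.
rewrite [leRHS](_ : _ = \int[m0]_x \int[m1]_y F (x, y)); last first.
  rewrite -(fubini_tonelli1 F mF F0) integral_mkcond.
  by apply: eq_measure_integral.
pose dens := density P0 m0.
have md : measurable_fun setT dens by exact: measurable_density.
pose v x := fine (P1 (xsection S x)).
have vE x : P1 (xsection S x) = (v x)%:E.
  by rewrite /v fineK// fin_num_measure//; exact: measurable_xsection.
have v0 x : (0 <= v x)%R by rewrite fine_ge0.
have mv : measurable_fun setT v.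
  apply/measurable_EFinP; rewrite (_ : EFin \o v = P1 \o xsection S).
    exact: measurable_fun_xsection.
  by apply/funext => x /=; rewrite vE.
pose q x : R := if (0 < dens x)%R then v x else 0%R.
have mq : measurable_fun setT q.
  by apply: measurable_fun_ifT => //; exact: measurable_fun_ltr.
have q0 x : (0 <= q x)%R by rewrite /q; case: ifP.
rewrite [leLHS](_ : _ = \int[P0]_x (q x)%:E); last first.
  rewrite /product_measure1; apply: ge0_ae_eq_integral => //.
  - by apply: measurable_fun_xsection.
  - exact/measurable_EFinP.
  - by move=> x _; rewrite lee_fin.
  by apply: filterS (density_gt0_ae Pm0) => x dx _; rewrite /q /dens dx /= vE.
rewrite (density_change Pm0 mq q0); last first.
  by move=> x dx; rewrite /q /dens ltNge dx.
apply: ge0_le_integral => //.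
- move=> x _; rewrite lee_fin /q; case: ifP => [dx|_]; last by rewrite mul0r.
  by rewrite mulr_ge0// ltW.
- by apply/measurable_EFinP; exact: measurable_funM.
- exact: (measurable_fun_fubini_tonelli_F F mF F0).
move=> x _; rewrite /q; case: ifPn => [dx|_]; last first.
  by rewrite mul0r; apply: integral_ge0.
rewrite (_ : (fun y => F (x, y)) = (fun y => (a x)%:E * (EFin \o b) y) \_ (xsection S x)); last first.
  apply/funext => y; rewrite /F !patchE /xsection /= -EFinM.
  by rewrite (_ : (y \in [set y | (x, y) \in S]) = ((x, y) \in S))//;
    apply/idP/idP => [/set_mem|h]; last exact: mem_set.
have mSx : measurable (xsection S x) by exact: measurable_xsection.
rewrite -integral_mkcond ge0_integralZl//; last 3 first.
- by apply: measurable_funTS; exact/measurable_EFinP.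
- by move=> y _; rewrite lee_fin.
- by rewrite lee_fin.
rewrite mulrC EFinM; apply: lee_pmul.
- by rewrite lee_fin ltW.
- by rewrite lee_fin.
- by rewrite lee_fin /a /pos_density le_max lexx orbT.
rewrite -vE (density_integral Pm1 mSx) [leLHS]integral_mkcond [leRHS]integral_mkcond.
apply: ae_le_integral.
- apply: (measurable_restrictT _ mSx).1; apply: measurable_funTS.
  by apply/measurable_EFinP; exact: measurable_density.
- apply: (measurable_restrictT _ mSx).1; apply: measurable_funTS.
  exact/measurable_EFinP.
apply: aeW => y; rewrite !patchE; case: ifP => // _.
by rewrite lee_fin /b /pos_density le_max lexx orbT.
Qed.

End product_density.

Section marginal_integral.
Local Open Scope ereal_scope.
Context d d' (X : measurableType d) (Y : measurableType d') (R : realType).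
Variables (P : probability X R) (mu : probability Y R) (phi : X -> Y).
Hypotheses (mphi : measurable_fun setT phi)
  (Pmu : forall A, measurable A -> pushforward P phi A = mu A).

Lemma integrable_marginal (l : Y -> \bar R) :
  mu.-integrable setT l -> P.-integrable setT (l \o phi).
Proof.
move=> /integrableP[ml il]; apply/integrableP; split; first exact: measurableT_comp ml mphi.
apply: le_lt_trans il.
pose phim : {mfun _ >-> _} := HB.pack phi (isMeasurableFun.Build _ _ _ _ _ mphi).
rewrite [leRHS](_ : _ = \int[pushforward P phim]_x `|l x|); last first.
  by apply: eq_measure_integral => A mA _; exact/esym/Pmu.
rewrite ge0_integral_pushforward//; exact: measurableT_comp.
Qed.

(** The log-densities of the marginals have the same mean under every plan. *)
Lemma integral_marginal (l : Y -> \bar R) :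
  mu.-integrable setT l -> \int[P]_x l (phi x) = \int[mu]_y l y.
Proof.
move=> il; have ilphi := integrable_marginal il.
pose phim : {mfun _ >-> _} := HB.pack phi (isMeasurableFun.Build _ _ _ _ _ mphi).
rewrite [RHS](_ : _ = \int[pushforward P phim]_x l x); last first.
  by apply: eq_measure_integral => A mA _; exact/esym/Pmu.
by rewrite (@integral_pushforward _ _ _ _ _ phi)//; exact: measurable_int il.
Qed.

End marginal_integral.

Section rectangular_resampling.
Context d0 d1 (T0 : measurableType d0) (T1 : measurableType d1) (R : realType).
Local Notation X := (T0 * T1)%type.
Variables (mu0 : probability T0 R) (mu1 : probability T1 R) (g : probability X R).
Variables (m0 : {sigma_finite_measure set T0 -> \bar R})
  (m1 : {sigma_finite_measure set T1 -> \bar R}).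
Hypotheses (mum0 : mu0 `<< m0) (mum1 : mu1 `<< m1).
Hypotheses (hg : coupling mu0 mu1 g).
Variables (T : finType) (idx : X -> T) (K : set X).
Hypotheses (midx : measurable_fibers idx) (mK : measurable K) (gK : g (~` K) = 0%E).
Hypothesis rect : forall w w', idx w = idx w' -> idx (w.1, w'.2) = idx w.

Let A t : set X := idx @^-1` [set t].
Let p t : R := fine (g (A t)).
Let leb := prod_measure m0 m1.
Let same := same_fiber K idx.
Let cross (z : X * X) : X := (z.1.1, z.2.2).

Let mA t : measurable (A t). Proof. exact: midx. Qed.

Let pE t : g (A t) = (p t)%:E.
Proof. by rewrite /p fineK// fin_num_measure. Qed.

Let p0 t : 0 <= p t. Proof. by rewrite fine_ge0. Qed.

Let msame : measurable_fun setT same. Proof. exact: measurable_same_fiber. Qed.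

Let mcross : measurable_fun setT cross.
Proof.
apply: measurable_fun_pair.
  exact: measurableT_comp measurable_fst measurable_fst.
exact: measurableT_comp measurable_snd measurable_snd.
Qed.

Let ggX (E F : set X) : measurable E -> measurable F ->
  (g \x g)%E (E `*` F) = (g E * g F)%E.
Proof. by move=> mE mF; apply: product_measure1E. Qed.

Lemma cross_product_measure S : measurable S ->
  (g \x g)%E (cross @^-1` S) = (mu0 \x mu1)%E S.
Proof.
move=> mS.
pose phi : {mfun _ >-> _} := HB.pack cross (isMeasurableFun.Build _ _ _ _ _ mcross).
rewrite [RHS](@product_measure_unique _ _ _ _ _ mu0 mu1 (pushforward (g \x g)%E phi))//.
move=> E F mE mF.
change ((g \x g)%E (cross @^-1` (E `*` F)) = (mu0 E * mu1 F)%E).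
have mE' : measurable (fst @^-1` E : set X) by rewrite -[X in measurable X]setTI; exact: measurable_fst.
have mF' : measurable (snd @^-1` F : set X) by rewrite -[X in measurable X]setTI; exact: measurable_snd.
by rewrite -(hg.1 _ mE) -(hg.2 _ mF) -ggX.
Qed.

Variable Q : probability (X * X)%type R.
Hypotheses (hQ : self_coupling g Q)
  (QE : forall E, Q E = (\sum_(t : T) ((fine (g (A t)))^-1)%:E *
                   (g \x g)%E (E `&` (A t `*` A t)))%E).

Lemma not_same_fiber_null : Q [set z | ~~ same z] = 0%E.
Proof.
have mKC : measurable (~` K) by exact: measurableC.
have m1' : measurable (fst @^-1` (~` K) : set (X * X)).
  by rewrite -[X in measurable X]setTI; exact: measurable_fst.
have m2' : measurable (snd @^-1` (~` K) : set (X * X)).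
  by rewrite -[X in measurable X]setTI; exact: measurable_snd.
have m3 : measurable [set z : X * X | idx z.1 != idx z.2].
  apply: (@measurable_fun_pred _ _ (fun z : X * X => idx z.1 != idx z.2)).
  by apply: measurable_neg; exact: measurable_eq_fiber.
have Q1 : Q (fst @^-1` (~` K)) = 0%E by rewrite hQ.2.
have Q2 : Q (snd @^-1` (~` K)) = 0%E by rewrite -Q1 -[RHS]hQ.1.
have Q3 : Q [set z : X * X | idx z.1 != idx z.2] = 0%E.
  rewrite QE big1// => t _; rewrite (_ : _ `&` _ = set0) ?measure0 ?mule0//.
  by apply/seteqP; split=> // -[a b] [/= /eqP ab [/= at_ bt]]; apply: ab; rewrite at_ bt.
apply/eqP; rewrite -measure_le0.
apply: (@le_trans _ _ (Q ((fst @^-1` (~` K) `|` snd @^-1` (~` K)) `|` [set z : X * X | idx z.1 != idx z.2]))).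
  apply: le_measure; rewrite ?inE.
  - by apply: (@measurable_fun_pred _ _ (fun z => ~~ same z)); exact: measurable_neg.
  - by apply: measurableU => //; exact: measurableU.
  move=> z /negP nz; have [K1|nK] := pselect (K z.1); last by left; left.
  have [K2|nK] := pselect (K z.2); last by left; right.
  by right; apply/negP => E; apply: nz; apply/and3P; split => //; exact: mem_set.
rewrite (le_trans (measureU2 _ _ _))//; first exact: measurableU.
rewrite [X in (_ + X)%E]Q3 adde0 (le_trans (measureU2 _ _ _))//.
by rewrite [X in (X + _)%E]Q1 [X in (_ + X)%E]Q2 adde0.
Qed.

Variable g' : probability X R.
Hypotheses (hg' : coupling mu0 mu1 g')
  (g'E : forall E, g' E = Q (resample same @^-1` E)).

(** Almost every pair lies in a common fiber, where the resampled point is [cross z]. *)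
Lemma resampled_le E : measurable E ->
  (g' E <= \sum_(t : T) ((p t)^-1)%:E * (g \x g)%E (cross @^-1` E `&` (A t `*` A t)))%E.
Proof.
move=> mE; rewrite g'E.
have mcE : measurable (cross @^-1` E) by rewrite -[X in measurable X]setTI; exact: mcross.
have mns : measurable [set z | ~~ same z].
  by apply: (@measurable_fun_pred _ _ (fun z => ~~ same z)); exact: measurable_neg.
apply: (@le_trans _ _ (Q (cross @^-1` E `|` [set z | ~~ same z]))).
  apply: le_measure; rewrite ?inE.
  - by rewrite -[X in measurable X]setTI; exact: measurable_resample.
  - exact: measurableU.
  by move=> z; rewrite /resample /=; case: ifP => [_|_ _]; [left|right].
rewrite (le_trans (measureU2 _ _ _))// [X in (_ + X)%E]not_same_fiber_null adde0.
by rewrite [leLHS]QE.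
Qed.

(** Fibers are rectangles, so that resampling does not leave them. *)
Lemma resampled_cell_le t : (g' (A t) <= (p t)%:E)%E.
Proof.
apply: (le_trans (resampled_le (mA t))); rewrite (bigD1 t)//= big1 ?adde0.
  apply: (@le_trans _ _ (((p t)^-1)%:E * (g \x g)%E (A t `*` A t))%E).
    apply: lee_wpmul2l; first by rewrite lee_fin invr_ge0.
    apply: le_measure; rewrite ?inE.
    - apply: measurableI; last exact: measurableX.
      by rewrite -[X in measurable X]setTI; exact: mcross.
    - exact: measurableX.
    by move=> z [].
  rewrite ggX// pE -!EFinM lee_fin; have [->|pt0] := eqVneq (p t) 0; first by rewrite !mulr0.
  by rewrite mulKf.
move=> u ut; rewrite (_ : _ `&` _ = set0) ?measure0 ?mule0//.
apply/seteqP; split=> // -[a b] [/= E [/= ua ub]]; move/eqP: ut; apply.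
by rewrite -E -ua; apply/esym; apply: rect; rewrite ua ub.
Qed.

Let a := pos_density mu0 m0.
Let b := pos_density mu1 m1.
Let h (z : X) : R := (p (idx z))^-1 * (a z.1 * b z.2).

Let a0 x : 0 <= a x. Proof. exact: pos_density_ge0. Qed.
Let b0 x : 0 <= b x. Proof. exact: pos_density_ge0. Qed.

Let mab : measurable_fun setT (fun z : X => a z.1 * b z.2).
Proof.
apply: measurable_funM.
  exact: (measurableT_comp (measurable_pos_density mum0) measurable_fst).
exact: (measurableT_comp (measurable_pos_density mum1) measurable_snd).
Qed.

Let mh : measurable_fun setT h.
Proof.
apply: measurable_funM => //.
exact: (measurable_fun_of_fibers (fun t => (p t)^-1) midx).
Qed.

Let h0 z : 0 <= h z.
Proof. by rewrite /h mulr_ge0 ?invr_ge0// mulr_ge0. Qed.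

(** On the cell [t] the resampled plan is at most [(p t)^-1] times the product of the
    marginals. *)
Lemma resampled_density_le E : measurable E -> (g' E <= \int[leb]_(z in E) (h z)%:E)%E.
Proof.
move=> mE; apply: (le_trans (resampled_le mE)).
rewrite integral_mkcond (ge0_integral_fin_cells midx); last 2 first.
- by apply: (measurable_restrictT _ mE).1; apply: measurable_funTS; exact/measurable_EFinP.
- by move=> z; rewrite patchE; case: ifP => // _; rewrite lee_fin.
apply: lee_sum => t _; rewrite -integral_mkcondr.
have mEA : measurable (E `&` A t) by exact: measurableI.
rewrite (eq_integral (fun z => ((p t)^-1)%:E * (a z.1 * b z.2)%:E)%E); last first.
  by move=> z /[!inE] -[/= zt _]; rewrite /h zt EFinM.
rewrite ge0_integralZl//; first last.
- by rewrite lee_fin invr_ge0.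
- by move=> z _; rewrite lee_fin mulr_ge0.
- by apply: measurable_funTS; exact/measurable_EFinP.
- by rewrite setIC.
apply: lee_wpmul2l; first by rewrite lee_fin invr_ge0.
have mAE : measurable (A t `&` E) by rewrite setIC.
apply: (@le_trans _ _ ((mu0 \x mu1)%E (A t `&` E))); last exact: (prod_pos_density_le mum0 mum1 mAE).
rewrite -cross_product_measure//; apply: le_measure; rewrite ?inE.
- apply: measurableI; first by rewrite -[X in measurable X]setTI; exact: mcross.
  exact: measurableX.
- by rewrite -[X in measurable X]setTI; exact: mcross.
move=> [w w'] [/= Ez [/= wt w't]]; split => //.
by rewrite /A /= rect// wt w't.
Qed.

(** By [resampled_density_le], the entropy of [g'] is at most that of the marginals plus
    the mean of [ln (p t)^-1]; as [g'] gives the cell of index [t] at most [p t], the latter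
    is at most [ln N] by concavity, used in the form [ln q <= q - 1] with
    [q = (p t)^-1 / N]. *)
Lemma resampled_entropy_le (N : nat) :
  mu0.-integrable setT (EFin \o (fun x => ln (density mu0 m0 x))) ->
  mu1.-integrable setT (EFin \o (fun y => ln (density mu1 m1 y))) ->
  (0 < N)%N -> (#|[pred t | g (A t) != 0%E]| <= N)%N ->
  (entropy g' leb <= (ln N%:R)%:E + entropy mu0 m0 + entropy mu1 m1)%E.
Proof.
move=> il0 il1 N0 cardN; apply: (le_trans (entropy_le mh h0 resampled_density_le)).
pose l0 x : R := ln (density mu0 m0 x); pose l1 y : R := ln (density mu1 m1 y).
have NR : 0 < N%:R :> R by rewrite ltr0n.
have g'0 t : p t = 0 -> g' (A t) = 0%E.
  by move=> pt; apply/eqP; rewrite -measure_le0; have := resampled_cell_le t; rewrite pt.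
pose q (z : X) : R := (p (idx z))^-1 / N%:R.
have q0 z : 0 <= q z by rewrite divr_ge0// invr_ge0.
have mq : measurable_fun setT q.
  exact: (measurable_fun_of_fibers (fun t => (p t)^-1 / N%:R) midx).
have q1 : (\int[g']_z (q z)%:E <= 1)%E.
  rewrite (ge0_integral_fin_cells midx); last 2 first.
  - exact/measurable_EFinP.
  - by move=> z; rewrite lee_fin.
  apply: (@le_trans _ _ (\sum_(t : T) (if g (A t) != 0%E then N%:R^-1 else 0)%:E)%E).
    apply: lee_sum => t _.
    rewrite (eq_integral (fun=> ((p t)^-1 / N%:R)%:E)); last first.
      by move=> z /[!inE] /= zt; rewrite /q zt.
    rewrite integral_cst//; have [pt|pt] := eqVneq (p t) 0.
      by rewrite [X in (_ * X)%E]g'0// mule0 lee_fin; case: ifP => // _; rewrite invr_ge0 ltW.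
    rewrite pE eqe pt; apply: (@le_trans _ _ (((p t)^-1 / N%:R)%:E * (p t)%:E)%E).
      by apply: lee_wpmul2l; [rewrite lee_fin divr_ge0// invr_ge0|exact: resampled_cell_le].
    by rewrite -EFinM lee_fin mulrAC mulVf// mul1r.
  rewrite sumEFin lee_fin -big_mkcond/= sumr_const -[leLHS]mulr_natl ler_pdivrMr// mul1r.
  by rewrite ler_nat; exact: leq_trans cardN.
have iq : g'.-integrable setT (EFin \o q).
  apply/integrableP; split; first exact/measurable_EFinP.
  under eq_integral do rewrite /= ger0_norm//.
  by rewrite (le_lt_trans q1)// ltry.
have ic : g'.-integrable setT (EFin \o (fun=> ln N%:R - 1 : R)).
  exact: (finite_measure_integrable_cst g' _).
have i0 : g'.-integrable setT ((EFin \o l0) \o fst).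
  exact: (integrable_marginal measurable_fst hg'.1 il0).
have i1 : g'.-integrable setT ((EFin \o l1) \o snd).
  exact: (integrable_marginal measurable_snd hg'.2 il1).
have icq : g'.-integrable setT (EFin \o (fun z => ln N%:R - 1 + q z)).
  exact: (integrableD measurableT ic iq).
have icq0 : g'.-integrable setT (EFin \o (fun z => ln N%:R - 1 + q z + l0 z.1)).
  exact: (integrableD measurableT icq i0).
have ik : g'.-integrable setT (EFin \o (fun z => ln N%:R - 1 + q z + l0 z.1 + l1 z.2)).
  exact: (integrableD measurableT icq0 i1).
apply: (@le_trans _ _ (\int[g']_z (ln N%:R - 1 + q z + l0 z.1 + l1 z.2)%:E)%E).
  apply: ae_le_integral.
  - by apply/measurable_EFinP; exact: (measurableT_comp (@measurable_ln R) mh).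
  - exact: measurable_int ik.
  have ae_marg d (Y : measurableType d) (mu : probability Y R) (phi : X -> Y) (B : Y -> Prop) :
      measurable_fun setT phi -> (forall E, measurable E -> pushforward g' phi E = mu E) ->
      {ae mu, forall y, B y} -> {ae g', forall z, B (phi z)}.
    move=> mphi Emu [E [mE E0 BE]]; exists (phi @^-1` E); split.
    - by rewrite -[X in measurable X]setTI; exact: mphi.
    - by rewrite -[RHS]E0 -Emu.
    - by move=> z /= nB; exact: BE.
  have ae_p : {ae g', forall z, p (idx z) != 0}.
    have mE : measurable [set z : X | p (idx z) == 0].
      apply: (@measurable_fun_pred _ _ (fun z : X => p (idx z) == 0)).
      exact: (measurable_fun_of_fibers (fun t => p t == 0) midx).
    exists [set z : X | p (idx z) == 0]; split => //; last by move=> z /negP; rewrite negbK.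
    rewrite (measure_fin_cells midx g' mE) big1// => t _.
    have [pt|pt] := eqVneq (p t) 0.
      apply/eqP; rewrite -measure_le0 -[leRHS](g'0 _ pt) le_measure ?inE//.
      exact: measurableI.
    rewrite (_ : _ `&` _ = set0) ?measure0//; apply/seteqP; split=> // z [/= /eqP + zt].
    by rewrite zt; exact/eqP.
  have ae_a := ae_marg _ _ _ _ _ measurable_fst hg'.1 (density_gt0_ae mum0).
  have ae_b := ae_marg _ _ _ _ _ measurable_snd hg'.2 (density_gt0_ae mum1).
  apply: filterS3 ae_p ae_a ae_b => z pz az bz; rewrite lee_fin.
  have pz0 : 0 < p (idx z) by rewrite lt0r pz p0.
  rewrite /h /a /b /pos_density (max_r (ltW az)) (max_r (ltW bz)).
  rewrite lnM ?posrE ?invr_gt0 ?mulr_gt0// lnM ?posrE// addrA; apply: lerD => //; apply: lerD => //.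
  rewrite -[X in ln X](divfK (lt0r_neq0 NR)) -/(q z) lnM ?posrE ?divr_gt0 ?invr_gt0//.
  have : 1 + ln (q z) <= q z.
    by rewrite (le_trans (expR_ge1Dx _))// lnK// posrE divr_gt0 ?invr_gt0.
  lra.
rewrite [leLHS](_ : _ = \int[g']_z (ln N%:R - 1 + q z)%:E + \int[g']_z (l0 z.1)%:E +
    \int[g']_z (l1 z.2)%:E)%E; last first.
  by rewrite -integralD// -integralD.
rewrite (integral_marginal measurable_fst hg'.1 il0).
rewrite (integral_marginal measurable_snd hg'.2 il1) -!entropyE//.
apply: leeD => //; apply: leeD => //.
rewrite [leLHS](integralD measurableT ic iq) integral_cst// [X in (_ * X)%E]probability_setT mule1.
rewrite (le_trans (leeD2l _ q1))// -EFinD lee_fin; lra.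
Qed.

End rectangular_resampling.

Section block_plan.
Context {R : realType} {d : nat}.
Local Notation V := 'rV[R]_d.
Local Notation X := (borel V * borel V)%type.
Local Notation leb := (lebesgue_rV d).
Variables (f : V * V -> R) (K : set (V * V)).
Variables (s : seq (set (V * V) * 'M[R]_d)) (C rho r : R).
Hypotheses (C1 : 1 <= C) (rho0 : 0 <= rho) (r0 : 0 < r).
Hypothesis sP : forall U, U \in s -> [/\ measurable (U.1 : set X),
  twisted_patch f (U.1 `&` K) U.2 C & `|U.2| <= C].
Hypothesis sball : forall p, K p -> exists2 U, U \in s & ball p r `<=` U.1.
Hypothesis Krho : forall p, K p -> `|p.1| <= rho /\ `|p.2| <= rho.
Hypothesis mK : measurable (K : set X).
Hypothesis bf : bounded_measurable (f : X -> R).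
Variables (mu0 mu1 : probability (borel V) R) (OT0 : R).
Hypotheses (mum0 : mu0 `<< leb) (mum1 : mu1 `<< leb).
Hypotheses (il0 : mu0.-integrable setT (EFin \o (fun x => ln (density mu0 leb x))))
  (il1 : mu1.-integrable setT (EFin \o (fun y => ln (density mu1 leb y)))).
Hypothesis OT0_le : forall g : probability X R, coupling mu0 mu1 g -> OT0 <= \int[g]_w f w.
Variable g : probability X R.
Hypothesis hg : coupling mu0 mu1 g.
Hypothesis gK : g (~` K) = 0%E.
Hypothesis gopt : \int[g]_w f w = OT0.

Local Notation cellT delta :=
  ('I_(size s).+1 * {ffun 'I_d -> 'I_(@cell_number R d C rho delta).+1})%type.

(** The optimal plan is resampled inside each block. Both points of a pair lie in one
    patch at distance [delta], so the mixed difference is at most [C * delta ^+ 2]; and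
    the number of charged blocks is at most [A * k.+1 ^ (2 * d) / delta ^+ d]. *)
Lemma block_plan (delta A : R) (k : nat) : 0 < delta -> delta < r -> 0 < A ->
  #|{: cellT delta}|%:R <= A / delta ^+ d -> 1 + C + d%:R * C * C <= k%:R ->
  exists g' : probability X R, [/\ coupling mu0 mu1 g',
    \int[g']_w f w <= OT0 + C * delta ^+ 2 &
    (plan_entropy g' <= (ln (A * (k.+1%:R ^+ d) ^+ 2) - d%:R * ln delta)%:E +
      entropy mu0 leb + entropy mu1 leb)%E].
Proof.
move=> delta0 deltar A0 cA kC.
have scov p : K p -> exists2 U, U \in s & U.1 p.
  by move=> /sball[U Us bU]; exists U => //; apply: bU; exact: ballxx.
pose blk : X -> _ := block rho delta.
have mblk : measurable_fibers blk by exact: measurable_block.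
have [Q [hQ QE _]] := fin_cell_coupling_exists g mblk.
have msame : measurable_fun setT (same_fiber (K : set X) blk) by exact: measurable_same_fiber.
have [g' [hg' g'E g'f]] := resample_plan hg hQ msame (same_fiberC (K : set X) blk) bf.
have bD := bounded_measurable_mixed_diff bf msame.
exists g'; split => //.
  rewrite g'f gopt; set I := \int[Q]_z _.
  suff : - (C * delta ^+ 2) <= I.
    have : 0 <= C * delta ^+ 2 by rewrite mulr_ge0 ?sqr_ge0// (le_trans ler01).
    lra.
  have -> : - (C * delta ^+ 2) = \int[Q]_z (- (C * delta ^+ 2)).
    by rewrite Rintegral_cst// [X in fine X]probability_setT mulr1.
  apply: le_Rintegral_bounded; first exact: bounded_measurable_cst.
    exact: bD.
  have C0 : 0 <= C by exact: le_trans C1.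
  move=> [w w']; case: ifP => [/and3P[/set_mem Kw /set_mem Kw' /eqP /= E]|_]; last first.
    by rewrite oppr_le0 mulr_ge0 ?sqr_ge0.
  have [w1 w2] := Krho Kw; have [w1' w2'] := Krho Kw'.
  have d1 : `|w'.1 - w.1| <= delta.
    by apply: (grid_close delta0 (@block_number_gt R rho delta)) => //; exact: (esym (congr1 fst E)).
  have d2 : `|w'.2 - w.2| <= delta.
    by apply: (grid_close delta0 (@block_number_gt R rho delta)) => //; exact: (esym (congr1 snd E)).
  have [U Us bU] := sball Kw; have [_ tw _] := sP Us.
  have Uw : (U.1 `&` K) w by split => //; apply: bU; exact: ballxx.
  have Uw' : (U.1 `&` K) w'.
    split => //; apply: bU; split; rewrite -ball_normE /ball_ /=; rewrite distrC.
      exact: le_lt_trans d1 deltar.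
    exact: le_lt_trans d2 deltar.
  have [+ _] := tw _ _ Uw Uw'; rewrite ler_norml => /andP[+ _]; apply: le_trans.
  by rewrite lerN2 expr2 ler_wpM2l// ler_pM.
have rect w w' : blk w = blk w' -> blk (w.1, w'.2) = blk w.
  by move=> E; rewrite /blk /block /=; congr pair; exact: (esym (congr1 snd E)).
set N := (#|{: cellT delta}| * (k.+1 ^ d * k.+1 ^ d))%N.
have N0 : (0 < N)%N.
  rewrite !muln_gt0 !expn_gt0/= andbT; apply/card_gt0P.
  by exists (ord0, [ffun=> ord0]); rewrite inE.
have cN : (#|[pred B | g (blk @^-1` [set B]) != 0%E]| <= N)%N.
  have PC := positive_blocks_card C1 sP scov Krho mK bf delta0 OT0_le hg gK gopt kC. exact: PC.
apply: (le_trans (resampled_entropy_le mum0 mum1 hg mblk mK gK rect hQ QE hg' g'E il0 il1 N0 cN)).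
apply: leeD => //; apply: leeD => //; rewrite lee_fin.
have k0 : 0 < A * (k.+1%:R ^+ d) ^+ 2 by rewrite mulr_gt0// !exprn_gt0.
rewrite [X in _ - X]mulr_natl -lnXn// -ln_div ?posrE ?exprn_gt0//.
rewrite ler_ln ?posrE ?ltr0n// ?divr_gt0 ?exprn_gt0//.
rewrite natrM natrM natrX -expr2 mulrAC ler_pM2r//.
Qed.

End block_plan.

(** * Bounds uniform over all plans *)

Section coupling_support.
Context {R : realType} {d : nat}.
Local Notation V := 'rV[R]_d.
Local Notation X := (borel V * borel V)%type.
Variables (mu0 mu1 : probability (borel V) R).

Lemma compact_norm_le (K : set V) : compact K ->
  exists2 rho : R, 0 < rho & forall x, K x -> `|x| <= rho.
Proof. by move=> /compact_bounded/pinfty_ex_gt0[M M0 h]; exists M. Qed.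

(** Each factor of the complement is null for the corresponding marginal. *)
Lemma coupling_support (g : probability X R) : coupling mu0 mu1 g ->
  g (~` (msupport mu0 `*` msupport mu1)) = 0%E.
Proof.
move=> [g0 g1].
have mC (mu : probability (borel V) R) : measurable (~` msupport mu : set (borel V)).
  by apply: measurableC; exact: measurable_msupport.
have m0 : measurable (fst @^-1` (~` msupport mu0) : set X).
  by rewrite -[X in measurable X]setTI; exact: measurable_fst.
have m1 : measurable (snd @^-1` (~` msupport mu1) : set X).
  by rewrite -[X in measurable X]setTI; exact: measurable_snd.
have G0 : g (fst @^-1` (~` msupport mu0)) = 0%E.
  by rewrite [LHS]g0 ?measure_msupportC.
have G1 : g (snd @^-1` (~` msupport mu1)) = 0%E.
  by rewrite [LHS]g1 ?measure_msupportC.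
rewrite (_ : ~` _ = fst @^-1` (~` msupport mu0) `|` snd @^-1` (~` msupport mu1)); last first.
  apply/seteqP; split=> [[x y] /= /not_andP//|[x y] /= h [hx hy]].
  by case: h.
apply/eqP; rewrite -measure_le0 (le_trans (measureU2 _ m0 m1))//.
by rewrite [X in (X + _)%E]G0 [X in (_ + X)%E]G1 adde0.
Qed.

(** [entropy_integrable] on the support, which lies in a box. *)
Lemma compact_entropy_integrable (mu : probability (borel V) R) :
  compact (msupport mu) -> mu `<< lebesgue_rV d ->
  (entropy mu (lebesgue_rV d) < +oo)%E ->
  mu.-integrable setT (EFin \o (fun x => ln (density mu (lebesgue_rV d) x))).
Proof.
move=> cK muleb Hoo.
apply: (entropy_integrable muleb (measurable_msupport mu) (measure_msupportC mu)) => //.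
have [rho rho0 Krho] := compact_norm_le cK.
have rho1 : 0 <= rho + 1 by rewrite addr_ge0// ltW.
have [B [mB ballB BE]] := lebesgue_ball_le (0 : V) rho1.
apply: (@le_lt_trans _ _ (lebesgue_rV d B)); last by rewrite BE ltry.
apply: le_measure; rewrite ?inE//; first exact: measurable_msupport.
by move=> x Kx; apply: ballB; rewrite subr0 (le_lt_trans (Krho _ Kx))// ltrDl.
Qed.

Variables (Omega : set V) (c : V * V -> R).
Hypotheses (oOmega : open Omega)
  (cc : forall z, (Omega `*` Omega) z -> {for z, continuous c}).
Hypotheses (cpt0 : compact (msupport mu0)) (cpt1 : compact (msupport mu1)).
Hypotheses (sub0 : msupport mu0 `<=` Omega) (sub1 : msupport mu1 `<=` Omega).

Let K : set (V * V) := msupport mu0 `*` msupport mu1.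
Let f (z : V * V) : R := if z \in K then c z else 0.

Let KO : K `<=` Omega `*` Omega.
Proof. by move=> z [/sub0 ? /sub1 ?]. Qed.

Let mK : measurable (K : set X).
Proof. by apply: measurableX; exact: measurable_msupport. Qed.

Let mOO : measurable (Omega `*` Omega : set X).
Proof. by apply: measurableX; exact: borel_open. Qed.

Lemma bounded_measurable_cost : bounded_measurable (f : X -> R).
Proof.
have mc : measurable_fun (Omega `*` Omega : set X) (c : X -> R).
  by apply: continuous_product_measurable => //; exact: open_setX.
split.
  apply: measurable_fun_if => //; first exact: measurable_fun_mem.
  rewrite setTI; apply: (measurable_funS mOO) mc => z /= /set_mem; exact: KO.
have : compact (c @` K).
  apply: continuous_compact; last exact: compact_setX.
  by apply: continuous_in_subspaceT => z /set_mem/KO; exact: cc.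
move=> /compact_bounded/pinfty_ex_gt0[M M0 h]; exists M => z; rewrite /f.
case: ifP => [/set_mem Kz|_]; last by rewrite normr0 ltW.
by apply: h; exists z.
Qed.

(** Couplings do not charge the complement of the product of the supports, so that the
    cost may be cut off there, which makes it bounded. *)
Lemma transport_costE (g : probability X R) : coupling mu0 mu1 g ->
  transport_cost Omega c g = (\int[g]_z f z)%:E.
Proof.
move=> hg; have gK := coupling_support hg.
have [mf _] := bounded_measurable_cost.
have mc : measurable_fun (Omega `*` Omega : set X) (c : X -> R).
  by apply: continuous_product_measurable => //; exact: open_setX.
rewrite [RHS]fineK; last exact/integrable_fin_num/bounded_measurable_integrable/bounded_measurable_cost.
rewrite /transport_cost (ae_eq_integral (EFin \o (f : X -> R)))//; first last.
- exists (~` K); split => //; first exact: measurableC.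
  by move=> z /= + Kz; apply=> _; rewrite /f mem_set.
- by apply: measurable_funTS; exact/measurable_EFinP.
- exact/measurable_EFinP.
rewrite integral_mkcond; apply: eq_integral => z _; rewrite patchE /f /=.
case: ifP => // /negP nO; case: ifP => // /set_mem/KO Oz.
by exfalso; apply: nO; exact: mem_set.
Qed.

End coupling_support.

Section plan_bounds.
Context {R : realType} {d : nat}.
Local Notation V := 'rV[R]_d.
Local Notation plan := (probability (borel V * borel V)%type R).

(** What the geometry of the problem contributes to the asymptotics: a lower bound on the
    entropy valid for all plans at all scales up to [1], and at each small scale a nearly optimal
    plan of matching entropy. *)
Lemma plan_bounds (Omega : set V) (c : V * V -> R)
    (mu0 mu1 : probability (borel V) R) (gamma0 : plan) :
  open Omega -> class_C 2 (Omega `*` Omega) c -> infinitesimally_twisted Omega c ->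
  compactly_supported_in Omega mu0 -> compactly_supported_in Omega mu1 ->
  mu0 `<< lebesgue_rV d -> mu1 `<< lebesgue_rV d ->
  (entropy mu0 (lebesgue_rV d) < +oo)%E -> (entropy mu1 (lebesgue_rV d) < +oo)%E ->
  minimizer_on (coupling mu0 mu1) (transport_cost Omega c) gamma0 ->
  exists (cost : plan -> R) (r L : R), [/\ 0 < r, 0 < L,
    (forall g, coupling mu0 mu1 g -> transport_cost Omega c g = (cost g)%:E /\
      cost gamma0 <= cost g),
    (forall g delta, coupling mu0 mu1 g -> 0 < delta -> delta <= 1 ->
      ((- (d%:R * ln delta) - L * (1 + (cost g - cost gamma0) / delta ^+ 2))%:E
       <= plan_entropy g)%E) &
    (forall delta, 0 < delta -> delta <= 1 -> delta < r ->
      exists g, [/\ coupling mu0 mu1 g, cost g <= cost gamma0 + L * delta ^+ 2 &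
        (plan_entropy g <= (- (d%:R * ln delta) + L)%:E)%E])].
Proof.
move=> oO cC tw [cpt0 sub0] [cpt1 sub1] mum0 mum1 H0 H1 [hg0 gamma0_min].
pose K : set (V * V) := msupport mu0 `*` msupport mu1.
have mK : measurable (K : set (borel V * borel V)%type).
  by apply: measurableX; exact: measurable_msupport.
have KO : K `<=` Omega `*` Omega by move=> z [/sub0 ? /sub1 ?].
have cK : compact K by exact: compact_setX.
have cc z : (Omega `*` Omega) z -> {for z, continuous c}.
  by move=> Oz; apply: differentiable_continuous; exact: cC.1.
pose f (z : V * V) : R := if z \in K then c z else 0.
have bf : bounded_measurable (f : (borel V * borel V)%type -> R).
  exact: (bounded_measurable_cost oO cc cpt0 cpt1 sub0 sub1).
have costE (g : plan) : coupling mu0 mu1 g -> transport_cost Omega c g = (\int[g]_z f z)%:E.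
  exact: (transport_costE oO cc cpt0 cpt1 sub0 sub1).
have OT0_le (g : plan) : coupling mu0 mu1 g -> \int[gamma0]_z f z <= \int[g]_z f z.
  by move=> hg; rewrite -lee_fin -!costE//; exact: gamma0_min.
have gK (g : plan) : coupling mu0 mu1 g -> g (~` K) = 0%E by exact: coupling_support.
have il0 := compact_entropy_integrable cpt0 mum0 H0.
have il1 := compact_entropy_integrable cpt1 mum1 H1.
have [s [r [C [r0 C1 sP sball]]]] := patches_exist oO cC tw cK KO.
(* [K] is a product, hence contains the exchanged points *)
have fK p q : K p -> K q -> mixed_diff f p q = mixed_diff c p q.
  move=> [p1 p2] [q1 q2]; rewrite /mixed_diff /f !mem_set//; split=> //.
have sP' U : U \in s -> [/\ measurable (U.1 : set (borel V * borel V)%type),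
    twisted_patch f (U.1 `&` K) U.2 C & `|U.2| <= C].
  move=> /sP[oU twU UC]; split => //; first exact: open_product_measurable.
  by move=> p q [Up Kp] [Uq Kq]; rewrite fK//; exact: twU.
have scov p : K p -> exists2 U, U \in s & U.1 p.
  by move=> /sball[U Us bU]; exists U => //; apply: bU; exact: ballxx.
have [rho0 rho0_gt0 K0le] := compact_norm_le cpt0.
have [rho1 rho1_gt0 K1le] := compact_norm_le cpt1.
pose rho := rho0 + rho1.
have rho_ge0 : 0 <= rho by rewrite addr_ge0// ltW.
have Krho p : K p -> `|p.1| <= rho /\ `|p.2| <= rho.
  move=> [/K0le p0 /K1le p1]; split.
    by rewrite (le_trans p0)// lerDl ltW.
  by rewrite (le_trans p1)// lerDr ltW.
have [A [A0 cA]] := card_sheared_cells s C1 rho_ge0.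
have [k kC] : exists k : nat, 1 + C + d%:R * C * C <= k%:R.
  by exists (Num.truncn (1 + C + d%:R * C * C)).+1; rewrite ltW// truncnS_gt.
have C0 : 0 < C by exact: lt_le_trans C1.
set Lk := ln (A * (k.+1%:R ^+ d) ^+ 2).
set h0 := fine (entropy mu0 (lebesgue_rV d)); set h1 := fine (entropy mu1 (lebesgue_rV d)).
pose d1 : R := d%:R + 1.
have d1_gt0 : 0 < d1 by rewrite ltr_wpDl.
have ln2 : 0 <= ln (2 : R) by rewrite ln_ge0// ler1n.
pose a := `|ln A| + 2 * d%:R * ln 2 + d1 * (2 + C ^+ 2).
pose b := 2 * C * d1.
pose u := `|Lk| + `|h0| + `|h1|.
pose L := a + b + u + C.
have a0 : 0 <= a by rewrite !addr_ge0 ?mulr_ge0 ?addr_ge0 ?sqr_ge0.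
have b0 : 0 <= b by rewrite !mulr_ge0// ltW.
have u0 : 0 <= u by rewrite !addr_ge0.
have [aL bL uL CL] : [/\ a <= L, b <= L, u <= L & C <= L].
  by move: a0 b0 u0 C0; clearbody a b u; clear; rewrite /L => *; split; lra.
exists (fun g : plan => \int[g]_z f z), r, L; split => //.
- exact: lt_le_trans CL.
- by move=> g hg; rewrite costE//; split=> //; exact: OT0_le.
- move=> g delta hg delta0 delta1.
  apply: le_trans (plan_entropy_ge C1 rho_ge0 sP' scov Krho mK bf delta0 gK OT0_le hg A0 (cA _ delta0 delta1)).
  rewrite lee_fin; set E := \int[g]_z f z - \int[gamma0]_z f z.
  have E0 : 0 <= E by rewrite subr_ge0 OT0_le.
  have d2 : 0 < delta ^+ 2 by rewrite exprn_gt0.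
  have -> : (2 * C * E + C ^+ 2 * delta ^+ 2) / delta ^+ 2 = 2 * C * (E / delta ^+ 2) + C ^+ 2.
    by field; rewrite gt_eqF.
  have : 0 <= E / delta ^+ 2 by rewrite divr_ge0// ltW.
  set q := E / _ => q0.
  rewrite -addrA lerD2l -/d1 -opprD lerN2 [L * _]mulrDr mulr1.
  apply: (@le_trans _ _ (a + b * q)); last by rewrite lerD// ler_wpM2r.
  have -> : a + b * q = `|ln A| + 2 * d%:R * ln 2 + d1 * (2 + (2 * C * q + C ^+ 2)).
    by rewrite /a /b; ring.
  by rewrite lerD2r lerD2r ler_norm.
move=> delta delta0 delta1 deltar.
have [g [hg gf gH]] := block_plan C1 r0 sP' sball Krho mK bf mum0 mum1 il0 il1 OT0_le
  hg0 (gK _ hg0) erefl delta0 deltar A0 (cA _ delta0 delta1) kC.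
exists g; split => //.
  apply: (le_trans gf); by rewrite lerD2l ler_wpM2r ?sqr_ge0.
apply: (le_trans gH).
have f0 : (entropy mu0 (lebesgue_rV d)) \is a fin_num.
  by rewrite entropyE//; exact: integrable_fin_num.
have f1 : (entropy mu1 (lebesgue_rV d)) \is a fin_num.
  by rewrite entropyE//; exact: integrable_fin_num.
rewrite -(fineK f0) -(fineK f1) -!EFinD lee_fin -/h0 -/h1 -/Lk.
rewrite -!addrA [leLHS]addrCA lerD2l; apply: le_trans uL.
by rewrite /u -addrA !lerD// ler_norm.
Qed.

End plan_bounds.

(** * Asymptotics of the regularized problem *)

Section asymptotics.
Context {R : realType}.

(** [E e] and [h e] stand for the cost gap and the entropy of the minimizer at [e], and
    [K] for half the dimension. Taking [t] of order [e] in both bounds locates the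
    minimum [E e + e * h e]; comparing the minimizers at [e], [2 * e] and [e / 2] gives
    [h e]; the gap is what remains, and the lower bound at [t = rho * e] keeps it away
    from [0]. *)
Lemma entropic_asymptotics (K L r : R) (E h : R -> R) : 0 < K -> 0 < L -> 0 < r ->
  (forall e e', 0 < e -> 0 < e' -> E e + e * h e <= E e' + e * h e') ->
  (forall e t, 0 < e -> 0 < t -> t <= 1 -> - (K * ln t) - L * (1 + E e / t) <= h e) ->
  (forall e t, 0 < e -> 0 < t -> t <= 1 -> t < r ->
    E e + e * h e <= L * t + e * (- (K * ln t) + L)) ->
  exists a b e0 : R, [/\ 0 < a, 0 < e0 & forall e, 0 < e -> e < e0 ->
    [/\ a * e <= E e <= b * e, `|h e + K * ln e| <= b &
        `|E e + e * h e + K * (e * ln e)| <= b * e]].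
Proof.
move=> K0 L0 r0 minE lb ub.
pose e1 := Num.min (Num.min 1 L^-1) r.
have e1_gt0 : 0 < e1 by rewrite !lt_min ltr01 invr_gt0 L0 r0.
pose C1 := 2 * L + K * `|ln L|.
have KlnL : 0 <= K * `|ln L| by rewrite mulr_ge0// ltW.
have C1_gt0 : 0 < C1 by rewrite /C1; lra.
have FE e : 0 < e -> e < e1 -> `|E e + e * h e + K * (e * ln e)| <= C1 * e.
  move=> e0; rewrite !lt_min => /andP[/andP[e_lt1 eL] er].
  have h1 := ub e e e0 e0 (ltW e_lt1) er.
  have t0 : 0 < L * e by rewrite mulr_gt0.
  have tle1 : L * e <= 1 by rewrite -ler_pdivlMl// mulr1 ltW.
  (* with [t = L * e] the gap cancels in [E e + e * h e] *)
  have h2 := lb e (L * e) e0 t0 tle1.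
  have {}h2 := ler_wpM2l (ltW e0) h2.
  rewrite lnM ?posrE// in h2.
  have E2 : e * (- (K * (ln L + ln e)) - L * (1 + E e / (L * e))) =
    - (K * (e * ln e)) - e * (K * ln L) - e * L - E e.
    by field; rewrite !gt_eqF.
  rewrite E2 in h2.
  have eK : e * (K * ln L) <= e * (K * `|ln L|).
    by rewrite ler_pM2l// ler_pM2l// ler_norm.
  have eK0 : 0 <= e * (K * `|ln L|) by rewrite mulr_ge0// ltW.
  have eL0 : 0 < e * L by rewrite mulr_gt0.
  rewrite ler_norml; apply/andP; rewrite /C1; split; lra.
pose C2 := 3 * C1 + 2 * K * ln 2.
have ln2 : 0 <= ln (2 : R) by rewrite ln_ge0// ler1n.
have Kln2 : 0 <= 2 * K * ln (2 : R) by rewrite !mulr_ge0// ltW.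
have hE e : 0 < e -> e < e1 / 2 -> `|h e + K * ln e| <= C2.
  move=> e0 e1e.
  have ee1 : e < e1 by lra.
  have := FE e e0 ee1; rewrite ler_norml => /andP[F1 F2].
  have e20 : 0 < 2 * e by lra.
  have e2e1 : 2 * e < e1 by lra.
  have := FE _ e20 e2e1; rewrite ler_norml => /andP[G1 G2].
  have eh0 : 0 < e / 2 by lra.
  have ehe1 : e / 2 < e1 by lra.
  have := FE _ eh0 ehe1; rewrite ler_norml => /andP[H1 H2].
  have M1 := minE _ _ e20 e0; have M2 := minE _ _ eh0 e0.
  rewrite lnM ?posrE// in G1 G2; rewrite ln_div ?posrE// in H1 H2.
  have e2l : 0 <= e * (2 * K * ln 2) by rewrite mulr_ge0// ltW.
  have X1 : - C2 * e <= (h e + K * ln e) * e by rewrite /C2; lra.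
  have X2 : (h e + K * ln e) * e <= C2 * e by rewrite /C2; lra.
  by rewrite ler_norml; apply/andP; split; rewrite -(ler_pM2r e0).
(* then [- K * ln rho = L + C2 + 1], which exceeds the other constants by [1] *)
pose rho := expR (- ((L + C2 + 1) / K)).
have C2_gt0 : 0 < C2 by rewrite /C2; lra.
have LC0 : 0 <= (L + C2 + 1) / K by rewrite divr_ge0 ?ltW//; lra.
have rho0 : 0 < rho by exact: expR_gt0.
have rho1 : rho <= 1 by rewrite expR_le1 oppr_le0.
exists (rho / L), (C1 + C2), (e1 / 2); split; [exact: divr_gt0|exact: divr_gt0|].
move=> e e0 ee1; have ee1' : e < e1 by lra.
have F := FE e e0 ee1'; have H := hE e e0 ee1.
have e_lt1 : e < 1 by move: ee1'; rewrite !lt_min => /andP[/andP[]].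
have C2e : 0 < C2 * e by rewrite mulr_gt0.
split; last 2 first.
- by apply: (le_trans H); lra.
- by apply: (le_trans F); lra.
move: F H; rewrite !ler_norml => /andP[F1 F2] /andP[H1 H2].
apply/andP; split; last first.
  have := ler_wpM2r (ltW e0) H1; lra.
have t0 : 0 < rho * e by rewrite mulr_gt0.
have tle1 : rho * e <= 1 by rewrite mulr_ile1// ltW.
have lbt := lb e (rho * e) e0 t0 tle1.
rewrite lnM ?posrE// expRK in lbt.
have Eq : - (K * (- ((L + C2 + 1) / K) + ln e)) = L + C2 + 1 - K * ln e.
  by field; rewrite gt_eqF.
rewrite Eq in lbt.
have : 1 <= L * (E e / (rho * e)) by lra.
rewrite mulrA ler_pdivlMr// mul1r => X.
by rewrite mulrAC ler_pdivrMr// [leRHS]mulrC.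
Qed.

End asymptotics.

Theorem theorem4p8 (R : realType) (d : nat) (Omega : set 'rV[R]_d)
    (c : 'rV[R]_d * 'rV[R]_d -> R)
    (mu0 mu1 : probability (borel 'rV[R]_d) R)
    (gamma : R -> probability (borel 'rV[R]_d * borel 'rV[R]_d)%type R)
    (gamma0 : probability (borel 'rV[R]_d * borel 'rV[R]_d)%type R) :
  (0 < d)%N ->
  open Omega ->
  class_C 2 (Omega `*` Omega) c ->
  infinitesimally_twisted Omega c ->
  compactly_supported_in Omega mu0 ->
  compactly_supported_in Omega mu1 ->
  mu0 `<< lebesgue_rV d ->
  mu1 `<< lebesgue_rV d ->
  (entropy mu0 (lebesgue_rV d) < +oo)%E ->
  (entropy mu1 (lebesgue_rV d) < +oo)%E ->
  (forall e, 0 < e ->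
    minimizer_on (coupling mu0 mu1) (entropic_cost Omega c e) (gamma e)) ->
  minimizer_on (coupling mu0 mu1) (transport_cost Omega c) gamma0 ->
  [/\ Theta_at0 (fun e =>
        transport_cost Omega c (gamma e) - transport_cost Omega c gamma0)%E,
      (exists2 r : R -> R, r =O_ (0^'+) (fun=> 1 : R) &
        \forall e \near 0^'+,
          plan_entropy (gamma e) = (- (d%:R / 2) * ln e + r e)%:E) &
      (exists2 r : R -> R, r =O_ (0^'+) (fun e => e : R) &
        \forall e \near 0^'+,
          entropic_OT Omega c mu0 mu1 e =
            (OT Omega c mu0 mu1 + (- (d%:R * e / 2) * ln e + r e)%:E)%E)].
Proof.
move=> d0 oO cC tw cs0 cs1 mum0 mum1 H0 H1 gamma_min gamma0_min.
have [cost [r [L [r0 L0 costE lb ub]]]] :=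
  plan_bounds oO cC tw cs0 cs1 mum0 mum1 H0 H1 gamma0_min.
have hgamma e : 0 < e -> coupling mu0 mu1 (gamma e) by move=> /gamma_min[].
pose h e := fine (plan_entropy (gamma e)).
pose t1 := Num.min 1 (r / 2).
have t1_gt0 : 0 < t1 by rewrite lt_min ltr01 divr_gt0.
have t1_le1 : t1 <= 1 by rewrite ge_min lexx.
have t1r : t1 < r by rewrite gt_min; apply/orP; right; lra.
have costP e (g : probability (borel 'rV[R]_d * borel 'rV[R]_d)%type R) :
    coupling mu0 mu1 g ->
    entropic_cost Omega c e g = ((cost g)%:E + e%:E * plan_entropy g)%E.
  by move=> hg; rewrite /entropic_cost (costE _ hg).1.
have entropyE e : 0 < e -> plan_entropy (gamma e) = (h e)%:E.
  move=> e0; rewrite fineK// fin_numE; apply/andP; split.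
    rewrite gt_eqF// (lt_le_trans _ (lb _ _ (hgamma _ e0) t1_gt0 t1_le1))//.
    exact: ltNyr.
  have [g [hg _ gH]] := ub _ t1_gt0 t1_le1 t1r.
  have := (gamma_min e e0).2 g hg; rewrite !costP//; last exact: hgamma.
  apply: contraTN => /eqP ->; rewrite gt0_muley ?lte_fin// addey//.
  rewrite -ltNge; apply: lte_add_pinfty; first exact: ltry.
  apply: (le_lt_trans (lee_wpmul2l _ gH)); first by rewrite lee_fin ltW.
  by rewrite -EFinM ltry.
have valueE e e' : 0 < e' ->
    entropic_cost Omega c e (gamma e') = (cost (gamma e') + e * h e')%:E.
  by move=> e'0; rewrite costP ?entropyE//; exact: hgamma.
pose E e := cost (gamma e) - cost gamma0.
have dK : 0 < d%:R / 2 :> R by rewrite divr_gt0// ltr0n.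
(* the scale [delta] of the geometric bounds is [Num.sqrt t] *)
have ln_sqrt t : 0 < t -> d%:R * ln (Num.sqrt t) = d%:R / 2 * ln t :> R.
  move=> t0; rewrite -[in RHS](sqr_sqrtr (ltW t0)) lnXn ?sqrtr_gt0// -mulr_natl.
  by field.
have sqrt_le1 t : t <= 1 -> Num.sqrt t <= 1 :> R.
  by move=> t1'; rewrite -[leRHS]sqrtr1 ler_wsqrtr.
have minE e e' : 0 < e -> 0 < e' -> E e + e * h e <= E e' + e * h e'.
  move=> e0 e'0; have := (gamma_min e e0).2 _ (hgamma _ e'0).
  by rewrite !valueE// lee_fin /E; lra.
have lbE e t : 0 < e -> 0 < t -> t <= 1 ->
    - (d%:R / 2 * ln t) - L * (1 + E e / t) <= h e.
  move=> e0 t0 tle1; have st0 : 0 < Num.sqrt t by rewrite sqrtr_gt0.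
  have := lb _ _ (hgamma _ e0) st0 (sqrt_le1 _ tle1).
  by rewrite entropyE// lee_fin ln_sqrt// sqr_sqrtr ?(ltW t0).
have r20 : 0 < r ^+ 2 by rewrite exprn_gt0.
have ubE e t : 0 < e -> 0 < t -> t <= 1 -> t < r ^+ 2 ->
    E e + e * h e <= L * t + e * (- (d%:R / 2 * ln t) + L).
  move=> e0 t0 tle1 tr; have st0 : 0 < Num.sqrt t by rewrite sqrtr_gt0.
  have str : Num.sqrt t < r by rewrite -[ltRHS]gtr0_norm// -sqrtr_sqr ltr_sqrt.
  have [g [hg gc gH]] := ub _ st0 (sqrt_le1 _ tle1) str.
  rewrite ln_sqrt// in gH; rewrite sqr_sqrtr ?(ltW t0)// in gc.
  have := (gamma_min e e0).2 _ hg; rewrite valueE// costP// => le.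
  have := le_trans le (leeD2l _ (lee_wpmul2l _ gH)).
  by rewrite lee_fin (ltW e0) -EFinM -EFinD lee_fin /E => /(_ isT); lra.
have [a [b [e0 [a0 e0_gt0 bounds]]]] := entropic_asymptotics dK L0 r20 minE lbE ubE.
have near_bounds (P : R -> Prop) : (forall e, 0 < e -> e < e0 -> P e) ->
    \forall e \near 0^'+, P e.
  move=> HP; near=> e; apply: HP; first by near: e; exact: nbhs_right_gt.
  by near: e; exact: nbhs_right_lt.
have OTE : OT Omega c mu0 mu1 = (cost gamma0)%:E.
  rewrite -(costE _ gamma0_min.1).1; apply/eqP; rewrite eq_le; apply/andP; split.
    by apply: ereal_inf_lbound; exists gamma0 => //; exact: gamma0_min.1.
  by apply: le_ereal_inf_tmp => _ [g hg <-]; exact: gamma0_min.2.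
have entropic_OTE e : 0 < e ->
    entropic_OT Omega c mu0 mu1 e = (cost (gamma e) + e * h e)%:E.
  move=> e_gt0; rewrite -valueE//; apply/eqP; rewrite eq_le; apply/andP; split.
    by apply: ereal_inf_lbound; exists (gamma e) => //; exact: hgamma.
  by apply: le_ereal_inf_tmp => _ [g hg <-]; exact: (gamma_min e e_gt0).2.
have big_O (u v : R -> R) :
    (forall e, 0 < e -> e < e0 -> `|u e| <= b * `|v e|) -> u =O_ (0^'+) v.
  move=> uv; apply/eqOP; exists b; split=> [|k bk]; first exact: num_real.
  apply: near_bounds => e e_gt0 elt.
  apply: (le_trans (uv e e_gt0 elt)); apply: ler_wpM2r => //.
  exact: ltW.
split.
- exists a, (Num.max a b); split => //; first by rewrite le_max lexx.
  apply: near_bounds => e e_gt0 elt; have [/andP[lo hi] _ _] := bounds e e_gt0 elt.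
  rewrite (costE _ (hgamma _ e_gt0)).1 (costE _ gamma0_min.1).1 -EFinB !lee_fin lo/=.
  by apply: (le_trans hi); rewrite ler_pM2r// le_max lexx orbT.
- exists (fun e => h e + d%:R / 2 * ln e).
    by apply: big_O => e e_gt0 elt; rewrite normr1 mulr1; have [] := bounds e e_gt0 elt.
  apply: near_bounds => e e_gt0 _; rewrite entropyE//; congr EFin; ring.
exists (fun e => E e + e * h e + d%:R / 2 * (e * ln e)).
  apply: big_O => e e_gt0 elt; rewrite [X in b * X]gtr0_norm//.
  by have [] := bounds e e_gt0 elt.
apply: near_bounds => e e_gt0 _; rewrite entropic_OTE// OTE -EFinD /E; congr EFin.
field.
Unshelve. all: by end_near.
Qed.
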